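(* Let $(\mathbb{L}_n(k))_{k\in\mathbb{Z}}$ be the external profile of a binary search tree with $n+1$ external nodes. For every $r\in\mathbb{N}_0$, almost surely, as $n\to\infty$, $$ (\log n)^{\frac{r+1}{2}}\sup_{k\in\mathbb{Z}}\left|\frac1n\mathbb{L}_n(k)-\frac{e^{-\frac{(k-2\log n)^2}{4\log n}}}{\sqrt{4\pi\log n}}\sum_{j=0}^r G_j\left(\frac{k-2\log n}{\sqrt{2\log n}};0\right)\frac{1}{(\log n)^{j/2}}\right|\longrightarrow 0, $$ where $$ G_j(x;0)=\frac{(-1)^j}{j!}\,e^{\frac12x^2}B_j(D_1,\ldots,D_j)e^{-\frac12x^2},\qquad D_j=\frac{2}{(j+1)(j+2)}\left(\frac{1}{\sqrt2}\frac{d}{dx}\right)^{j+2}+\chi_j(0)\left(\frac1{\sqrt2}\frac{d}{dx}\right)^{j}, $$ is a polynomial in $x$ of degree at most $3j$ whose coefficients are linear combinations (with deterministic coefficients) of $1,W_\infty'(0),\ldots,W_\infty^{(j)}(0)$. For example, $G_0(x;0)=1$ and $G_1(x;0)=\frac1{\sqrt2}\left(W_\infty'(0)x+\frac{x^3-3x}{6}\right)$.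
   Context: Binary search tree (BST) process: at time $n=0$ there is one external node, the root, at depth $0$. At each step one of the existing external nodes is picked uniformly at random (independently of the past given the current tree), declared internal, and connected to two new external nodes, each of depth one larger than that of the picked node. After $n$ steps the tree has $n$ internal and $n+1$ external nodes; the trees for all $n$ are defined on one probability space through this evolution. The depth of a node is its distance to the root. $\mathbb{L}_n(k)$ is the number of external nodes at depth $k$ after $n$ steps ($\mathbb{L}_n(k)=0$ for $k<0$); $x_{1,n},\dots,x_{n+1,n}$ are the depths of the external nodes. Let $\beta_-\approx-1.678$ and $\beta_+\approx0.768$ be the solutions of $2e^\beta(1-\beta)=1$, and let $W_n(\beta)=n^{-(2e^\beta-1)}\sum_{i=1}^{n+1}e^{\beta x_{i,n}}$, $\beta\in\mathbb{C}$. There are an open set $\mathscr{D}\subset\mathbb{C}$ containing $(\beta_-,\beta_+)$ and a random analytic function $W_\infty$ on $\mathscr{D}$ such that, almost surely, $W_n\to W_\infty$ uniformly on compact subsets of $\mathscr{D}$; one has $W_\infty(0)=1$, and almost surely $W_\infty$ has no zeros on $(\beta_-,\beta_+)$. Put $\chi_j(0)=(\log W_\infty)^{(j)}(0)$, $j\in\mathbb{N}$. The complete Bell polynomials $B_j(z_1,\dots,z_j)$ are defined by the formal identity $\exp\{\sum_{j\ge1}\frac{x^j}{j!}z_j\}=\sum_{j\ge0}\frac{x^j}{j!}B_j(z_1,\dots,z_j)$ (so $B_0=1$); they are applied to the commuting differential operators $D_1,D_2,\dots$. $\mathbb{N}_0=\{0,1,2,\dots\}$. *)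

(* Defs.v *)
From HB Require Import structures.
From mathcomp Require Export all_boot all_order all_algebra complex.
From mathcomp Require Export all_classical all_reals all_analysis.
Export Order.TTheory GRing.Theory Num.Theory numFieldNormedType.Exports.

Set Implicit Arguments.
Unset Strict Implicit.
Unset Printing Implicit Defensive.

Local Open Scope classical_set_scope.
Local Open Scope ring_scope.
Local Open Scope complex_scope.

(* A node is the left/right word describing the path from the root to it, so
   its depth is its size. *)
Definition node := seq bool.

(* [picks i] is the external node of the tree after [i] steps that becomes
   internal at step [i.+1]. *)
Fixpoint ext_nodes (picks : nat -> node) (n : nat) : seq node :=
  if n is m.+1 then
    [:: rcons (picks m) false, rcons (picks m) true
      & rem (picks m) (ext_nodes picks m)]
  else [:: [::]].

Section BST.
Context (R : realType) (d : measure_display) (T : measurableType d).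
Context (P : probability T R) (V : nat -> T -> node).

(* [V n] is the node picked at step [n.+1]: given the whole history, it is
   uniform on the [n.+1] external nodes of the current tree. The product form
   of the conditional probabilities avoids conditioning on null histories. *)
Definition bst_process : Prop :=
  (forall n v, measurable [set w | V n w = v]) /\
  (forall (n : nat) (v : nat -> node),
     P [set w | forall i, (i <= n)%N -> V i w = v i] =
     ((if v n \in ext_nodes v n then (n.+1%:R^-1)%:E else 0) *
      P [set w | forall i, (i < n)%N -> V i w = v i])%E).

Definition bst_ext (n : nat) (w : T) : seq node :=
  ext_nodes (fun i => V i w) n.

Definition profile (n : nat) (k : int) (w : T) : nat :=
  count (fun u : node => (size u)%:Z == k) (bst_ext n w).

End BST.

Section Complex.
Context (R : realType).

Definition cexp (z : R[i]) : R[i] :=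
  (expR (complex.Re z))%:C *
  (cos (complex.Im z) +i* sin (complex.Im z)).

(* [R[i]^o] is [R[i]] with its norm topology. *)
Definition analytic_on (D : set R[i]^o) (f : R[i]^o -> R[i]^o) : Prop :=
  forall z, D z -> exists (a : nat -> R[i]^o) (rho : R), 0 < rho /\
    forall h : R[i]^o, `|h| < rho%:C ->
      series (fun k => a k * h ^+ k : R[i]^o) @ \oo --> f (z + h).

End Complex.

Section BigginsMartingale.
Context (R : realType) (d : measure_display) (T : measurableType d).
Context (P : probability T R) (V : nat -> T -> node).

(* The first factor is n^(-(2 e^b - 1)). *)
Definition W_ (n : nat) (w : T) (b : R[i]^o) : R[i]^o :=
  cexp (- (2 * cexp b - 1) * (ln n%:R)%:C) *
  \sum_(u <- bst_ext V n w) cexp (b * (size u)%:R).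

Definition random_analytic (D : set R[i]^o) (W : T -> R[i]^o -> R[i]^o) :=
  (forall w, analytic_on D (W w)) /\
  (forall z, D z ->
     measurable_fun setT (fun w => complex.Re (W w z)) /\
     measurable_fun setT (fun w => complex.Im (W w z))).

Definition is_W_infty (D : set R[i]^o) (W : T -> R[i]^o -> R[i]^o) : Prop :=
  random_analytic D W /\
  {ae P, forall w, forall K : set R[i]^o, compact K -> K `<=` D ->
    {uniform K, (fun n => W_ n w) @ \oo --> W w}}.

End BigginsMartingale.

Section Edgeworth.
Context (R : realType).

(* [W] is the limit function of one realization. Almost surely it is real on
   the real axis and, being 1 at 0 without zeros on the interval
   (beta_-, beta_+), positive there: [log W] is the real logarithm along that
   interval. *)
Definition chi (W : R[i]^o -> R[i]^o) (j : nat) : R :=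
  derive1n j (fun b : R => ln (complex.Re (W b%:C))) 0.

(* The derivatives of [W] at 0 are almost surely real. *)
Definition Wderiv (W : R[i]^o -> R[i]^o) (j : nat) : R :=
  complex.Re (derive1n j W 0).

(* j! times the coefficient of X^j in exp(sum_(k >= 1) z_k X^k / k!): the terms
   with k > j, and the powers above j of the series, do not contribute. *)
Definition bell (S : comAlgType R) (z : nat -> S) (j : nat) : S :=
  (j`!%:R : R) *:
  (\sum_(m < j.+1) ((m`!%:R^-1 : R)%:A : S) *:
     (\sum_(1 <= k < j.+1) ((k`!%:R^-1 : R) *: z k) *: 'X^k) ^+ m)`_j.

(* Constant-coefficient differential operators form the commutative algebra
   [{poly R}], ['X] standing for d/dx; [diffop p] is the action of [p]. *)
Definition diffop (p : {poly R}) (f : R -> R) (x : R) : R :=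
  \sum_(i < size p) p`_i * derive1n i f x.

Definition Dop (c : nat -> R) (j : nat) : {poly R} :=
  (2 / (j.+1%:R * j.+2%:R)) *: ((Num.sqrt 2)^-1 *: 'X) ^+ j.+2 +
  c j *: ((Num.sqrt 2)^-1 *: 'X) ^+ j.

Definition G (c : nat -> R) (j : nat) (x : R) : R :=
  (-1) ^+ j / j`!%:R * expR (x ^+ 2 / 2) *
  diffop (bell (Dop c) j) (fun y => expR (- (y ^+ 2 / 2))) x.

End Edgeworth.

(* Main.v *)
Require Import Defs.
From mathcomp Require Import ring lra zify.

(** Write [L_n(k)] for the profile and [S_n(u)] for the sum of [exp(i u |v|)]
    over the external nodes [v] after [n] steps, so that [L_n(k)] is the [k]-th
    Fourier coefficient of [S_n].  Picking a node replaces its phase by twice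
    the phase of a node one level deeper, hence given the past [S_n] is
    multiplied on average by [1 + (2 e^{iu} - 1) / (n + 1)].  With
    [lambda = 2 log n] this gives, near [u = 0],
      [S_n(u) / n = exp(lambda (e^{iu} - 1)) W_n(iu)],
    the characteristic function of a Poisson law of parameter [lambda] times a
    factor that converges.  The theorem is the Edgeworth expansion of this
    product, read off by Fourier inversion.

    The integral of the transform over [-pi, pi] is split at a small [d0].  For
    [|u| <= d0] the exponential is [e^{i lambda u} e^{-lambda u^2/2}] times
      [exp(lambda (e^{iu} - 1 - iu + u^2/2)) W(iu)],
    which is expanded in powers of [iu], a factor [lambda (iu)^2] counting as
    order zero ([edge_poly], [edge_local], [edge_segment]).  The Gaussian
    integral of [(iu)^m e^{-iuy}] is a Hermite polynomial times a Gaussian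
    density ([J_cvg]), so the inverted expansion is a sum of Hermite polynomials
    ([edge_density]).  The polynomials [G] have the same Hermite form
    ([G_hermite]): the generating function of the operators [D_j] is the sum of
    one part with the coefficients of [e^z - 1 - z - z^2/2], which are the
    higher cumulants of the Poisson law, and one part with the Taylor
    coefficients of [log W], whose exponential is [W] ([exp_coefs_chi]).

    What remains is to bound the integrals of the moduli of
    [S_n(u) / n - exp(lambda (e^{iu} - 1)) W(iu)] over [|u| <= d0] and of
    [S_n(u) / n] elsewhere by a negative power of [n].  Convergence of [W_n] on
    compact sets comes without a rate, so the rate is obtained from second
    moments.  The history of picks is uniform on [n!] lists
    ([prob_hist_pred]), and the recursion above bounds the mean square of
    [W_{n'}(iu) - W_n(iu)] by [C n^{-1/2}] near [u = 0] ([Wh_increment]) and that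
    of [S_n(u) / n] by a negative power of [n] elsewhere ([second_moment]).
    First moments of integrals over [u] suffice, since the supremum over [k] is
    at most the integral of the modulus.  Markov's inequality and the
    Borel-Cantelli lemma apply along the block ends [(m + 1)^q]
    ([history_ae_small]); inside a block [S_n / n] moves by at most [O(1 / m)]
    because each step changes [S_n] by a bounded amount ([Sbar_diff],
    [Sbar_Wh_shift]).  Summing over blocks gives an error [O(n^{-1/q})], which is
    smaller than any power of [1 / lambda].  The limit [W] enters only through
    the difference with [W_N] for [N] large, on the compact segment
    [i [-d0, d0]], so [W] itself is never integrated ([path_edgeworth]). *)

Set Implicit Arguments.
Unset Strict Implicit.
Unset Printing Implicit Defensive.

Local Open Scope classical_set_scope.
Local Open Scope ring_scope.
Local Open Scope complex_scope.

(** * Derivatives of real functions *)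

Section RealDerivatives.
Context {R : realType}.
Implicit Types (f g : R -> R) (x a b : R).

Lemma is_derive_eqfun f g x a b : f =1 g -> a = b ->
  is_derive x 1 f a -> is_derive x 1 g b.
Proof. by move=> /funext -> ->. Qed.

Lemma is_derive_funD f g x a b : is_derive x 1 f a -> is_derive x 1 g b ->
  is_derive x 1 (fun y => f y + g y) (a + b).
Proof. by move=> ? ?; exact: is_deriveD. Qed.

Lemma is_derive_funB f g x a b : is_derive x 1 f a -> is_derive x 1 g b ->
  is_derive x 1 (fun y => f y - g y) (a - b).
Proof. by move=> ? ?; exact: is_deriveB. Qed.

Lemma is_derive_funM f g x a b : is_derive x 1 f a -> is_derive x 1 g b ->
  is_derive x 1 (fun y => f y * g y) (f x * b + g x * a).
Proof. by move=> ? ?; exact: is_deriveM. Qed.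

Lemma is_derive_fun_comp f g x a b : is_derive (g x) 1 f a -> is_derive x 1 g b ->
  is_derive x 1 (fun y => f (g y)) (b * a).
Proof. by move=> ? ?; rewrite mulrC; exact: is_derive1_comp. Qed.

Lemma is_derive_linear x a : is_derive x 1 (fun y => a * y) a.
Proof.
apply: is_derive_eqfun (is_derive_funM (is_derive_cst a x 1) (is_derive_id x 1)) => //=.
by rewrite mulr0 addr0 mulr1.
Qed.

Lemma is_derive_funZ g x a b : is_derive x 1 g b ->
  is_derive x 1 (fun y => a * g y) (a * b).
Proof.
move=> h; apply: is_derive_eqfun (is_derive_funM (is_derive_cst a x 1) h) => //=.
by rewrite mulr0 addr0.
Qed.

Lemma is_derive_derive1 f x a : is_derive x 1 f a -> f^`()%classic x = a.
Proof. by move=> ?; rewrite derive1E; exact: derive_val. Qed.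

Lemma is_derive_fun_expR g x b : is_derive x 1 g b ->
  is_derive x 1 (fun y => expR (g y)) (b * expR (g x)).
Proof. by move=> h; exact: (is_derive_fun_comp (is_derive_expR (g x)) h). Qed.

Lemma is_derive_fun_cos g x b : is_derive x 1 g b ->
  is_derive x 1 (fun y => cos (g y)) (b * - sin (g x)).
Proof. by move=> h; exact: (is_derive_fun_comp (is_derive_cos (g x)) h). Qed.

Lemma is_derive_fun_sin g x b : is_derive x 1 g b ->
  is_derive x 1 (fun y => sin (g y)) (b * cos (g x)).
Proof. by move=> h; exact: (is_derive_fun_comp (is_derive_sin (g x)) h). Qed.

End RealDerivatives.

(** * Bell polynomials of the operators D_j, in Hermite form *)

Section Truncation.
Context {S : comNzRingType}.

Definition eq_upto (N : nat) (p q : {poly S}) :=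
  forall i, (i < N)%N -> p`_i = q`_i.

Lemma eq_uptoD N p p' q q' :
  eq_upto N p p' -> eq_upto N q q' -> eq_upto N (p + q) (p' + q').
Proof. by move=> hp hq i iN; rewrite !coefD hp// hq. Qed.

Lemma eq_uptoM N p p' q q' :
  eq_upto N p p' -> eq_upto N q q' -> eq_upto N (p * q) (p' * q').
Proof.
move=> hp hq i iN; rewrite !coefM; apply: eq_bigr => -[k /= ki] _.
by rewrite hp ?hq//; lia.
Qed.

Lemma coef_exp_lt (a : {poly S}) m i : a`_0 = 0 -> (i < m)%N -> (a ^+ m)`_i = 0.
Proof.
move=> a0; have -> : a = Poly (behead a) * 'X.
  apply/polyP => -[|k]; first by rewrite coefMX a0.
  by rewrite coefMX/= coef_Poly nth_behead.
by move=> im; rewrite exprMn coefMXn im.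
Qed.

End Truncation.

Section FormalExponential.
Context {R : realType} {S : comAlgType R}.

Definition trunc_exp (a : {poly S}) (N : nat) : {poly S} :=
  \sum_(m < N.+1) ((m`!%:R^-1 : R)%:A : S) *: a ^+ m.

Lemma coef0_trunc_exp (a : {poly S}) N : a`_0 = 0 -> (trunc_exp a N)`_0 = 1.
Proof.
move=> a0; rewrite /trunc_exp big_ord_recl coefD expr0 fact0 invr1 !scale1r.
rewrite coef1 coef_sum big1 ?addr0// => i _.
by rewrite coefZ coef_exp_lt// mulr0.
Qed.

Lemma deriv_trunc_exp (a : {poly S}) N : a`_0 = 0 ->
  eq_upto N (trunc_exp a N)^`() (a^`() * trunc_exp a N).
Proof.
move=> a0 i iN.
have -> : (trunc_exp a N)^`() =
    a^`() * \sum_(m < N) ((m`!%:R^-1 : R)%:A : S) *: a ^+ m.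
  rewrite /trunc_exp big_ord_recl derivD expr0 derivZ derivC scaler0 add0r.
  rewrite raddf_sum /= mulr_sumr; apply: eq_bigr => m _.
  rewrite derivZ deriv_exp /bump/= add1n /=.
  rewrite -mulrnAr scalerAr; congr (_ * _); rewrite add0n -[_ *+ m.+1]scaler_nat scalerA.
  congr (_ *: _); rewrite -[m.+1%:R in LHS](rmorph_nat (in_alg S)) -!in_algE -rmorphM/=.
  congr (_ %:A); rewrite factS natrM invfM mulrAC mulVf ?mul1r//.
rewrite /trunc_exp big_ord_recr/= mulrDr coefD -[LHS]addr0; congr (_ + _).
rewrite coefM big1// => -[k /= ki] _; rewrite coefZ coef_exp_lt ?mulr0//.
by lia.
Qed.

(** The equation determines each coefficient from the previous ones, as the
    positive integers are invertible in the scalars. *)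
Lemma formal_ode_uniq (g E F : {poly S}) N : E`_0 = F`_0 ->
  eq_upto N E^`() (g * E) -> eq_upto N F^`() (g * F) -> eq_upto N.+1 E F.
Proof.
move=> EF0 hE hF i; elim/ltn_ind: i => -[//|i] IH iN.
have : E^`()`_i = F^`()`_i.
  rewrite hE// hF// !coefM; apply: eq_bigr => -[k /= ki] _.
  by rewrite IH//; lia.
rewrite !coef_deriv => /(congr1 (fun x : S => (i.+1%:R^-1 : R) *: x)).
have h : (i.+1%:R : R) != 0 by rewrite pnatr_eq0.
rewrite -(scaler_nat i.+1 (E`_i.+1)) -(scaler_nat i.+1 (F`_i.+1)) => H.
by move: H; rewrite !scalerA mulVf// !scale1r.
Qed.

(** Up to the order of truncation both sides solve [E' = (a + b)' E] with
    constant term 1. *)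
Lemma trunc_expD (a b : {poly S}) N : a`_0 = 0 -> b`_0 = 0 ->
  eq_upto N.+1 (trunc_exp (a + b) N) (trunc_exp a N * trunc_exp b N).
Proof.
move=> a0 b0; have ab0 : (a + b)`_0 = 0 by rewrite coefD a0 b0 addr0.
apply: (@formal_ode_uniq (a + b)^`()).
- by rewrite coef0M !coef0_trunc_exp// mulr1.
- exact: deriv_trunc_exp.
- rewrite derivM derivD mulrDl mulrA; apply: eq_uptoD.
    by apply: eq_uptoM => //; exact: deriv_trunc_exp.
  by rewrite mulrCA; apply: eq_uptoM => //; exact: deriv_trunc_exp.
Qed.

End FormalExponential.

Section Dilation.
Context {R : realType} {S : comAlgType R}.

(** The polynomial [p(t X)], for [t] in the algebra. *)
Definition dilated (t : S) (p : {poly R}) (q : {poly S}) :=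
  forall i, q`_i = p`_i *: t ^+ i.

Lemma dilatedX t p q m : dilated t p q -> dilated t (p ^+ m) (q ^+ m).
Proof.
move=> pq; elim: m => [|m IH] i.
  by rewrite !expr0 !coef1; case: i => [|i]/=; rewrite ?scale0r ?scale1r ?expr0.
rewrite !exprS !coefM scaler_suml; apply: eq_bigr => -[k /= ki] _.
by rewrite pq IH -scalerAl -scalerAr scalerA -exprD subnKC//.
Qed.

End Dilation.

Section BellDop.
Context {R : realType}.
Implicit Types (c w : nat -> R).

(** The series [(e^X - 1 - X - X^2/2) / X^2], truncated. *)
Definition third_order_tail (N : nat) : {poly R} :=
  \poly_(k < N.+1) (if k == 0%N then 0 else (k.+2)`!%:R^-1).

(** The coefficient of order [j] in [H^m / m!] times the series of the [w i],
    where [H] is the third order tail. *)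
Definition kappa w (j m : nat) : R :=
  m`!%:R^-1 * \sum_(i < j.+1) (third_order_tail j ^+ m)`_i * w (j - i)%N.

(** The differential equation [f' = (log f)' f], read coefficientwise for
    [f] with Taylor coefficients [w i] and [log f] with derivatives [c i]. *)
Definition exp_coefs c w (N : nat) : Prop :=
  (w 0%N = 1) /\
  (forall k, (k < N)%N ->
    k.+1%:R * w k.+1 = \sum_(i < k.+1) c i.+1 / i`!%:R * w (k - i)%N).

Lemma sqr_isqrt2 : (Num.sqrt 2 : R)^-1 ^+ 2 = 2^-1.
Proof. by rewrite exprVn sqr_sqrtr. Qed.

Lemma bell_generator (S : comAlgType R) (z : nat -> S) (N : nat) :
  \sum_(1 <= k < N.+1) ((k`!%:R^-1 : R) *: z k) *: 'X^k =
  \poly_(k < N.+1) (if k == 0%N then 0 else (k`!%:R^-1 : R) *: z k).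
Proof.
rewrite poly_def -(big_mkord xpredT (fun k => (if k == 0%N then 0 else (k`!%:R^-1 : R) *: z k) *: 'X^k)).
rewrite big_ltn//= scale0r add0r; apply: eq_big_nat => k /andP[k1 _].
by case: k k1.
Qed.

(** As [2 / ((k+1) (k+2) k!) = 2 / (k+2)!] and the square of [D / sqrt 2] is
    [D^2 / 2], the generating polynomial of the [Dop c k] is
    [D^2 H(t) + sum_k c_k t^k / k!] with [t = X D / sqrt 2]; its exponential is
    the product of that of [D^2 H(t)] and of a series with coefficients [w]. *)
Lemma bell_Dop c w j : exp_coefs c w j ->
  bell (Dop c) j = (j`!%:R * (Num.sqrt 2)^-1 ^+ j) *:
    \sum_(m < j.+1) kappa w j m *: 'X^(j + 2 * m).
Proof.
move=> [w0 wS]; set s := (Num.sqrt 2)^-1.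
pose t : {poly R} := s *: 'X.
pose A : {poly {poly R}} := \poly_(k < j.+1) ((third_order_tail j)`_k *: t ^+ k).
pose B : {poly {poly R}} :=
  \poly_(k < j.+1) ((if k == 0%N then 0 else c k / k`!%:R) *: t ^+ k).
have genE : \sum_(1 <= k < j.+1) ((k`!%:R^-1 : R) *: Dop c k) *: 'X^k =
    ('X^2 : {poly R}) *: A + B.
  rewrite bell_generator; apply/polyP => k.
  rewrite coefD coefZ !coef_poly; case: ltnP => kj; last by rewrite mulr0 addr0.
  case: k kj => [|k] kj /=; first by rewrite !scale0r mulr0 addr0.
  rewrite /Dop -/s -/t scalerDr; congr (_ + _); last by rewrite scalerA mulrC.
  have -> : t ^+ k.+3 = t ^+ k.+1 * (2^-1 *: 'X^2).
    by rewrite -sqr_isqrt2 -/s -exprZn -exprD addn2.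
  rewrite -!scalerAr [t ^+ _ * _]mulrC [in LHS]scalerA [LHS]scalerA; congr (_ *: _).
  rewrite 2!factS !natrM; field. by rewrite nat1r -!natrD !pnatr_eq0 -lt0n fact_gt0.
have A0 : (('X^2 : {poly R}) *: A)`_0 = 0 by rewrite coefZ !coef_poly/= scale0r mulr0.
have B0 : B`_0 = 0 by rewrite coef_poly/= scale0r.
rewrite /bell genE -[X in _ *: X]/((trunc_exp _ j)`_j) trunc_expD// -scalerA; congr (_ *: _).
have expA i : (i <= j)%N -> (trunc_exp (('X^2 : {poly R}) *: A) j)`_i =
    \sum_(m < j.+1) (m`!%:R^-1 * (third_order_tail j ^+ m)`_i) *: ('X^(2 * m) * t ^+ i).
  move=> ij; rewrite coef_sum; apply: eq_bigr => m _.
  (* Powers commute with dilations, so [A] may be replaced by the tail. *)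
  have dA : dilated t (third_order_tail j) A.
    move=> k; rewrite !coef_poly; case: ltnP => //; by rewrite scale0r.
  rewrite coefZ exprZn coefZ (dilatedX m dA) -exprM.
  by rewrite -!scalerAr -scalerAl mul1r scalerA [X in X *: _]mulrC.
have expB i : (i <= j)%N -> (trunc_exp B j)`_i = w i *: t ^+ i.
  move=> ij; have -> : (trunc_exp B j)`_i = (\poly_(k < j.+1) (w k *: t ^+ k))`_i.
    apply: (@formal_ode_uniq R _ B^`() _ _ j) => //.
    - by rewrite coef0_trunc_exp// coef_poly/= w0 scale1r.
    - exact: deriv_trunc_exp.
    - move=> k kj; rewrite coef_deriv coef_poly ltnS kj coefM.
      rewrite scalerMnl -mulr_natl wS// scaler_suml; apply: eq_bigr => -[l /= lk] _.
      rewrite coef_deriv !coef_poly !ifT/=; [|lia|lia].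
      rewrite scalerMnl -[RHS]scalerAr -[X in _ = _ *: X]scalerAl [RHS]scalerA -exprD.
      have -> : (l.+1 + (k - l) = k.+1)%N by lia.
      congr (_ *: _); rewrite factS natrM; field.
      by rewrite nat1r !pnatr_eq0 -lt0n fact_gt0.
  by rewrite coef_poly ltnS ij.
rewrite coefM.
transitivity (\sum_(m < j.+1) \sum_(i < j.+1)
   (m`!%:R^-1 * ((third_order_tail j ^+ m)`_i * w (j - i)%N)) *: ('X^(2 * m) * t ^+ j)).
  rewrite exchange_big/=; apply: eq_bigr => -[i /= ij] _.
  rewrite expA// expB ?leq_subr// mulr_suml; apply: eq_bigr => m _.
  rewrite -[LHS]scalerAr -[X in _ *: X]scalerAl [LHS]scalerA -mulrA -exprD subnKC//.
  by congr (_ *: _); ring.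
rewrite scaler_sumr; apply: eq_bigr => m _.
rewrite -scaler_suml -mulr_sumr -/(kappa w j m) exprZn -scalerAr -exprD.
by rewrite [LHS]scalerA [RHS]scalerA addnC mulrC.
Qed.

End BellDop.

Section Hermite.
Context {R : realType}.

(** The probabilists' Hermite polynomials. *)
Fixpoint hermite (n : nat) : {poly R} :=
  if n is m.+1 then 'X * hermite m - (hermite m)^`() else 1.

Lemma size_hermite n : (size (hermite n) <= n.+1)%N.
Proof.
elim: n => [|n IH] /=; first by rewrite size_poly1.
apply: (leq_trans (size_polyD _ _)); rewrite geq_max size_polyN; apply/andP; split.
  by rewrite mulrC; apply: (leq_trans (size_polyMleq _ _)); rewrite size_polyX addn2/= ltnS.
by apply: (leq_trans (size_poly _ _)); lia.
Qed.

Lemma hermite_rec m : (hermite m.+2 : {poly R}) = 'X * hermite m.+1 - m.+1%:R *: hermite m.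
Proof.
have dH k : (hermite k.+1 : {poly R})^`() = k.+1%:R *: hermite k.
  elim: k => [|k IH]; first by rewrite /= derivB derivM !derivC derivX mulr1 mulr0 addr0 subr0 scale1r.
  rewrite -[hermite k.+2]/('X * hermite k.+1 - (hermite k.+1)^`()).
  rewrite IH derivB derivM derivX derivZ IH mul1r.
  rewrite -[in RHS]/('X * hermite k - (hermite k)^`()) -!mul_polyC -[in RHS](natr1) polyCD.
  by rewrite /=; ring.
by rewrite -[hermite m.+2]/('X * hermite m.+1 - (hermite m.+1)^`()) dH.
Qed.

Lemma derive1n_gauss n (x : R) :
  derive1n n (fun y => expR (- (y ^+ 2 / 2))) x =
  (-1) ^+ n * (hermite n).[x] * expR (- (x ^+ 2 / 2)).
Proof.
elim: n x => [|n IH] x; first by rewrite derive1n0 expr0 hornerC !mul1r.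
rewrite derive1nS (_ : derive1n n _ = fun y =>
  (-1) ^+ n * (hermite n).[y] * expR (- (y ^+ 2 / 2))); last by apply/funext => y; exact: IH.
have dE : is_derive x 1 (fun y : R => expR (- (y ^+ 2 / 2)))
    (- x * expR (- (x ^+ 2 / 2))).
  apply: is_derive_fun_expR.
  apply: is_derive_eqfun (is_derive_funM (is_derive_linear x (- 2^-1)) (is_derive_id x 1)).
    by move=> y /=; field.
  by rewrite /=; field.
have dH : is_derive x 1 (fun y => (-1) ^+ n * (hermite n).[y])
    ((-1) ^+ n * (hermite n)^`().[x]).
  by apply: is_derive_funZ; exact: is_derive_poly.
rewrite (is_derive_derive1 (is_derive_funM dH dE)) /= hornerD hornerN hornerM hornerX [(-1) ^+ n.+1]exprS.
by ring.
Qed.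

Lemma diffopE (p : {poly R}) n f x : (size p <= n)%N ->
  diffop p f x = \sum_(i < n) p`_i * derive1n i f x.
Proof.
move=> pn; rewrite /diffop (big_ord_widen n (fun i => p`_i * derive1n i f x) pn).
rewrite big_mkcond/=; apply: eq_bigr => i _; case: ltnP => // h.
by rewrite nth_default// mul0r.
Qed.

(** Rodrigues' formula turns each derivative of the Gaussian into a Hermite
    polynomial; the exponents [j + 2 m] all have the parity of [j], which
    cancels the sign in the definition of [G]. *)
Lemma G_hermite (c w : nat -> R) j x : exp_coefs c w j ->
  G c j x = (Num.sqrt 2)^-1 ^+ j *
    \sum_(m < j.+1) kappa w j m * (hermite (j + 2 * m)).[x].
Proof.
move=> cw; rewrite /G (bell_Dop cw) (@diffopE _ (3 * j).+1); last first.
  apply: (leq_trans (size_scale_leq _ _)).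
  apply: (leq_trans (size_sum _ _ _)); apply/bigmax_leqP => -[m /= mj] _.
  by apply: (leq_trans (size_scale_leq _ _)); rewrite size_polyXn; lia.
under eq_bigr => i _ do rewrite derive1n_gauss coefZ coef_sum.
set s := (Num.sqrt 2)^-1.
transitivity (\sum_(m < j.+1) \sum_(i < (3 * j).+1)
   (-1) ^+ j * s ^+ j * (kappa w j m * ('X^(j + 2 * m) : {poly R})`_i) * ((-1) ^+ i * (hermite i).[x])).
  rewrite exchange_big/= mulr_sumr; apply: eq_bigr => i _.
  under eq_bigr do rewrite coefZ.
  rewrite -mulr_suml -mulr_sumr !mulrA.
  have h : expR (x ^+ 2 / 2) * expR (- (x ^+ 2 / 2)) = 1 by rewrite -expRD subrr expR0.
  set S := \sum_(_ < _) _; rewrite -[RHS]mulr1 -[X in _ = _ * X]h.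
by field; rewrite pnatr_eq0 -lt0n fact_gt0.
rewrite mulr_sumr; apply: eq_bigr => -[m /= mj] _.
have lt : (j + 2 * m < (3 * j).+1)%N by lia.
rewrite (bigD1 (Ordinal lt))//= big1 ?addr0.
  rewrite coefXn eqxx exprD exprM sqrrN expr1n.
  have : (-1 : R) ^+ j * (-1) ^+ j = 1 by rewrite -expr2 -exprM mulnC exprM sqrrN expr1n expr1n.
  move=> h.
  rewrite !expr1n mulr1n.
  by transitivity (((-1) ^+ j * (-1) ^+ j) * (s ^+ j * (kappa w j m * (hermite (j + 2 * m)).[x]))); [ring | rewrite h mul1r; ring].
move=> i ni; rewrite coefXn (_ : (_ == _) = false) ?mulr0 ?mul0r//.
by apply/negbTE; apply: contra ni => /eqP h; apply/eqP/val_inj.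
Qed.

End Hermite.

(** * Modulus and exponential of complex numbers *)

Notation cabs := Normc.normc.

Section ComplexModulus.
Context {R : realType}.
Implicit Types (z w c : R[i]) (x t : R).

Lemma cabsE z : cabs z = Num.sqrt (complex.Re z ^+ 2 + complex.Im z ^+ 2).
Proof. by case: z. Qed.

Lemma cabs_ge0 z : 0 <= cabs z.
Proof. by rewrite cabsE sqrtr_ge0. Qed.

Lemma sqr_cabs z : cabs z ^+ 2 = complex.Re z ^+ 2 + complex.Im z ^+ 2.
Proof. by rewrite cabsE sqr_sqrtr// addr_ge0// sqr_ge0. Qed.

Lemma normr_cabs z : `|z| = (cabs z)%:C.
Proof. by rewrite normc_def -cabsE. Qed.

Lemma gt0_complex z : 0 < z -> complex.Im z = 0 /\ 0 < complex.Re z.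
Proof. by rewrite ltcE/= => /andP[/eqP -> ->]. Qed.

Lemma Re_le_cabs z : `|complex.Re z| <= cabs z.
Proof.
rewrite cabsE -sqrtr_sqr ler_sqrt ?addr_ge0 ?sqr_ge0//.
by rewrite lerDl sqr_ge0.
Qed.

Lemma Im_le_cabs z : `|complex.Im z| <= cabs z.
Proof.
rewrite cabsE -sqrtr_sqr ler_sqrt ?addr_ge0 ?sqr_ge0//.
by rewrite lerDr sqr_ge0.
Qed.

Lemma cabs_real x : cabs x%:C = `|x|.
Proof. by rewrite cabsE/= expr0n/= addr0 sqrtr_sqr. Qed.

Lemma cabs_le_ReIm z : cabs z <= `|complex.Re z| + `|complex.Im z|.
Proof.
rewrite -(@ler_pXn2r _ 2)// ?nnegrE ?cabs_ge0 ?addr_ge0//.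
rewrite sqr_cabs sqrrD !real_normK ?num_real//.
by rewrite lerD2r lerDl mulrn_wge0// mulr_ge0.
Qed.

Lemma cabsB z w : cabs (z - w) <= cabs z + cabs w.
Proof. by rewrite -(normcN w) le_normcD. Qed.

Lemma cabs_distC z w : cabs (z - w) = cabs (w - z).
Proof. by rewrite -opprB normcN. Qed.

Lemma cabs_dist_triangle w z c : cabs (z - c) <= cabs (z - w) + cabs (w - c).
Proof.
by rewrite (_ : z - c = (z - w) + (w - c)) ?le_normcD//; ring.
Qed.

Lemma cabs_le_dist z w : cabs z - cabs w <= cabs (z - w).
Proof.
by rewrite lerBlDr (le_trans _ (le_normcD _ _))// subrK.
Qed.

Lemma cabsX z n : cabs (z ^+ n) = cabs z ^+ n.
Proof. by elim: n => [|n IH]; rewrite ?expr0 ?Normc.normc1// !exprS Normc.normcM IH. Qed.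

Lemma cabs_sum (I : Type) (r : seq I) (Q : pred I) (F : I -> R[i]) :
  cabs (\sum_(i <- r | Q i) F i) <= \sum_(i <- r | Q i) cabs (F i).
Proof.
elim/big_rec2: _ => [|i y z _ h]; first by rewrite Normc.normc0.
by rewrite (le_trans (le_normcD _ _))// lerD2l.
Qed.

Lemma cabs_nat n : cabs (n%:R : R[i]) = n%:R.
Proof. by rewrite -(rmorph_nat (real_complex R)) cabs_real normr_nat. Qed.

Lemma Re_conjM_self z : complex.Re (z^* * z) = cabs z ^+ 2.
Proof. by rewrite sqr_cabs; case: z => a b /=; ring. Qed.

Lemma cabs_conj z : cabs z^* = cabs z.
Proof. by rewrite !cabsE; case: z => a b /=; rewrite sqrrN. Qed.

Lemma ReD z w : complex.Re (z + w) = complex.Re z + complex.Re w.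
Proof. by case: z; case: w. Qed.

Lemma ReB z w : complex.Re (z - w) = complex.Re z - complex.Re w.
Proof. by case: z; case: w. Qed.

Lemma ImD z w : complex.Im (z + w) = complex.Im z + complex.Im w.
Proof. by case: z; case: w. Qed.

Lemma ImB z w : complex.Im (z - w) = complex.Im z - complex.Im w.
Proof. by case: z; case: w. Qed.

Lemma Re_realM x z : complex.Re (x%:C * z) = x * complex.Re z.
Proof. by case: z => a b /=; ring. Qed.

Lemma Im_realM x z : complex.Im (x%:C * z) = x * complex.Im z.
Proof. by case: z => a b /=; ring. Qed.

Lemma Re_sum (I : Type) (r : seq I) (Q : pred I) (F : I -> R[i]) :
  complex.Re (\sum_(i <- r | Q i) F i) = \sum_(i <- r | Q i) complex.Re (F i).
Proof. by elim/big_rec2: _ => // i y z _ h; rewrite ReD h. Qed.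

Lemma Im_sum (I : Type) (r : seq I) (Q : pred I) (F : I -> R[i]) :
  complex.Im (\sum_(i <- r | Q i) F i) = \sum_(i <- r | Q i) complex.Im (F i).
Proof. by elim/big_rec2: _ => // i y z _ h; rewrite ImD h. Qed.

Lemma eq_ReIm z w : complex.Re z = complex.Re w -> complex.Im z = complex.Im w -> z = w.
Proof. by case: z; case: w => a b c d /= -> ->. Qed.

(** Taking for [c] the conjugate of [z] gives the square of the modulus.  This
    reduces bounds on complex functions to the mean value theorem for real
    ones. *)
Lemma cabs_le_Re z (M : R) :
  (forall c, complex.Re (c * z) <= cabs c * M) -> cabs z <= M.
Proof.
move=> h; have := h z^*; rewrite Re_conjM_self cabs_conj expr2.
have [->|z0] := eqVneq (cabs z) 0.
  have := h 1; rewrite Normc.normc1 !mul1r => h1 _.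
  by have := h (-1); rewrite mulN1r normcN Normc.normc1 mul1r; case: {h} z h1 => a b /=; lra.
by rewrite ler_pM2l// lt_neqAle eq_sym z0 cabs_ge0.
Qed.

End ComplexModulus.

Section ComplexExponential.
Context {R : realType}.
Implicit Types (z w c : R[i]) (x t : R).

Lemma cexpD z w : cexp (z + w) = cexp z * cexp w.
Proof.
apply: eq_ReIm; case: z => a b; case: w => e f; rewrite /cexp /= expRD sinD cosD; ring.
Qed.

Lemma cexp0 : cexp 0 = 1 :> R[i].
Proof. by apply: eq_ReIm; rewrite /cexp /= expR0 sin0 cos0; ring. Qed.

Lemma cabs_cexp z : cabs (cexp z) = expR (complex.Re z).
Proof.
rewrite /cexp Normc.normcM cabs_real ger0_norm ?expR_ge0//.
by rewrite cabsE/= cos2Dsin2 sqrtr1 mulr1.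
Qed.

Lemma cexp_real x : cexp x%:C = (expR x)%:C.
Proof. by apply: eq_ReIm; rewrite /cexp /= sin0 cos0; ring. Qed.

Lemma is_derive_funsum (n : nat) (f : nat -> R -> R) (a : nat -> R) x :
  (forall i, (i < n)%N -> is_derive x 1 (f i) (a i)) ->
  is_derive x 1 (fun y => \sum_(i < n) f i y) (\sum_(i < n) a i).
Proof.
elim: n => [|n IH] h.
  rewrite big_ord0; apply: is_derive_eqfun (is_derive_cst 0 x 1) => // y.
  by rewrite big_ord0.
rewrite big_ord_recr/=; apply: is_derive_eqfun (is_derive_funD (IH _) (h n _)) => //.
  by move=> y /=; rewrite big_ord_recr.
by move=> i ni; apply: h; rewrite ltnS ltnW.
Qed.

Lemma is_derive_funX n x : is_derive x 1 (fun y : R => y ^+ n) (n%:R * x ^+ n.-1).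
Proof.
apply: is_derive_eqfun (is_derive_poly 'X^n x).
  by move=> y; rewrite hornerXn.
by rewrite derivXn hornerMn hornerXn mulr_natl.
Qed.

Lemma is_derive_Re_cexp c z t :
  is_derive t 1 (fun t => complex.Re (c * cexp (t%:C * z)))
    (complex.Re (c * z * cexp (t%:C * z))).
Proof.
case: c => c1 c2; case: z => a b.
have h1 : is_derive t 1 (fun t => expR (a * t) * (c1 * cos (b * t) - c2 * sin (b * t)))
   (expR (a * t) * (c1 * (b * - sin (b * t)) - c2 * (b * cos (b * t))) +
    (c1 * cos (b * t) - c2 * sin (b * t)) * (a * expR (a * t))).
  apply: is_derive_funM; first by apply: is_derive_fun_expR; exact: is_derive_linear.
  apply: is_derive_funB; apply: is_derive_funZ.
    by apply: is_derive_fun_cos; exact: is_derive_linear.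
  by apply: is_derive_fun_sin; exact: is_derive_linear.
apply: is_derive_eqfun h1.
  move=> y; rewrite /cexp /= !mul0r !subr0 addr0 (mulrC y a) (mulrC y b). ring.
rewrite /cexp /= !mul0r !subr0 addr0 (mulrC t a) (mulrC t b); ring.
Qed.

(** Remainder of order [r] of the real function [t |-> Re (c e^{t z})], whose
    derivative is a remainder of order [r - 1]. *)
Definition cexp_rem (r : nat) c z t : R :=
  complex.Re (c * cexp (t%:C * z)) -
  \sum_(m < r) complex.Re (c * z ^+ m) / m`!%:R * t ^+ m.

Lemma is_derive_cexp_rem r c z t :
  is_derive t 1 (cexp_rem r.+1 c z) (cexp_rem r (c * z) z t).
Proof.
have h : is_derive t 1 (fun t => \sum_(m < r.+1) complex.Re (c * z ^+ m) / m`!%:R * t ^+ m)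
   (\sum_(m < r.+1) complex.Re (c * z ^+ m) / m`!%:R * (m%:R * t ^+ m.-1)).
  apply: (@is_derive_funsum r.+1 (fun m t => complex.Re (c * z ^+ m) / m`!%:R * t ^+ m)
    (fun m => complex.Re (c * z ^+ m) / m`!%:R * (m%:R * t ^+ m.-1))) => i _.
  by apply: is_derive_funZ; exact: is_derive_funX.
apply: is_derive_eqfun (is_derive_funB (is_derive_Re_cexp c z t) h) => //.
rewrite /cexp_rem; congr (_ - _); rewrite big_ord_recl/= mul0r mulr0 add0r.
apply: eq_bigr => i _; rewrite /bump/= add1n/= exprS mulrA.
rewrite factS natrM; field.
by rewrite nat1r !pnatr_eq0 -lt0n fact_gt0.
Qed.

Lemma le_cexp_rem r c z t : 0 <= t <= 1 ->
  `|cexp_rem r c z t| <= cabs c * cabs z ^+ r * expR (cabs z).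
Proof.
elim: r c t => [|r IH] c t /andP[t0 t1].
  rewrite /cexp_rem big_ord0 subr0 expr0 mulr1.
  rewrite (le_trans (Re_le_cabs _))// Normc.normcM cabs_cexp ler_wpM2l ?cabs_ge0//.
  rewrite ler_expR Re_realM (le_trans (ler_norm _))// normrM ger0_norm//.
  by rewrite -[leRHS]mul1r ler_pM// Re_le_cabs.
have c0 : {within `[0, t], continuous (cexp_rem r.+1 c z)}.
  apply: derivable_within_continuous => x _.
  by have := is_derive_cexp_rem r c z x => ?; exact: ex_derive.
have [s] := MVT_segment t0 (fun x _ => is_derive_cexp_rem r c z x) c0.
have -> : cexp_rem r.+1 c z 0 = 0.
  rewrite /cexp_rem mul0r cexp0 mulr1 big_ord_recl/= expr0 fact0 invr1 !mulr1.
  by rewrite big1 ?addr0 ?subrr// => i _; rewrite expr0n/= mulr0.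
rewrite !subr0 in_itv/= => /andP[s0 st] ->.
rewrite normrM (ger0_norm t0) -[leRHS]mulr1 ler_pM// exprSr mulrA mulrAC.
rewrite [leRHS](_ : _ = cabs (c * z) * cabs z ^+ r * expR (cabs z)); last first.
  by rewrite Normc.normcM; ring.
by apply: IH; rewrite s0 (le_trans st t1).
Qed.

(** The mean value theorem bounds the real remainders [cexp_rem] by induction
    on the order, uniformly in the direction [c]. *)
Lemma cexp_taylor r z :
  cabs (cexp z - \sum_(m < r) z ^+ m / m`!%:R) <= cabs z ^+ r * expR (cabs z).
Proof.
apply: cabs_le_Re => c; rewrite mulrA.
have -> : complex.Re (c * (cexp z - \sum_(m < r) z ^+ m / m`!%:R)) = cexp_rem r c z 1.
  rewrite /cexp_rem mul1r mulrBr ReB mulr_sumr Re_sum; congr (_ - _).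
  apply: eq_bigr => m _; rewrite expr1n mulr1.
  rewrite -[in LHS](rmorph_nat (real_complex R)) -fmorphV/= mulrA mulrC Re_realM mulrC.
  by [].
apply: (le_trans (ler_norm _)); apply: le_cexp_rem; lra.
Qed.

End ComplexExponential.

(** * Complex power series *)

Section ComplexLimits.
Context {R : realType}.
Implicit Types (u v : nat -> R[i]) (l c z : R[i]).

(** Convergence with real tolerances: positive elements of [R[i]] are real. *)
Definition clim u l := forall e : R, 0 < e -> exists N, forall n, (N <= n)%N ->
  cabs (u n - l) < e.

Lemma climP (u : nat -> R[i]^o) (l : R[i]^o) : clim u l <-> (u @ \oo --> l).
Proof.
split=> [h|h].
  apply/cvgrPdist_lt => e e0.
  have [eIm eRe] := gt0_complex e0.
  have [N hN] := h _ eRe; exists N => // n /= Nn.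
  by rewrite distrC normr_cabs ltcE/= eIm eqxx hN.
move=> e e0; have e0' : 0 < e%:C :> R[i] by rewrite ltcR.
have /cvgrPdist_lt /(_ _ e0')[N _ hN] := h.
exists N => n Nn; have := hN n Nn.
by rewrite distrC normr_cabs ltcR.
Qed.

Lemma clim_dist_le u l c (M : R) N : clim u l ->
  (forall n, (N <= n)%N -> cabs (u n - c) <= M) -> cabs (l - c) <= M.
Proof.
move=> ul h; apply/ler_addgt0Pr => e e0.
have [N1 hN1] := ul _ e0.
have := h (maxn N N1) (leq_maxl _ _); have := hN1 (maxn N N1) (leq_maxr _ _).
have := cabs_dist_triangle (u (maxn N N1)) l c.
rewrite (cabs_distC l (u _)); lra.
Qed.

Lemma clim_eventually_const u c N : (forall n, (N <= n)%N -> u n = c) -> clim u c.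
Proof. by move=> h e e0; exists N => n Nn; rewrite h// subrr Normc.normc0. Qed.

Lemma clim_uniq u l c : clim u l -> clim u c -> l = c.
Proof.
move=> ul uc; apply/eqP; rewrite -subr_eq0; apply/eqP; apply: Normc.eq0_normc.
apply/eqP; rewrite eq_le cabs_ge0 andbT; apply/ler_addgt0Pr => e e0.
rewrite add0r; have [N hN] := uc _ e0.
by apply: (clim_dist_le (N := N) ul) => n /hN /ltW.
Qed.

Lemma climD u v l c : clim u l -> clim v c -> clim (fun n => u n + v n) (l + c).
Proof.
move=> ul vc e e0; have e2 : 0 < e / 2 by lra.
have [N1 h1] := ul _ e2; have [N2 h2] := vc _ e2.
exists (maxn N1 N2) => n; rewrite geq_max => /andP[n1 n2].
rewrite (_ : _ - _ = (u n - l) + (v n - c)); last by ring.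
have := le_normcD (u n - l) (v n - c); have := h1 n n1; have := h2 n n2; lra.
Qed.

Lemma climZ u l c : clim u l -> clim (fun n => c * u n) (c * l).
Proof.
move=> ul e e0; have e2 : 0 < e / (cabs c + 1) by rewrite divr_gt0// ltr_wpDl// cabs_ge0.
have [N1 h1] := ul _ e2; exists N1 => n n1.
rewrite -mulrBr Normc.normcM; have := h1 n n1.
rewrite ltr_pdivlMr ?ltr_wpDl ?cabs_ge0// mulrC; apply: le_lt_trans.
by rewrite ler_wpM2r ?cabs_ge0// lerDl.
Qed.

Lemma clim_shift u l : clim u l -> clim (fun n => u n.-1) l.
Proof.
move=> ul e /ul[N hN]; exists N.+1 => n Nn; apply: hN; lia.
Qed.

Lemma clim_le_dist u v l c (M : R) : clim u l -> clim v c ->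
  (forall n, cabs (u n - v n) <= M) -> cabs (l - c) <= M.
Proof.
move=> ul vc h.
have := climD ul (climZ (-1) vc).
rewrite -[l - c]subr0 => H; rewrite -mulN1r; apply: (clim_dist_le (N := 0) H) => n _.
by rewrite subr0 mulN1r.
Qed.

End ComplexLimits.

Section GeometricBounds.
Context {R : realType}.

Lemma geometric_sum_le (th : R) n : 0 <= th < 1 -> \sum_(k < n) th ^+ k <= (1 - th)^-1.
Proof.
move=> /andP[t0 t1]; have h : 0 < 1 - th by lra.
rewrite -[leRHS]mul1r ler_pdivlMr//.
have -> : (\sum_(k < n) th ^+ k) * (1 - th) = 1 - th ^+ n.
  elim: n => [|n IH]; first by rewrite big_ord0 mul0r expr0 subrr.
  by rewrite big_ord_recr/= mulrDl IH exprS; ring.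
by rewrite gerBl exprn_ge0.
Qed.

Lemma mulrn_geometric_le (th : R) n : 0 <= th < 1 -> n%:R * th ^+ n <= (1 - th)^-1.
Proof.
move=> t01; apply: (le_trans _ (geometric_sum_le n t01)).
rewrite mulr_natl -[n in _ *+ n]card_ord -sumr_const; apply: ler_sum => -[k /= kn] _.
by move: t01 => /andP[t0 t1]; rewrite ler_wiXn2l// ?ltW// ltnW.
Qed.

End GeometricBounds.

Section PowerSeries.
Context {R : realType}.
Implicit Types (a : nat -> R[i]) (z h c : R[i]) (rho r : R).

Definition psum a z n := \sum_(k < n) a k * z ^+ k.

(** Cauchy's estimates, a form of [rho] being at most the radius of
    convergence that is stable under formal differentiation. *)
Definition coef_bounded rho a := forall r, 0 < r < rho ->
  exists M, forall k, cabs (a k) * r ^+ k <= M.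

Lemma coef_bounded_sum rho a r : coef_bounded rho a -> 0 < r < rho ->
  exists M, forall n, \sum_(k < n) cabs (a k) * r ^+ k <= M.
Proof.
move=> ba /andP[r0 rr].
pose r1 := (r + rho) / 2; have [|M hM] := ba r1; first by rewrite /r1; lra.
have r1r : r < r1 by rewrite /r1; lra.
have r10 : 0 < r1 by lra.
have t01 : 0 <= r / r1 < 1 by rewrite divr_ge0 ?ltW//= ltr_pdivrMr// mul1r.
exists (M * (1 - r / r1)^-1) => n.
apply: (@le_trans _ _ (M * \sum_(k < n) (r / r1) ^+ k)).
  rewrite mulr_sumr; apply: ler_sum => k _.
  have -> : r ^+ k = r1 ^+ k * (r / r1) ^+ k.
    by rewrite -exprMn mulrC divfK// gt_eqF.
  by rewrite mulrA ler_wpM2r// exprn_ge0//; case/andP: t01.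
rewrite ler_wpM2l ?geometric_sum_le//.
by apply: le_trans (hM 0%N); rewrite mulr_ge0 ?cabs_ge0 ?exprn_ge0// ltW.
Qed.

Lemma coef_bounded_natmul rho a : coef_bounded rho a -> coef_bounded rho (fun k => k%:R * a k).
Proof.
move=> ba r /andP[r0 rr].
pose r1 := (r + rho) / 2; have [|M hM] := ba r1; first by rewrite /r1; lra.
have r1r : r < r1 by rewrite /r1; lra.
have r10 : 0 < r1 by lra.
have t01 : 0 <= r / r1 < 1 by rewrite divr_ge0 ?ltW//= ltr_pdivrMr// mul1r.
exists (M * (1 - r / r1)^-1) => k; rewrite Normc.normcM cabs_nat.
have -> : r ^+ k = r1 ^+ k * (r / r1) ^+ k.
  by rewrite -exprMn mulrC divfK// gt_eqF.
rewrite (_ : _ * _ = (cabs (a k) * r1 ^+ k) * (k%:R * (r / r1) ^+ k)); last by ring.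
case/andP: (t01) => t0 _.
apply: ler_pM => //; [| |exact: mulrn_geometric_le].
  by rewrite mulr_ge0 ?cabs_ge0 ?exprn_ge0// ltW.
by rewrite mulr_ge0 ?exprn_ge0.
Qed.

Definition deriv_coef a k := k.+1%:R * a k.+1.

Lemma coef_bounded_deriv rho a : coef_bounded rho a -> coef_bounded rho (deriv_coef a).
Proof.
move=> /coef_bounded_natmul ba r rr; have [M hM] := ba r rr.
case/andP: rr => r0 _; exists (M / r) => k.
by rewrite ler_pdivlMr// -mulrA -exprSr hM.
Qed.

Lemma psum_tail_le a z m n r : cabs z <= r -> 0 < r ->
  cabs (psum a z (m + n) - psum a z m) <=
  cabs z ^+ m / r ^+ m * \sum_(k < m + n) cabs (a k) * r ^+ k.
Proof.
move=> zr r0; rewrite /psum big_split_ord/= addrAC subrr add0r.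
apply: (le_trans (cabs_sum _ _ _)); rewrite big_split_ord/= mulrDr ler_wpDl//.
  rewrite mulr_ge0 ?divr_ge0 ?exprn_ge0 ?cabs_ge0 ?sumr_ge0// 1?ltW// => i _.
  by rewrite mulr_ge0 ?cabs_ge0 ?exprn_ge0// ltW.
rewrite mulr_sumr; apply: ler_sum => k _.
rewrite Normc.normcM cabsX !exprD.
have -> : cabs z ^+ m / r ^+ m * (cabs (a (m + k)%N) * (r ^+ m * r ^+ k)) =
   cabs (a (m + k)%N) * (cabs z ^+ m * r ^+ k) by field; rewrite expf_neq0// gt_eqF.
rewrite ler_wpM2l ?cabs_ge0// ler_wpM2l ?exprn_ge0 ?cabs_ge0//.
by rewrite lerXn2r// ?nnegrE ?cabs_ge0// ltW.
Qed.

Lemma psum_cvg rho a z : coef_bounded rho a -> cabs z < rho -> exists l, clim (psum a z) l.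
Proof.
move=> ba zr; have z0 := cabs_ge0 z.
pose r := (cabs z + rho) / 2.
have [|M hM] := @coef_bounded_sum rho a r ba; first by rewrite /r; lra.
have zle : cabs z <= r by rewrite /r; lra.
have cv (f : R[i] -> R) : (forall z, `|f z| <= cabs z) -> cvgn (series (fun k => f (a k * z ^+ k))).
  move=> fz; apply: normed_cvg.
  apply: nondecreasing_is_cvgn.
    by move=> m n mn; rewrite -subr_ge0 /= (sub_series_geq _ mn) sumr_ge0.
  exists M => _ /= [n _ <-]; rewrite /series/= big_mkord.
  apply: le_trans (hM n); apply: ler_sum => k _.
  apply: (le_trans (fz _)); rewrite Normc.normcM cabsX ler_wpM2l ?cabs_ge0//.
  by rewrite lerXn2r// nnegrE// (le_trans z0).
have /cvg_ex[/= l1 h1] := cv (@complex.Re R) (@Re_le_cabs _).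
have /cvg_ex[/= l2 h2] := cv (@complex.Im R) (@Im_le_cabs _).
exists (l1 +i* l2) => e e0; have e2 : 0 < e / 2 by lra.
have /cvgrPdist_lt /(_ _ e2)[N1 _ hN1] := h1.
have /cvgrPdist_lt /(_ _ e2)[N2 _ hN2] := h2.
exists (maxn N1 N2) => n; rewrite geq_max => /andP[n1 n2].
apply: (le_lt_trans (cabs_le_ReIm _)); rewrite ReB ImB /psum Re_sum Im_sum /=.
have := hN1 n n1; have := hN2 n n2; rewrite /series/= !big_mkord => a2 a1.
by rewrite (distrC _ l1) (distrC _ l2); lra.
Qed.

Definition is_power_series rho a (F : R[i] -> R[i]) :=
  coef_bounded rho a /\ forall z, cabs z < rho -> clim (psum a z) (F z).

(** The terms of a convergent series are bounded. *)
Lemma cvg_coef_bounded rho a : (forall z, cabs z < rho -> exists l, clim (psum a z) l) ->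
  coef_bounded rho a.
Proof.
move=> H r /andP[r0 rr].
have [|l hl] := H r%:C; first by rewrite cabs_real gtr0_norm.
have [N hN] := hl 1 ltr01.
exists (2 + \sum_(k < N) cabs (a k) * r ^+ k) => k.
have sum0 n : 0 <= \sum_(k < n) cabs (a k) * r ^+ k.
  by apply: sumr_ge0 => i _; rewrite mulr_ge0 ?cabs_ge0 ?exprn_ge0// ltW.
have [kN|Nk] := ltnP k N.
  rewrite (bigD1 (Ordinal kN))//= addrCA lerDl ltW// ltr_wpDr//.
  by apply: sumr_ge0 => i _; rewrite mulr_ge0 ?cabs_ge0 ?exprn_ge0// ltW.
rewrite ler_wpDr//; have := hN k.+1 (leqW Nk); have := hN k Nk.
have := cabs_dist_triangle l (psum a r%:C k.+1) (psum a r%:C k).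
rewrite (cabs_distC l) {1}/psum big_ord_recr/= -/(psum _ _ _) addrAC subrr add0r.
rewrite Normc.normcM cabsX cabs_real gtr0_norm//; lra.
Qed.

Lemma power_series_taylor rho a F r : is_power_series rho a F -> 0 < r < rho ->
  forall m, exists C, 0 <= C /\ forall z, cabs z <= r -> cabs (F z - psum a z m) <= C * cabs z ^+ m.
Proof.
move=> [ba hF] rr m; have [M hM] := coef_bounded_sum ba rr.
have M0 : 0 <= M by apply: le_trans (hM 0%N); rewrite big_ord0.
case/andP: rr => r0 rr; exists (M / r ^+ m); split; first by rewrite divr_ge0// exprn_ge0// ltW.
move=> z zr; apply: (clim_dist_le (N := m) (hF z (le_lt_trans zr rr))) => n mn.
rewrite -(subnKC mn); apply: (le_trans (psum_tail_le _ _ _ zr r0)).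
rewrite mulrC mulrA mulrAC ler_wpM2r ?exprn_ge0 ?cabs_ge0//.
by rewrite ler_wpM2r ?hM// invr_ge0 exprn_ge0// ltW.
Qed.

(** Multiplied by [r^2] to avoid the exponent [k - 2] for [k < 2]. *)
Lemma power_second_order z h k r : 0 < r -> cabs z <= r -> cabs (z + h) <= r ->
  r ^+ 2 * cabs ((z + h) ^+ k - z ^+ k - k%:R * h * z ^+ k.-1) <=
  k%:R ^+ 2 * cabs h ^+ 2 * r ^+ k.
Proof.
move=> r0 zr zhr; elim: k => [|k IH].
  by rewrite !expr0 subrr !mul0r subrr Normc.normc0 mulr0 expr0n/= !mul0r.
have -> : (z + h) ^+ k.+1 - z ^+ k.+1 - k.+1%:R * h * z ^+ k.+1.-1 =
    (z + h) * ((z + h) ^+ k - z ^+ k - k%:R * h * z ^+ k.-1) + k%:R * h ^+ 2 * z ^+ k.-1.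
  case: k {IH} => [|k] /=; first by rewrite !expr0 !expr1; ring.
  by rewrite -!natr1 !exprS; ring.
set P := (_ - _ - _) in IH *.
apply: (@le_trans _ _ (r ^+ 2 * (r * cabs P + k%:R * cabs h ^+ 2 * cabs z ^+ k.-1))).
  apply: ler_wpM2l; first by rewrite exprn_ge0// ltW.
  apply: (le_trans (le_normcD _ _)).
  by rewrite !Normc.normcM !cabsX cabs_nat lerD2r ler_wpM2r ?cabs_ge0.
apply: (@le_trans _ _ (r * (k%:R ^+ 2 * cabs h ^+ 2 * r ^+ k) + k%:R * cabs h ^+ 2 * r ^+ k.+1)).
  rewrite mulrDr; apply: lerD; first by rewrite mulrCA ler_wpM2l// ltW.
  case: k {IH P} => [|k] /=; first by rewrite !mul0r mulr0.
  rewrite mulrCA; apply: ler_wpM2l; first by rewrite mulr_ge0 ?exprn_ge0 ?cabs_ge0.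
  rewrite -[k.+2]addn2 exprD mulrC; apply: ler_wpM2r; first by rewrite exprn_ge0// ltW.
  by rewrite lerXn2r// ?nnegrE ?cabs_ge0// ltW.
rewrite (_ : _ + _ = (k%:R ^+ 2 + k%:R) * (cabs h ^+ 2 * r ^+ k.+1)); last by rewrite [r ^+ k.+1]exprS; ring.
rewrite -mulrA ler_wpM2r ?mulr_ge0 ?exprn_ge0 ?cabs_ge0 1?ltW//.
by rewrite -natr1; have : 0 <= k%:R :> R by []; nra.
Qed.

(** Termwise differentiation with a quadratic error term, in which form it
    passes to the limit of the partial sums.  The sum of the derived series is
    chosen among limits, as series are given by convergence only. *)
Lemma power_series_second_order rho a F : is_power_series rho a F -> exists F',
  is_power_series rho (deriv_coef a) F' /\
  forall z, cabs z < rho -> exists C e, 0 < e /\ forall h, cabs h < e ->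
     cabs (F (z + h) - F z - h * F' z) <= C * cabs h ^+ 2.
Proof.
move=> [ba hF].
have bd := coef_bounded_deriv ba.
pose F' z := if pselect (cabs z < rho) is left p then projT1 (cid (psum_cvg bd p)) else 0.
have hF' z : cabs z < rho -> clim (psum (deriv_coef a) z) (F' z).
  move=> zr; rewrite /F'; case: pselect => // p.
  exact: (projT2 (cid (psum_cvg bd p))).
exists F'; split; first by split.
move=> z zr; have z0 := cabs_ge0 z; pose r := (cabs z + rho) / 2.
have rr : 0 < r < rho by rewrite /r; lra.
have [M hM] := coef_bounded_sum (coef_bounded_natmul (coef_bounded_natmul ba)) rr.
case/andP: (rr) => r0 rrho.
exists (M / r ^+ 2), (r - cabs z); split; first by rewrite /r; lra.
move=> h hr; have zhr : cabs (z + h) <= r by have := le_normcD z h; lra.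
have zr' : cabs z <= r by rewrite /r; lra.
have l1 := hF _ (le_lt_trans zhr rrho); have l2 := hF _ zr.
have l3 := climZ h (clim_shift (hF' _ zr)).
rewrite -addrA -opprD; apply: (clim_le_dist l1 (climD l2 l3)) => n.
have -> : psum a (z + h) n - (psum a z n + h * psum (deriv_coef a) z n.-1) =
    \sum_(k < n) a k * ((z + h) ^+ k - z ^+ k - k%:R * h * z ^+ k.-1).
  have -> : h * psum (deriv_coef a) z n.-1 = \sum_(k < n) a k * (k%:R * h * z ^+ k.-1).
    case: n => [|n]; first by rewrite /psum !big_ord0 mulr0.
    rewrite big_ord_recl/= !mul0r mulr0 add0r mulr_sumr; apply: eq_bigr => k _.
    by rewrite /deriv_coef /bump/= add1n/=; ring.
  rewrite opprD addrA /psum -!sumrB; apply: eq_bigr => k _; ring.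
apply: (le_trans (cabs_sum _ _ _)).
apply: (@le_trans _ _ (\sum_(k < n) cabs (k%:R * (k%:R * a k)) * r ^+ k * (cabs h ^+ 2 / r ^+ 2))).
  apply: ler_sum => k _; rewrite !Normc.normcM cabs_nat.
  rewrite (_ : _ * (_ / _) = cabs (a k) * (k%:R ^+ 2 * cabs h ^+ 2 * r ^+ k / r ^+ 2)); last first.
    by field; rewrite gt_eqF.
  rewrite ler_wpM2l ?cabs_ge0// ler_pdivlMr ?exprn_gt0// mulrC.
  exact: power_second_order.
have r20 : 0 <= r ^+ 2 by rewrite exprn_ge0// ltW.
rewrite -mulr_suml (_ : M / _ * _ = M * (cabs h ^+ 2 / r ^+ 2)); last by ring.
apply: ler_wpM2r => //.
by rewrite divr_ge0// exprn_ge0// cabs_ge0.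
Qed.

End PowerSeries.

Section PowerSeriesDerivatives.
Context {R : realType}.
Implicit Types (a : nat -> R[i]) (rho r : R).

Lemma near_normr_lt (b rho : R) : `|b| < rho -> \forall y \near b, `|y| < rho.
Proof.
move=> br; near=> y.
have : y \in `](- rho), rho[ by near: y; apply: near_in_itvoo; rewrite in_itv/= -ltr_norml.
by rewrite in_itv/= -ltr_norml.
Unshelve. all: by end_near.
Qed.

Lemma second_order_is_derive (f : R -> R) (x d C e : R) : 0 < e ->
  (forall h : R, `|h| < e -> `|f (x + h) - f x - h * d| <= C * h ^+ 2) ->
  is_derive x 1 f d.
Proof.
move=> e0 H.
have key : h^-1 *: ((f \o shift x) (h *: 1) - f x) @[h --> 0^'] --> d.
  apply/cvgrPdist_lt => eps eps0; near=> h.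
  have h0 : h != 0 by near: h; exact: nbhs_dnbhs_neq.
  have hh : `|h| < Num.min e (eps / (`|C| + 1)).
    near: h; apply: dnbhs0_lt; rewrite lt_min e0 divr_gt0// ltr_wpDl//.
  move: hh; rewrite lt_min => /andP[he hC].
  have := H _ he; rewrite /= /shift/= [h *: 1]mulr1 [h + x]addrC => Hh.
  have -> : d - h^-1 *: (f (x + h) - f x) = - (h^-1 * (f (x + h) - f x - h * d)).
    by rewrite [_ *: _]/(_ * _) mulrBr mulKf// opprB.
  rewrite normrN normrM normfV ltr_pdivrMl ?normr_gt0//.
  apply: (le_lt_trans Hh); rewrite -real_normK ?num_real// expr2 mulrA.
  rewrite mulrC ltr_pM2l ?normr_gt0//.
  move: hC; rewrite ltr_pdivlMr ?ltr_wpDl// => hC; apply: le_lt_trans hC.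
  rewrite mulrC; apply: ler_wpM2l => //.
  by rewrite (le_trans (ler_norm _))// lerDl.
apply: DeriveDef; first by apply/cvg_ex; exists d.
exact: cvg_lim key.
Unshelve. all: by end_near.
Qed.

Lemma second_order_derive1 (F : R[i]^o -> R[i]^o) (z d : R[i]^o) (C e : R) : 0 < e ->
  (forall h : R[i], cabs h < e -> cabs (F (z + h) - F z - h * d) <= C * cabs h ^+ 2) ->
  derive1 F z = d.
Proof.
move=> e0 H.
have key : h^-1 *: (F (h + z) - F z) @[h --> (0 : R[i]^o)^'] --> d.
  apply/cvgrPdist_lt => eps eps0.
  have [eIm eRe] := gt0_complex eps0.
  pose m := Num.min e (complex.Re eps / (`|C| + 1)).
  have m0 : 0 < m by rewrite lt_min e0 divr_gt0// ltr_wpDl.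
  near=> h.
  have h0 : h != 0 by near: h; exact: nbhs_dnbhs_neq.
  have hh : `|h| < m%:C.
    by near: h; apply: dnbhs0_lt; rewrite ltcR.
  move: hh; rewrite normr_cabs ltcR lt_min => /andP[he hC].
  have := H _ he; rewrite [z + h]addrC => Hh.
  have -> : d - h^-1 *: (F (h + z) - F z) = - (h^-1 * (F (h + z) - F z - h * d)).
    by rewrite mulrBr mulKf// opprB.
  have ch0 : 0 < cabs h.
    rewrite lt_neqAle cabs_ge0 andbT eq_sym; apply: contra h0 => /eqP/Normc.eq0_normc ->.
    by [].
  rewrite normrN normr_cabs Normc.normcM Normc.normcV ltcE/= eIm eqxx/=.
  rewrite ltr_pdivrMl//.
  apply: (le_lt_trans Hh); rewrite expr2 mulrA.
  rewrite mulrC ltr_pM2l//.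
  move: hC; rewrite ltr_pdivlMr ?ltr_wpDl// => hC; apply: le_lt_trans hC.
  rewrite mulrC; apply: ler_wpM2l => //; first exact: cabs_ge0.
  by rewrite (le_trans (ler_norm _))// lerDl.
exact: cvg_lim key.
Unshelve. all: by end_near.
Qed.

(** Stated together with a second order expansion of each derivative, which is
    what the real differentiability along the axis below is read off from. *)
Lemma power_series_derive1n rho a (F : R[i]^o -> R[i]^o) j : is_power_series rho a F ->
  is_power_series rho (iter j deriv_coef a) (derive1n j F) /\
  forall z, cabs z < rho -> exists C e : R, 0 < e /\ forall h, cabs h < e ->
     cabs (derive1n j F (z + h) - derive1n j F z - h * derive1n j.+1 F z) <= C * cabs h ^+ 2.
Proof.
elim: j a F => [|j IH] a F aF.
  split=> // z zr.
  have [F' [_ h]] := power_series_second_order aF.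
  have [C [e [e0 H]]] := h z zr; exists C, e; split=> // k hk.
  by rewrite derive1n1 (second_order_derive1 e0 H) H.
have [F' [[b1 b2] h]] := power_series_second_order aF.
have FF' z : cabs z < rho -> derive1 F z = F' z.
  by move=> zr; have [C [e [e0 H]]] := h z zr; exact: (second_order_derive1 e0 H).
have aF' : is_power_series rho (deriv_coef a) (derive1 F).
  by split=> // z zr; rewrite FF'//; exact: b2.
have [H1 H2] := IH _ _ aF'.
have E k : derive1n k.+1 F = derive1n k (derive1 F) by rewrite /derive1n iterSr.
by rewrite !E iterSr; split.
Qed.

Lemma power_series_at0 rho a F : 0 < rho -> is_power_series rho a F -> F 0 = a 0%N.
Proof.
move=> r0 [_ h]; apply: (clim_uniq (h 0 _)); first by rewrite Normc.normc0.
apply: (clim_eventually_const (N := 1)) => -[//|n] _.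
rewrite /psum big_ord_recl/= expr0 mulr1 big1 ?addr0// => i _.
by rewrite /bump/= add1n expr0n mulr0.
Qed.

Lemma power_series_derive1n_at0 rho a (F : R[i]^o -> R[i]^o) j : 0 < rho ->
  is_power_series rho a F -> derive1n j F 0 = (j`!)%:R * a j.
Proof.
move=> r0 aF; have [H _] := power_series_derive1n j aF.
rewrite (power_series_at0 r0 H).
have -> : forall k, iter j deriv_coef a k = ((k + j) ^_ j)%:R * a (k + j)%N.
  elim: j a {aF H} => [|j IH] a k; first by rewrite addn0 mul1r.
  rewrite iterS /deriv_coef IH mulrA -natrM addSnnS; congr (_%:R * _).
  by rewrite ffactnSr (_ : (k + j.+1 - j = k.+1)%N) 1?mulnC//; lia.
by rewrite add0n ffactnn.
Qed.

Lemma power_series_Re_derive rho a (F : R[i]^o -> R[i]^o) j (c : R[i]) (b : R) :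
  is_power_series rho a F -> `|b| < rho ->
  is_derive b 1 (fun b => complex.Re (c * derive1n j F b%:C))
    (complex.Re (c * derive1n j.+1 F b%:C)).
Proof.
move=> aF br; have [_ H] := power_series_derive1n j aF.
have [|C [e [e0 h]]] := H b%:C; first by rewrite cabs_real.
apply: (@second_order_is_derive _ _ _ (cabs c * C) e e0) => k ke.
have := h k%:C; rewrite cabs_real => /(_ ke) hk.
have -> : complex.Re (c * derive1n j F (b + k)%:C) - complex.Re (c * derive1n j F b%:C) -
  k * complex.Re (c * derive1n j.+1 F b%:C) =
  complex.Re (c * (derive1n j F (b%:C + k%:C) - derive1n j F b%:C - k%:C * derive1n j.+1 F b%:C)).
  by rewrite -rmorphD/= !mulrBr !ReB mulrCA Re_realM.
apply: (le_trans (Re_le_cabs _)); rewrite Normc.normcM -mulrA.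
rewrite -(real_normK (num_real k)); apply: ler_wpM2l => //; exact: cabs_ge0.
Qed.

(** The function [Re ('i F)] vanishes on the real axis, hence so do all its
    derivatives along that axis. *)
Lemma power_series_real_coef rho a (F : R[i]^o -> R[i]^o) : 0 < rho ->
  is_power_series rho a F -> (forall b : R, `|b| < rho -> complex.Im (F b%:C) = 0) ->
  forall j, complex.Im (a j) = 0.
Proof.
move=> r0 aF Fr j.
have H k (b : R) : `|b| < rho -> complex.Re ('i * derive1n k F b%:C) = 0.
  elim: k b => [|k IH] b br.
    by rewrite mulrC ReiNIm derive1n0 Fr// oppr0.
  have := is_derive_derive1 (power_series_Re_derive k 'i aF br) => <-.
  rewrite derive1E (near_eq_derive (g := cst 0)) ?derive_cst//.
  near=> y; apply: IH; near: y; exact: near_normr_lt.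
have := H j 0; rewrite normr0 => /(_ r0); rewrite (power_series_derive1n_at0 _ r0 aF).
rewrite mulrC ReiNIm -(rmorph_nat (real_complex R)) Im_realM => /eqP.
by rewrite oppr_eq0 mulf_eq0 pnatr_eq0 -[_ == 0%N]negbK -lt0n fact_gt0/= => /eqP.
Unshelve. all: by end_near.
Qed.

End PowerSeriesDerivatives.

(** * Derivatives of a logarithm *)

Section LogarithmicDerivative.
Context {R : realType}.
Variables (f : nat -> R -> R) (delta : R).
Hypothesis df : forall j (b : R), `|b| < delta -> is_derive b 1 (f j) (f j.+1 b).
Hypothesis f0 : forall b, `|b| < delta -> 0 < f 0%N b.

Let g b := ln (f 0%N b).
Let phi k b := f k b / k`!%:R.
Let gam k b := derive1n k.+1 g b / k`!%:R.

Let factn0 k : (k`!%:R : R) != 0.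
Proof. by rewrite pnatr_eq0 -lt0n fact_gt0. Qed.

Let dphi k (b : R) : `|b| < delta -> is_derive b 1 (phi k) (k.+1%:R * phi k.+1 b).
Proof.
move=> bd; apply: is_derive_eqfun (is_derive_funZ (k`!%:R^-1) (df k bd)).
  by move=> y; rewrite /phi mulrC.
rewrite /phi factS natrM; field; rewrite factn0 nat1r pnatr_eq0//.
Qed.

Lemma near_eq_is_derive (F G : R -> R) (b d : R) : (\forall y \near b, F y = G y) ->
  is_derive b 1 F d -> is_derive b 1 G d.
Proof.
move=> FG [dF vF]; apply: DeriveDef; last by rewrite -(near_eq_derive _ FG).
by apply: near_eq_derivable dF.
Qed.

(** Two statements by one induction.  The recursion of order [k] expresses the
    derivative of order [k + 1] of [log f] by differentiable functions in a
    whole neighbourhood, so it is differentiable in turn; differentiating the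
    recursion then gives the next one. *)
Lemma log_leibniz k (b : R) : `|b| < delta ->
  (forall i, (i <= k)%N -> is_derive b 1 (derive1n i g) (derive1n i.+1 g b)) /\
  (k.+1%:R * phi k.+1 b = \sum_(i < k.+1) gam i b * phi (k - i)%N b).
Proof.
elim: k b => [|k IH] b bd.
  have dg : is_derive b 1 g (f 1%N b * (f 0%N b)^-1).
    by apply: (@is_derive_fun_comp _ (@ln R) (f 0%N)); [exact/is_derive1_ln/f0|exact: df].
  have g1 : derive1n 1 g b = f 1%N b / f 0%N b by rewrite derive1n1 (is_derive_derive1 dg).
  split; first by move=> i; rewrite leqn0 => /eqP ->; rewrite g1.
  by rewrite mul1r big_ord1 /gam /phi g1 /= !divr1 divfK// gt_eqF// f0.
have nearI : \forall y \near b, `|y| < delta by exact: near_normr_lt.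
have dgam i : (i < k)%N -> is_derive b 1 (gam i) (i.+1%:R * gam i.+1 b).
  move=> ik; have [h _] := IH b bd.
  apply: is_derive_eqfun (is_derive_funZ (i`!%:R^-1) (h i.+1 ik)).
    by move=> y; rewrite /gam mulrC.
  rewrite /gam factS natrM; field; rewrite factn0 nat1r pnatr_eq0//.
have phi0 y : `|y| < delta -> phi 0%N y != 0.
  by move=> yd; rewrite /phi fact0 divr1 gt_eqF// f0.
have dgk : exists d, is_derive b 1 (gam k) d.
  have dsum := @is_derive_funsum R k (fun i y => gam i y * phi (k - i)%N y) _ b
     (fun i ik => is_derive_funM (dgam i ik) (dphi (k - i) bd)).
  have dnum := is_derive_funB (is_derive_funZ k.+1%:R (dphi k.+1 bd)) dsum.
  have dinv := is_deriveV (phi0 b bd) (dphi 0 bd).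
  have dall := is_derive_funM dnum dinv.
  eexists; apply: near_eq_is_derive dall; near=> y.
  have yd : `|y| < delta by near: y.
  have [_ ->] := IH y yd; rewrite big_ord_recr/= addrAC subrr add0r subnn.
  by rewrite mulfK// phi0.
have dgk1 : is_derive b 1 (derive1n k.+1 g) (derive1n k.+2 g b).
  have [d hd] := dgk.
  have h : is_derive b 1 (derive1n k.+1 g) (k`!%:R * d).
    apply: is_derive_eqfun (is_derive_funZ k`!%:R hd) => // y.
    by rewrite /gam mulrC divfK.
  by rewrite -[derive1n k.+2 g]/(derive1 (derive1n k.+1 g)) (is_derive_derive1 h).
have dgam' i : (i <= k)%N -> is_derive b 1 (gam i) (i.+1%:R * gam i.+1 b).
  rewrite leq_eqVlt => /predU1P[->|]; last exact: dgam.
  apply: is_derive_eqfun (is_derive_funZ (k`!%:R^-1) dgk1).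
    by move=> y; rewrite /gam mulrC.
  rewrite /gam factS natrM; field; rewrite factn0 nat1r pnatr_eq0//.
split.
  move=> i; rewrite leq_eqVlt => /predU1P[->//|ik].
  by have [h _] := IH b bd; exact: h.
have dsum := @is_derive_funsum R k.+1 (fun i y => gam i y * phi (k - i)%N y) _ b
     (fun i ik => is_derive_funM (dgam' i ik) (dphi (k - i) bd)).
have dl := is_derive_funZ k.+1%:R (dphi k.+1 bd).
have E : k.+1%:R * (k.+2%:R * phi k.+2 b) =
  \sum_(i < k.+1) (gam i b * ((k - i).+1%:R * phi (k - i).+1 b) +
     phi (k - i)%N b * (i.+1%:R * gam i.+1 b)).
  have dl' : is_derive b 1 (fun y => \sum_(i < k.+1) gam i y * phi (k - i)%N y)
      (k.+1%:R * (k.+2%:R * phi k.+2 b)).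
    apply: near_eq_is_derive dl; near=> y.
    have yd : `|y| < delta by near: y.
    by have [_ ->] := IH y yd.
  by rewrite -(is_derive_derive1 dl') (is_derive_derive1 dsum).
apply: (@mulfI _ k.+1%:R); first by rewrite pnatr_eq0.
rewrite {}E big_split/=.
have -> : \sum_(i < k.+1) gam i b * ((k - i).+1%:R * phi (k - i).+1 b) =
    \sum_(i < k.+2) (k.+1 - i)%:R * (gam i b * phi (k.+1 - i)%N b).
  rewrite [RHS]big_ord_recr/= subnn mul0r addr0; apply: eq_bigr => -[i /= ik] _.
  by rewrite subSn//; ring.
have -> : \sum_(i < k.+1) phi (k - i)%N b * (i.+1%:R * gam i.+1 b) =
    \sum_(i < k.+2) i%:R * (gam i b * phi (k.+1 - i)%N b).
  rewrite [RHS]big_ord_recl/= mul0r add0r; apply: eq_bigr => -[i /= ik] _.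
  by rewrite /bump/= add1n subSS; ring.
rewrite -big_split/= mulr_sumr; apply: eq_bigr => -[i /= ik] _.
by rewrite -mulrDl -natrD subnK.
Unshelve. all: by end_near.
Qed.

End LogarithmicDerivative.

(** The [chi] are derivatives of the logarithm of the real function
    [b |-> Re (F b)], which is positive near 0. *)
Lemma exp_coefs_chi (R : realType) (rho : R) (a : nat -> R[i]) (F : R[i]^o -> R[i]^o) N :
  0 < rho -> is_power_series rho a F -> a 0%N = 1 ->
  exp_coefs (chi F) (fun k => complex.Re (a k)) N.
Proof.
move=> r0 aF a0; split; first by rewrite a0.
move=> k _.
pose f j (b : R) := complex.Re (derive1n j F b%:C).
have df j (b : R) : `|b| < rho -> is_derive b 1 (f j) (f j.+1 b).
  move=> br; have := power_series_Re_derive j 1 aF br.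
  by rewrite !mul1r; apply: is_derive_eqfun => // y; rewrite mul1r.
have f00 : f 0%N 0 = 1.
  by rewrite /f derive1n0 -[0%:C]/(0 : R[i]) (power_series_at0 r0 aF) a0.
have c0 : {for 0, continuous (f 0%N)}.
  apply: differentiable_continuous; apply/derivable1_diffP.
  have := df 0%N 0; rewrite normr0 => /(_ r0) h; exact: ex_derive.
have : \forall b \near 0, 0 < f 0%N b.
  by move/cvgr_gt: c0; apply; rewrite f00.
move=> /nbhs_ballP[e /= e0 he].
pose delta := Num.min e rho.
have d0 : 0 < delta by rewrite lt_min e0.
have [|||_] := @log_leibniz R f delta _ _ k 0.
- by move=> j b; rewrite lt_min => /andP[_ br]; exact: df.
- move=> b; rewrite lt_min => /andP[be _]; apply: he.
  by rewrite /ball/= sub0r normrN.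
- by rewrite normr0.
have fk j : f j 0 / j`!%:R = complex.Re (a j).
  rewrite /f -[0%:C]/(0 : R[i]) (power_series_derive1n_at0 _ r0 aF).
  by rewrite -(rmorph_nat (real_complex R)) Re_realM mulrC mulKf.
rewrite fk => ->; apply: eq_bigr => i _; rewrite fk.
by rewrite /chi.
Qed.

(** * Integrals of continuous functions over segments *)

Lemma exp_trunc2 (F : fieldType) (z : F) : \sum_(m < 2) z ^+ m / m`!%:R = 1 + z.
Proof. by rewrite !big_ord_recl big_ord0 addr0 expr0 expr1 fact0 !divr1. Qed.

Section ContinuousFunctions.
Context {R : realType}.
Implicit Types (f g : R -> R).

Lemma cont_add f g : continuous f -> continuous g -> continuous (fun u => f u + g u).
Proof. by move=> cf cg x; apply: continuousD; [exact: cf|exact: cg]. Qed.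

Lemma cont_opp f : continuous f -> continuous (fun u => - f u).
Proof. by move=> cf x; apply: continuousN; exact: cf. Qed.

Lemma cont_sub f g : continuous f -> continuous g -> continuous (fun u => f u - g u).
Proof. by move=> cf cg; apply: cont_add => //; exact: cont_opp. Qed.

Lemma cont_mul f g : continuous f -> continuous g -> continuous (fun u => f u * g u).
Proof. by move=> cf cg x; apply: continuousM; [exact: cf|exact: cg]. Qed.

Lemma cont_cst (c : R) : continuous (fun _ : R => c).
Proof. by move=> x; exact: cvg_cst. Qed.

Lemma cont_id : continuous (fun u : R => u).
Proof. by move=> x. Qed.

Lemma cont_compose f g : continuous f -> continuous g -> continuous (fun u => f (g u)).
Proof. by move=> cf cg x; apply: (@continuous_comp _ _ _ g f); [exact: cg|exact: cf]. Qed.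

Lemma cont_pow f n : continuous f -> continuous (fun u => f u ^+ n).
Proof.
move=> cf; elim: n => [|n IH].
  by under eq_fun do rewrite expr0; exact: cont_cst.
by under eq_fun do rewrite exprS; exact: cont_mul.
Qed.

Lemma cont_sum (I : Type) (r : seq I) (Q : pred I) (F : I -> R -> R) :
  (forall i, continuous (F i)) -> continuous (fun u => \sum_(i <- r | Q i) F i u).
Proof.
move=> h; elim: r => [|i r IH].
  by under eq_fun do rewrite big_nil; exact: cont_cst.
under eq_fun do rewrite big_cons.
by case: (Q i) => //; exact: cont_add.
Qed.

Lemma cont_normr f : continuous f -> continuous (fun u => `|f u|).
Proof. by move=> cf x; apply: cvg_norm; exact: cf. Qed.

Lemma is_derive_continuous f (df : R -> R) : (forall x : R, is_derive x 1 f (df x)) -> continuous f.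
Proof.
move=> h x; apply: differentiable_continuous; apply/derivable1_diffP.
by have := h x => hx; exact: ex_derive.
Qed.

End ContinuousFunctions.

Section Integral.
Context {R : realType}.
Implicit Types (f g : R -> R) (a b c : R).

Definition Int a b f : R := Rintegral (@lebesgue_measure R) `[a, b] f.

Lemma cont_integrable a b f : continuous f ->
  (@lebesgue_measure R).-integrable `[a, b] (EFin \o f).
Proof.
move=> cf; apply: continuous_compact_integrable; first exact: segment_compact.
exact: continuous_subspaceT.
Qed.

Lemma eq_Int a b f g : (forall u, f u = g u) -> Int a b f = Int a b g.
Proof. by move=> h; congr (Int a b _); apply/funext. Qed.

Lemma IntD a b f g : continuous f -> continuous g ->
  Int a b (fun u => f u + g u) = Int a b f + Int a b g.
Proof. by move=> cf cg; rewrite /Int RintegralD//; exact: cont_integrable. Qed.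

Lemma IntZ a b f c : continuous f -> Int a b (fun u => c * f u) = c * Int a b f.
Proof. by move=> cf; rewrite /Int RintegralZl//; exact: cont_integrable. Qed.

Lemma IntB a b f g : continuous f -> continuous g ->
  Int a b (fun u => f u - g u) = Int a b f - Int a b g.
Proof.
move=> cf cg; rewrite (IntD a b cf (cont_opp cg)) -mulN1r -IntZ//.
by congr (_ + _); apply: eq_Int => u; rewrite mulN1r.
Qed.

Lemma Int_le a b f g : continuous f -> continuous g ->
  (forall u, a <= u <= b -> f u <= g u) -> Int a b f <= Int a b g.
Proof.
move=> cf cg h; have If := cont_integrable a b cf; have Ig := cont_integrable a b cg.
by apply: le_Rintegral => // u /=; rewrite in_itv/=; exact: h.
Qed.

Lemma Int_norm_le a b f : continuous f -> `|Int a b f| <= Int a b (fun u => `|f u|).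
Proof. by move=> cf; apply: le_normr_Rintegral => //; exact: cont_integrable. Qed.

Lemma Int_cst a b c : a <= b -> Int a b (fun=> c) = c * (b - a).
Proof.
move=> ab; rewrite /Int Rintegral_cst//.
congr (c * _); transitivity (fine (if (a%:E < b%:E)%E then (b%:E - a%:E)%E else 0%E)).
  by congr fine; exact: (lebesgue_measure_itv `[a, b]).
rewrite lte_fin; case: ltP => [//|ba].
have -> : a = b by lra.
by rewrite subrr.
Qed.

Lemma Int_ge0 a b f : (forall u, 0 <= f u) -> 0 <= Int a b f.
Proof. by move=> h; apply: Rintegral_ge0. Qed.

Lemma Int_sum (I : Type) (r : seq I) a b (F : I -> R -> R) : (forall i, continuous (F i)) ->
  Int a b (fun u => \sum_(i <- r) F i u) = \sum_(i <- r) Int a b (F i).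
Proof.
move=> h; elim: r => [|i r IH].
  under eq_Int do rewrite big_nil; rewrite big_nil.
  by under eq_Int do rewrite -[0](mul0r 0); rewrite (IntZ a b 0 (@cont_cst _ 0)) mul0r.
under eq_Int do rewrite big_cons; rewrite big_cons -IH IntD//.
by apply: cont_sum.
Qed.

Lemma Int_split a b c f : continuous f -> a <= c -> c <= b ->
  Int a b f = Int a c f + Int c b f.
Proof.
move=> cf ac cb; rewrite /Int.
have := @Rintegral_itvB R f (BLeft a) (BRight b) c (cont_integrable a b cf).
rewrite !bnd_simp => /(_ ac cb) h.
rewrite -(@Rintegral_itv_obnd_cbnd R c (BRight b) f) -?h; first by rewrite addrC subrK.
apply: integrableS (cont_integrable a b cf) => //.
by apply: subset_itvr; rewrite bnd_simp.
Qed.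

Lemma Int_FTC a b f (F : R -> R) : a <= b -> continuous f ->
  (forall u : R, is_derive u 1 F (f u)) -> Int a b f = F b - F a.
Proof.
move=> ab cf dF.
have cF : continuous F by exact: is_derive_continuous dF.
have [ab'|ba] := ltP a b; last first.
  have -> : a = b by lra.
  by rewrite subrr /Int set_itv1 Rintegral_set1.
rewrite /Int /Rintegral (@continuous_FTC2 R f F a b ab').
- by rewrite -EFinB.
- exact: continuous_subspaceT.
- split=> [x _||]; first by have := dF x => ?; exact: ex_derive.
    by apply: cvg_at_right_filter; exact: cF.
  by apply: cvg_at_left_filter; exact: cF.
- by move=> x _; rewrite (is_derive_derive1 (dF x)).
Qed.

Lemma Int_mono a b c f : continuous f -> (forall u, 0 <= f u) -> 0 <= a -> a <= b ->
  Int (- a) a f <= Int (- b) b f.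
Proof.
move=> cf f0 a0 ab.
rewrite (@Int_split (- b) b (- a))//; [|lra|lra].
rewrite (@Int_split (- a) b a)//; [|lra].
have := Int_ge0 (- b) (- a) f0; have := Int_ge0 a b f0; lra.
Qed.

Lemma Int_le_cst a b f (M : R) : a <= b -> continuous f ->
  (forall u, a <= u <= b -> f u <= M) -> Int a b f <= M * (b - a).
Proof. by move=> ab cf h; rewrite -(Int_cst M ab); apply: Int_le => //; exact: cont_cst. Qed.

End Integral.

Lemma cvg_seq_ext (R : realType) (f g : nat -> R) (l : R) : (forall n, f n = g n) ->
  f n @[n --> \oo] --> l -> g n @[n --> \oo] --> l.
Proof. by move=> /funext ->. Qed.

Lemma cvg_seq_scale (R : realType) (f : nat -> R) (c l : R) :
  f n @[n --> \oo] --> l -> c * f n @[n --> \oo] --> c * l.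
Proof. by move=> h; apply: cvgM => //; exact: cvg_cst. Qed.

(** * Fourier transform of the Gaussian times a power *)

Section GaussianFourier.
Context {R : realType}.
Variable lam : R.
Hypothesis lam0 : 0 < lam.
Implicit Types (y u a : R).

Definition gaussf (l u : R) : R := expR (- (l * u ^+ 2 / 2)).
Let E := gaussf lam.

Lemma is_derive_gaussf l u : is_derive u 1 (gaussf l) (- (l * u) * gaussf l u).
Proof.
apply: is_derive_fun_expR.
apply: is_derive_eqfun (is_derive_funZ (- (l / 2)) (is_derive_funX 2 u)).
  by move=> v; field.
by rewrite expr1; field.
Qed.

Lemma cont_gaussf l : continuous (gaussf l).
Proof. exact: is_derive_continuous (is_derive_gaussf l). Qed.

Lemma gaussf_ge0 l u : 0 <= gaussf l u. Proof. exact: expR_ge0. Qed.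

Lemma gaussfN l u : gaussf l (- u) = gaussf l u.
Proof. by rewrite /gaussf sqrrN. Qed.

(** The normalization of the normal law of variance [1 / lam], and symmetry to
    pass from half-lines to symmetric segments. *)
Lemma Int_gaussf_cvg : Int (- n%:R) n%:R E @[n --> \oo] --> Num.sqrt (2 * pi / lam).
Proof.
pose s := Num.sqrt lam^-1.
have li0 : 0 < lam^-1 by rewrite invr_gt0.
have s0 : s != 0 by rewrite gt_eqF// sqrtr_gt0.
have s2 : s ^+ 2 = lam^-1 by rewrite sqr_sqrtr// ltW.
have cE : continuous E := @cont_gaussf lam.
have := integral_normal_pdf 0 s; rewrite normal_pdfE//.
under eq_integral => x _.
  rewrite (_ : normal_fun 0 s x = E x); last first.
    rewrite /normal_fun /E /gaussf subr0 s2; congr expR.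
    by rewrite -mulr_natr; field; rewrite gt_eqF.
  over.
have pk0 : 0 < normal_peak s.
  by rewrite /normal_peak invr_gt0 sqrtr_gt0 s2 mulrn_wgt0// mulr_gt0// pi_gt0.
rewrite ge0_symfun_integralT; first last.
- by move=> x /=; rewrite /E gaussfN.
- exact: cont_mul (@cont_cst _ _) cE.
- by move=> x; rewrite mulr_ge0 ?gaussf_ge0// ltW.
rewrite -set_itvcy => H.
have mf : measurable_fun setT (fun x => normal_peak s * E x).
  by apply: measurable_realfun.continuous_measurable_fun; apply: cont_mul => //; exact: cont_cst.
have C := @ge0_cvgn_integral R (@lebesgue_measure R) (fun x => normal_peak s * E x)
  (fun x => mulr_ge0 (ltW pk0) (gaussf_ge0 lam x)) mf.
set L := (X in _ --> X) in C; set L' := (X in (2 * X)%E) in H.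
have LL' : L = L' by [].
have {}LE : L = (2^-1)%:E.
  rewrite LL'; move: H; case: L' {LL'} => [r| |].
    by rewrite -EFinM => -[] h; congr (_%:E); lra.
    by rewrite gt0_muley.
  by rewrite gt0_muleNy.
rewrite LE in C.
have C' : Int 0 n%:R E @[n --> \oo] --> (normal_peak s)^-1 * 2^-1.
  have h (n : nat) : Int 0 n%:R E = (normal_peak s)^-1 * Int 0 n%:R (fun x => normal_peak s * E x).
    by rewrite IntZ// mulKf// gt_eqF.
  apply: (cvg_seq_ext (fun n => esym (h n))).
  by apply: cvg_seq_scale; exact: (fine_cvg C).
have sym n : Int (- n%:R) n%:R E = 2 * Int 0 n%:R E.
  rewrite (@Int_split _ (- n%:R) n%:R 0)// ?oppr_le0//.
  have -> : Int (- n%:R) 0 E = Int 0 n%:R E; last by ring.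
  rewrite /Int /Rintegral; congr fine.
  have := @integration_by_substitution_oppr R E 0 n%:R (ler0n _ _) (@continuous_subspaceT _ _ _ _ cE).
  rewrite oppr0 => ->; apply: eq_integral => x _ /=.
  by rewrite /E gaussfN.
apply: (cvg_seq_ext (fun n => esym (sym n))).
have -> : Num.sqrt (2 * pi / lam) = 2 * ((normal_peak s)^-1 * 2^-1).
  rewrite mulrCA divff// mulr1 /normal_peak invrK s2; congr Num.sqrt.
  by rewrite -mulr_natr; ring.
by apply: cvg_seq_scale.
Qed.

Lemma Int_gaussf_le a : 0 <= a -> Int (- a) a E <= Num.sqrt (2 * pi / lam).
Proof.
move=> a0; have cE : continuous E := @cont_gaussf lam.
have [N aN] : exists N : nat, a <= N%:R.
  exists (Num.truncn a).+1; apply: ltW.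
  by have := truncnS_gt a.
rewrite -(cvg_lim (@Rhausdorff R) Int_gaussf_cvg); apply: limr_ge.
  by apply/cvg_ex; eexists; exact: Int_gaussf_cvg.
exists N => // n /= Nn.
apply: Int_mono => //; first exact: gaussf_ge0.
by rewrite (le_trans aN)// ler_nat.
Qed.

Lemma gaussf_cvg0 (l : R) : 0 < l -> gaussf l n%:R @[n --> \oo] --> 0.
Proof.
move=> l0; apply: (@squeeze_cvgr _ _ _ _ (fun=> 0) (fun n => (1 + 2 / l) * n.+1%:R^-1)).
- near=> n; rewrite gaussf_ge0/= /gaussf expRN.
  have h1 := expR_ge1Dx (l * n%:R ^+ 2 / 2).
  have n1 : n%:R <= n%:R ^+ 2 :> R by rewrite -natrX ler_nat; nia.
  have ll : 0 < l^-1 by rewrite invr_gt0.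
  have l1 : l * l^-1 = 1 by rewrite divff// gt_eqF.
  have n0 : 0 <= n%:R :> R by [].
  have x0 : 0 <= l * n%:R ^+ 2 by rewrite mulr_ge0// ltW.
  rewrite -[leLHS]mul1r ler_pdivrMr ?expR_gt0//.
  apply: (@le_trans _ _ ((1 + 2 / l) * (n.+1)%:R^-1 * (1 + l * n%:R ^+ 2 / 2))); last first.
    by rewrite ler_wpM2l// mulr_ge0 ?invr_ge0// addr_ge0// divr_ge0// ltW.
  rewrite mulrAC ler_pdivlMr ?ltr0n// mul1r -natr1.
  have -> : (1 + 2 / l) * (1 + l * n%:R ^+ 2 / 2) = 1 + l * n%:R ^+ 2 / 2 + 2 * l^-1 + n%:R ^+ 2 * (l * l^-1).
    by field; rewrite gt_eqF.
  rewrite l1; lra.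
- exact: cvg_cst.
- by rewrite -[X in _ --> X](mulr0 (1 + 2 / l)); apply: cvg_seq_scale; exact: cvg_harmonic.
Unshelve. all: by end_near.
Qed.

Lemma pow_le_exp p (x : R) : 0 <= x -> x ^+ p <= p%:R ^+ p * expR x.
Proof.
move=> x0; case: p => [|p].
  by rewrite !expr0 mul1r (le_trans _ (expR_ge1Dx x))// lerDl.
have -> : expR x = expR (x / p.+1%:R) ^+ p.+1.
  by rewrite -expRM_natl -mulr_natl mulrC divfK// pnatr_eq0.
rewrite -exprMn lerXn2r ?nnegrE ?mulr_ge0 ?expR_ge0//.
rewrite -ler_pdivrMl ?ltr0n// mulrC (le_trans _ (expR_ge1Dx _))// lerDr//.
Qed.

Definition gauss_moment_cst (p : nat) : R := p%:R ^+ p * expR 2.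

Lemma gauss_moment_cst_ge0 p : 0 <= gauss_moment_cst p.
Proof. by rewrite mulr_ge0 ?exprn_ge0 ?expR_ge0. Qed.

(** Powers of [sqrt lam * u] cost an arbitrarily small part of the exponent of
    the Gaussian; a quarter of it is paid here. *)
Lemma pow_le_gauss p u :
  (Num.sqrt lam * `|u|) ^+ p <= gauss_moment_cst p * expR (lam * u ^+ 2 / 8).
Proof.
have s2 : Num.sqrt lam ^+ 2 = lam by rewrite sqr_sqrtr// ltW.
set v := _ * `|u|.
have v0 : 0 <= v by rewrite mulr_ge0// sqrtr_ge0.
have -> : lam * u ^+ 2 = v ^+ 2 by rewrite exprMn s2 real_normK// num_real.
apply: (le_trans (pow_le_exp p v0)).
rewrite -mulrA ler_wpM2l ?exprn_ge0// -expRD ler_expR.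
by have := sqr_ge0 (v - 4); rewrite sqrrB; nra.
Qed.

(** The real part of [(iu)^m e^{-iuy}]. *)
Definition wave m y u : R := u ^+ m * cos (m%:R * (pi / 2) - u * y).
(** The real part of ['i (iu)^m e^{-iuy}], the boundary term when the Gaussian
    is integrated by parts against [(iu)^(m+1) e^{-iuy}]. *)
Definition dwave m y u : R := u ^+ m * cos (m.+1%:R * (pi / 2) - u * y).

Lemma is_derive_phase c y u : is_derive u 1 (fun u => c - u * y) (- y).
Proof.
apply: is_derive_eqfun (is_derive_funB (is_derive_cst c u 1) (is_derive_linear u y)).
  by move=> v; rewrite /= mulrC.
by rewrite sub0r.
Qed.

Lemma cos_shift m (x : R) :
  cos (m.+1%:R * (pi / 2) - x) = - sin (m%:R * (pi / 2) - x).
Proof.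
rewrite -natr1 mulrDl mul1r addrAC cosD cos_pihalf sin_pihalf; ring.
Qed.

Lemma sin_shift m (x : R) :
  sin (m.+1%:R * (pi / 2) - x) = cos (m%:R * (pi / 2) - x).
Proof.
rewrite -natr1 mulrDl mul1r addrAC sinD cos_pihalf sin_pihalf; ring.
Qed.

Lemma is_derive_dwave m y u :
  is_derive u 1 (dwave m y) (y * wave m y u - m%:R * wave m.-1 y u).
Proof.
apply: is_derive_eqfun (is_derive_funM (is_derive_funX m u)
   (is_derive_fun_cos (is_derive_phase (m.+1%:R * (pi / 2)) y u))) => //.
rewrite sin_shift /wave; case: m => [|m]; first by rewrite expr0; ring.
by rewrite /= [cos (m.+2%:R * _ - _)]cos_shift sin_shift; ring.
Qed.

Lemma cont_wave m y : continuous (wave m y).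
Proof.
apply: cont_mul; first exact: cont_pow (@cont_id R).
apply: cont_compose; first exact: continuous_cos.
by apply: is_derive_continuous => u; exact: is_derive_phase.
Qed.

Definition J m a y := Int (- a) a (fun u => wave m y u * E u).

(** Integration by parts; up to the boundary term this is the recurrence of
    the Hermite polynomials. *)
Lemma J_rec m a y : 0 <= a ->
  J m.+1 a y = y / lam * J m a y - m%:R / lam * J m.-1 a y -
    lam^-1 * (dwave m y a * E a - dwave m y (- a) * E (- a)).
Proof.
move=> a0; have cE : continuous E := @cont_gaussf lam.
pose F u := dwave m y u * E u.
pose f u := (y * (wave m y u * E u) - m%:R * (wave m.-1 y u * E u)) -
   lam * (wave m.+1 y u * E u).
have cw k : continuous (fun u => wave k y u * E u) by exact: cont_mul (@cont_wave k y) cE.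
have cf : continuous f.
  by apply: cont_sub; [apply: cont_sub|]; apply: cont_mul => //; exact: cont_cst.
have dF u : is_derive u 1 F (f u).
  apply: is_derive_eqfun (is_derive_funM (is_derive_dwave m y u) (is_derive_gaussf lam u)) => //.
  by rewrite /f /wave /dwave /E exprS; ring.
have := Int_FTC (a := - a) (b := a) (ltac:(lra)) cf dF.
rewrite /f IntB; [|apply: cont_sub; apply: cont_mul => //; exact: cont_cst|apply: cont_mul => //; exact: cont_cst].
rewrite IntB; [|apply: cont_mul => //; exact: cont_cst|apply: cont_mul => //; exact: cont_cst].
rewrite !IntZ// -!/(J _ _ _) -/(F a) -/(F (- a)) => <-.
by field; rewrite gt_eqF.
Qed.

Lemma cos_second_order (x h : R) : `|cos (x + h) - cos x + h * sin x| <= h ^+ 2 * expR `|h|.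
Proof.
pose z : R[i] := 0 +i* h.
have cz : cabs z = `|h| by rewrite cabsE/= expr0n/= add0r sqrtr_sqr.
have := cexp_taylor 2 z; rewrite cz real_normK ?num_real// => H; apply: le_trans H.
have -> : \sum_(m < 2) z ^+ m / m`!%:R = 1 + z.
  exact: exp_trunc2.
have -> : cos (x + h) - cos x + h * sin x =
    complex.Re ((cos x +i* sin x) * (cexp z - (1 + z))).
  by rewrite /cexp /= expR0 cosD; ring.
apply: (le_trans (Re_le_cabs _)); rewrite Normc.normcM.
by rewrite cabsE/= cos2Dsin2 sqrtr1 mul1r.
Qed.

Lemma is_derive_J0 a y : 0 <= a -> is_derive y 1 (J 0 a) (- J 1 a y).
Proof.
move=> a0; have cE : continuous E := @cont_gaussf lam.
have cw k z : continuous (fun u => wave k z u * E u) by exact: cont_mul (@cont_wave k z) cE.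
apply: (@second_order_is_derive _ _ _ _ (a ^+ 2 * expR a * (a - - a)) 1 ltr01) => h h1.
have -> : J 0 a (y + h) - J 0 a y - h * - J 1 a y =
    Int (- a) a (fun u => wave 0 (y + h) u * E u - wave 0 y u * E u + h * (wave 1 y u * E u)).
  rewrite IntD; [|exact: cont_sub|by apply: cont_mul => //; exact: cont_cst].
  by rewrite IntB// IntZ// -!/(J _ _ _); ring.
have cI : continuous (fun u => wave 0 (y + h) u * E u - wave 0 y u * E u + h * (wave 1 y u * E u)).
  by apply: cont_add; [exact: cont_sub|apply: cont_mul => //; exact: cont_cst].
apply: (le_trans (Int_norm_le _ _ cI)).
rewrite mulrAC; apply: Int_le_cst; [lra|exact: cont_normr|].
move=> u /andP[u1 u2].
have ua : `|u| <= a by rewrite ler_norml u1.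
have -> : wave 0 (y + h) u * E u - wave 0 y u * E u + h * (wave 1 y u * E u) =
   (cos (u * y + u * h) - cos (u * y) + (u * h) * sin (u * y)) * E u.
  rewrite /wave !expr0 !mul0r !sub0r !cosN mulrDr expr1 cos_shift mul0r sub0r sinN; ring.
have E1 : E u <= 1 by rewrite -expR0 ler_expR oppr_le0 divr_ge0// mulr_ge0 ?sqr_ge0// ltW.
rewrite normrM (ger0_norm (gaussf_ge0 _ _)) -[leRHS]mulr1.
apply: ler_pM => //; first exact: gaussf_ge0.
apply: (le_trans (cos_second_order _ _)).
rewrite exprMn normrM [leLHS]mulrAC; apply: ler_wpM2r; first exact: sqr_ge0.
apply: ler_pM; [exact: sqr_ge0|exact: expR_ge0| |].
  by rewrite -(real_normK (num_real u)) lerXn2r ?nnegrE.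
by rewrite ler_expR -[leRHS]mulr1; apply: ler_pM => //; exact: ltW.
Qed.

(** Differentiating under the integral gives [- J 1], which [J_rec] turns into
    [- y / lam * J 0] and a boundary term: [J 0] solves the equation of the
    Gaussian up to a small error. *)
Lemma gaussf_J0_variation a y : 0 <= a -> 0 <= y ->
  `|expR (y ^+ 2 / (2 * lam)) * J 0 a y - J 0 a 0| <=
  expR (y ^+ 2 / (2 * lam)) * (2 / lam) * y * E a.
Proof.
move=> a0 y0.
pose h z := expR (z ^+ 2 / (2 * lam)) * J 0 a z.
pose dh z := expR (z ^+ 2 / (2 * lam)) * lam^-1 * (dwave 0 z a * E a - dwave 0 z (- a) * E (- a)).
have de (z : R) : is_derive z 1 (fun z => expR (z ^+ 2 / (2 * lam))) (z / lam * expR (z ^+ 2 / (2 * lam))).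
  apply: is_derive_fun_expR.
  apply: is_derive_eqfun (is_derive_funZ ((2 * lam)^-1) (is_derive_funX 2 z)).
    by move=> v; rewrite mulrC.
  by rewrite expr1; field; rewrite gt_eqF.
have dhE (z : R) : is_derive z 1 h (dh z).
  apply: is_derive_eqfun (is_derive_funM (de z) (is_derive_J0 z a0)) => //.
  by rewrite /dh J_rec//; ring.
have ch : {within `[0, y], continuous h}.
  exact: continuous_subspaceT (is_derive_continuous dhE).
have [z] := MVT_segment y0 (fun x _ => dhE x) ch.
rewrite in_itv/= => /andP[z0 zy].
have -> : h 0 = J 0 a 0 by rewrite /h expr0n/= mul0r expR0 mul1r.
rewrite -/(h y) => ->; rewrite subr0 normrM (ger0_norm y0) [leRHS]mulrAC.
apply: ler_wpM2r => //.
rewrite /dh normrM ger0_norm ?mulr_ge0 ?expR_ge0 ?invr_ge0 ?(ltW lam0)//.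
rewrite (_ : expR (y ^+ 2 / (2 * lam)) * (2 / lam) * E a =
  expR (y ^+ 2 / (2 * lam)) * lam^-1 * (2 * E a)); last by ring.
apply: ler_pM; rewrite ?mulr_ge0 ?expR_ge0 ?invr_ge0 ?(ltW lam0)//.
  rewrite ler_wpM2r ?invr_ge0 ?(ltW lam0)// ler_expR ler_wpM2r ?invr_ge0 ?mulr_ge0 ?(ltW lam0)//.
  by rewrite lerXn2r ?nnegrE.
rewrite /dwave !expr0 !mul1r {2}/E gaussfN -/(E a) -mulrBl normrM (ger0_norm (gaussf_ge0 _ _)).
rewrite ler_wpM2r ?gaussf_ge0//.
set p := cos _; set q := cos _.
have := cos_le1 (pi / 2 - a * z); have := cos_geN1 (pi / 2 - a * z).
have := cos_le1 (pi / 2 - - a * z); have := cos_geN1 (pi / 2 - - a * z).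
rewrite -/p -/q ler_norml; lra.
Qed.

Lemma J0N a y : J 0 a (- y) = J 0 a y.
Proof.
apply: eq_Int => u; rewrite /wave !mul0r !sub0r mulrN opprK.
by rewrite cosN.
Qed.

Lemma J0_cvg y : J 0 n%:R y @[n --> \oo] --> Num.sqrt (2 * pi / lam) * expR (- (y ^+ 2 / (2 * lam))).
Proof.
wlog y0 : y / 0 <= y.
  move=> h; have [/h//|y0] := lerP 0 y.
  have := h (- y); rewrite sqrrN => H; apply: (cvg_seq_ext (fun n => J0N n%:R y)).
  by apply: H; lra.
have J00 n : J 0 n%:R 0 = Int (- n%:R) n%:R E.
  by apply: eq_Int => u; rewrite /wave expr0 mul0r mulr0 subr0 cos0 !mul1r.
have h : expR (y ^+ 2 / (2 * lam)) * J 0 n%:R y @[n --> \oo] --> Num.sqrt (2 * pi / lam).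
  pose C := expR (y ^+ 2 / (2 * lam)) * (2 / lam) * y.
  have e0 : C * E n%:R @[n --> \oo] --> 0.
    by rewrite -[X in _ --> X](mulr0 C); apply: cvg_seq_scale; exact: gaussf_cvg0.
  have I := Int_gaussf_cvg.
  apply: (@squeeze_cvgr _ _ _ _ (fun n => Int (- n%:R) n%:R E - C * E n%:R)
     (fun n => Int (- n%:R) n%:R E + C * E n%:R)).
  - near=> n; have := gaussf_J0_variation (ler0n R n) y0.
    by rewrite J00 -/C ler_distl.
  - by rewrite -[X in _ --> X]subr0; apply: cvgB.
  - by rewrite -[X in _ --> X]addr0; apply: cvgD.
have -> : (fun n => J 0 n%:R y) =
    fun n => expR (- (y ^+ 2 / (2 * lam))) * (expR (y ^+ 2 / (2 * lam)) * J 0 n%:R y).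
  by apply/funext => n; rewrite mulrA -expRD addNr expR0 mul1r.
by rewrite [X in _ --> X]mulrC; apply: cvg_seq_scale.
Unshelve. all: by end_near.
Qed.

Definition gauss_fourier m y : R :=
  Num.sqrt (2 * pi / lam) * (Num.sqrt lam)^-1 ^+ m *
  (hermite m).[y / Num.sqrt lam] * expR (- (y ^+ 2 / (2 * lam))).

Lemma gaussf_bound p a :
  `|a| ^+ p * E a <= gauss_moment_cst p * (Num.sqrt lam)^-1 ^+ p * gaussf (lam / 2) a.
Proof.
have sl0 : 0 < Num.sqrt lam by rewrite sqrtr_gt0.
have -> : `|a| ^+ p = (Num.sqrt lam)^-1 ^+ p * (Num.sqrt lam * `|a|) ^+ p.
  by rewrite -exprMn mulKf// gt_eqF.
rewrite -[leLHS]mulrA [leRHS](_ : _ =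
  (Num.sqrt lam)^-1 ^+ p * (gauss_moment_cst p * gaussf (lam / 2) a)); last by ring.
apply: ler_wpM2l; first by rewrite exprn_ge0// invr_ge0 ltW.
apply: (@le_trans _ _ (gauss_moment_cst p * expR (lam * a ^+ 2 / 8) * E a)).
  by rewrite ler_wpM2r ?gaussf_ge0// pow_le_gauss.
rewrite -mulrA ler_wpM2l ?gauss_moment_cst_ge0// -expRD ler_expR.
have : 0 <= lam * a ^+ 2 by rewrite mulr_ge0 ?sqr_ge0// ltW.
lra.
Qed.

(** The boundary terms in [J_rec] vanish in the limit, leaving the recurrence
    of Hermite polynomials. *)
Lemma J_cvg m y : J m n%:R y @[n --> \oo] --> gauss_fourier m y.
Proof.
have sl0 : 0 < Num.sqrt lam by rewrite sqrtr_gt0.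
have s2 : Num.sqrt lam ^+ 2 = lam by rewrite sqr_sqrtr// ltW.
have e1 : y / lam = y / Num.sqrt lam / Num.sqrt lam.
  by rewrite -[X in y / X]s2; field; rewrite gt_eqF.
have e2 k : k%:R / lam = k%:R / Num.sqrt lam / Num.sqrt lam.
  by rewrite -[X in _ / X]s2; field; rewrite gt_eqF.
pose bd m (n : nat) := dwave m y n%:R * E n%:R - dwave m y (- n%:R) * E (- n%:R).
have bd0 k : bd k n @[n --> \oo] --> 0.
  pose C := 2 * (gauss_moment_cst k * (Num.sqrt lam)^-1 ^+ k).
  have e0 : C * gaussf (lam / 2) n%:R @[n --> \oo] --> 0.
    by rewrite -[X in _ --> X](mulr0 C); apply: cvg_seq_scale; apply: gaussf_cvg0; exact: divr_gt0.
  apply: (@squeeze_cvgr _ _ _ _ (fun n => - (C * gaussf (lam / 2) n%:R)) (fun n => C * gaussf (lam / 2) n%:R)) => //.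
    near=> n; rewrite -ler_norml.
    have dw u : `|dwave k y u * E u| <= gauss_moment_cst k * (Num.sqrt lam)^-1 ^+ k * gaussf (lam / 2) u.
      apply: le_trans (gaussf_bound k u).
      rewrite /dwave !normrM (ger0_norm (gaussf_ge0 _ _)) normrX ler_wpM2r ?gaussf_ge0//.
      by rewrite -[leRHS]mulr1 ler_wpM2l ?exprn_ge0// cos_max.
    apply: (le_trans (ler_normB _ _)).
    have := dw n%:R; have := dw (- n%:R); rewrite gaussfN /C; lra.
  by rewrite -[X in _ --> X]oppr0; apply: cvgN.
have rec k : J k.+1 n%:R y @[n --> \oo] --> gauss_fourier k.+1 y ->
    J k n%:R y @[n --> \oo] --> gauss_fourier k y ->
    J k.+2 n%:R y @[n --> \oo] --> gauss_fourier k.+2 y.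
  move=> h1 h0.
  have -> : gauss_fourier k.+2 y = y / lam * gauss_fourier k.+1 y - k.+1%:R / lam * gauss_fourier k y - lam^-1 * 0.
    rewrite /gauss_fourier hermite_rec hornerD hornerN hornerM hornerX hornerZ e1 e2 mulr0 subr0.
    rewrite [_^-1 ^+ k.+2]exprS [_^-1 ^+ k.+1]exprS.
    by field; rewrite gt_eqF.
  apply: (cvg_seq_ext (fun n => esym (J_rec k.+1 y (ler0n R n)))).
  exact: (cvgB (cvgB (cvg_seq_scale h1) (cvg_seq_scale h0)) (cvg_seq_scale (bd0 k.+1))).
have J1 : J 1 n%:R y @[n --> \oo] --> gauss_fourier 1 y.
  have -> : gauss_fourier 1 y = y / lam * gauss_fourier 0 y - 0%:R / lam * gauss_fourier 0 y - lam^-1 * 0.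
    rewrite /gauss_fourier /= -polyC1 derivC subr0 hornerM hornerX !hornerC expr1 expr0 mulr0 mul0r.
    by rewrite e1; field; rewrite gt_eqF.
  have J0' := @J0_cvg y.
  have J0 : J 0 n%:R y @[n --> \oo] --> gauss_fourier 0 y.
    by rewrite /gauss_fourier /= expr0 hornerC !mulr1.
  apply: (cvg_seq_ext (fun n => esym (J_rec 0 y (ler0n R n)))).
  exact: (cvgB (cvgB (cvg_seq_scale J0) (cvg_seq_scale J0)) (cvg_seq_scale (bd0 0%N))).
suff : (J m n%:R y @[n --> \oo] --> gauss_fourier m y) /\
  (J m.+1 n%:R y @[n --> \oo] --> gauss_fourier m.+1 y) by case.
elim: m => [|m [IH1 IH2]]; last by split=> //; exact: rec.
split=> //; have J0' := @J0_cvg y.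
by rewrite /gauss_fourier /= expr0 hornerC !mulr1.
Unshelve. all: by end_near.
Qed.

End GaussianFourier.

(** * Expansion of the limiting transform *)

Section EdgeworthPointwise.
Context {R : realType}.
Implicit Types (l u : R).

Definition iu u : R[i] := 0 +i* u.

Lemma cabs_iu u : cabs (iu u) = `|u|.
Proof. by rewrite cabsE/= expr0n/= add0r sqrtr_sqr. Qed.

Lemma sqr_iu u : iu u ^+ 2 = (- u ^+ 2)%:C.
Proof. by apply: eq_ReIm; rewrite /= ; ring. Qed.

Variables (r : nat) (delta : R).
Hypothesis delta1 : delta <= 1.

(** Errors of order [r + 1] in [u], up to powers of [lam u^2] and a part of the
    exponent of the Gaussian that will multiply them. *)
Definition err_class (f : R -> R -> R[i]) := exists (C : R) (A : nat), 0 <= C /\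
  forall l u, 1 <= l -> `|u| <= delta ->
    cabs (f l u) <= C * (1 + l * u ^+ 2) ^+ A * `|u| ^+ r.+1 * expR (l * u ^+ 2 / 8).

Definition growth_class (f : R -> R -> R[i]) := exists (C : R) (A : nat), 0 <= C /\
  forall l u, 1 <= l -> `|u| <= delta -> cabs (f l u) <= C * (1 + l * u ^+ 2) ^+ A.

Let base1 l u : 1 <= l -> 1 <= 1 + l * u ^+ 2.
Proof. by move=> l1; rewrite lerDl mulr_ge0 ?sqr_ge0// (le_trans _ l1). Qed.

Let base_mono l u A B : 1 <= l -> (A <= B)%N -> (1 + l * u ^+ 2) ^+ A <= (1 + l * u ^+ 2) ^+ B.
Proof. by move=> l1 AB; rewrite ler_weXn2l// base1. Qed.

Lemma err_class_ext f g : (forall l u, f l u = g l u) -> err_class f -> err_class g.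
Proof. by move=> h [C [A [C0 H]]]; exists C, A; split=> // l u l1 ud; rewrite -h; exact: H. Qed.

Lemma growth_class_ext f g : (forall l u, f l u = g l u) -> growth_class f -> growth_class g.
Proof. by move=> h [C [A [C0 H]]]; exists C, A; split=> // l u l1 ud; rewrite -h; exact: H. Qed.

Lemma growthD f g : growth_class f -> growth_class g -> growth_class (fun l u => f l u + g l u).
Proof.
move=> [C [A [C0 H]]] [C' [A' [C'0 H']]]; exists (C + C'), (A + A')%N; split; first exact: addr_ge0.
move=> l u l1 ud; apply: (le_trans (le_normcD _ _)); rewrite mulrDl.
apply: lerD; [apply: (le_trans (H l u l1 ud))|apply: (le_trans (H' l u l1 ud))];
  by rewrite ler_wpM2l// base_mono// ?leq_addr ?leq_addl.
Qed.

Lemma growthM f g : growth_class f -> growth_class g -> growth_class (fun l u => f l u * g l u).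
Proof.
move=> [C [A [C0 H]]] [C' [A' [C'0 H']]]; exists (C * C'), (A + A')%N; split; first exact: mulr_ge0.
move=> l u l1 ud; rewrite Normc.normcM exprD mulrACA.
by apply: ler_pM; [exact: cabs_ge0|exact: cabs_ge0|exact: H|exact: H'].
Qed.

Lemma growth_bounded f (C : R) : 0 <= C -> (forall l u, 1 <= l -> `|u| <= delta -> cabs (f l u) <= C) ->
  growth_class f.
Proof. by move=> C0 H; exists C, 0%N; split=> // l u l1 ud; rewrite expr0 mulr1; exact: H. Qed.

Lemma growth_cst (c : R[i]) : growth_class (fun _ _ => c).
Proof. exact: (growth_bounded (cabs_ge0 c)). Qed.

Lemma growthX f m : growth_class f -> growth_class (fun l u => f l u ^+ m).
Proof.
move=> gf; elim: m => [|m IH].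
  by apply: growth_class_ext (growth_cst 1) => l u; rewrite expr0.
by apply: growth_class_ext (growthM gf IH) => l u; rewrite exprS.
Qed.

Lemma growth_sum (n : nat) (F : nat -> R -> R -> R[i]) :
  (forall i, growth_class (F i)) -> growth_class (fun l u => \sum_(i < n) F i l u).
Proof.
move=> h; elim: n => [|n IH].
  by apply: growth_class_ext (growth_cst 0) => l u; rewrite big_ord0.
by apply: growth_class_ext (growthD IH (h n)) => l u; rewrite big_ord_recr.
Qed.

Lemma err0 : err_class (fun _ _ => 0).
Proof. by exists 0, 0%N; split=> // l u _ _; rewrite Normc.normc0 !mul0r. Qed.

Lemma errD f g : err_class f -> err_class g -> err_class (fun l u => f l u + g l u).
Proof.
move=> [C [A [C0 H]]] [C' [A' [C'0 H']]]; exists (C + C'), (A + A')%N; split; first exact: addr_ge0.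
move=> l u l1 ud; apply: (le_trans (le_normcD _ _)); rewrite !mulrDl.
apply: lerD; [apply: (le_trans (H l u l1 ud))|apply: (le_trans (H' l u l1 ud))];
  rewrite ler_wpM2r ?expR_ge0// ler_wpM2r ?exprn_ge0//;
  by rewrite ler_wpM2l// base_mono// ?leq_addr ?leq_addl.
Qed.

Lemma errM f g : err_class f -> growth_class g -> err_class (fun l u => f l u * g l u).
Proof.
move=> [C [A [C0 H]]] [C' [A' [C'0 H']]]; exists (C * C'), (A + A')%N; split; first exact: mulr_ge0.
move=> l u l1 ud; rewrite Normc.normcM exprD.
rewrite [leRHS](_ : _ = (C * (1 + l * u ^+ 2) ^+ A * `|u| ^+ r.+1 * expR (l * u ^+ 2 / 8)) *
  (C' * (1 + l * u ^+ 2) ^+ A')); last by ring.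
by apply: ler_pM; [exact: cabs_ge0|exact: cabs_ge0|exact: H|exact: H'].
Qed.

Lemma err_sum (n : nat) (F : nat -> R -> R -> R[i]) :
  (forall i, err_class (F i)) -> err_class (fun l u => \sum_(i < n) F i l u).
Proof.
move=> h; elim: n => [|n IH].
  by apply: err_class_ext err0 => l u; rewrite big_ord0.
by apply: err_class_ext (errD IH (h n)) => l u; rewrite big_ord_recr.
Qed.

Lemma err_mul_congr f f' g g' : err_class (fun l u => f l u - f' l u) ->
  err_class (fun l u => g l u - g' l u) -> growth_class f' -> growth_class g ->
  err_class (fun l u => f l u * g l u - f' l u * g' l u).
Proof.
move=> ef eg gf gg.
by apply: err_class_ext (errD (errM ef gg) (errM eg gf)) => l u; ring.
Qed.

Lemma err_exp_congr f f' m : err_class (fun l u => f l u - f' l u) ->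
  growth_class f -> growth_class f' -> err_class (fun l u => f l u ^+ m - f' l u ^+ m).
Proof.
move=> ef gf gf'; elim: m => [|m IH].
  by apply: err_class_ext err0 => l u; rewrite !expr0 subrr.
apply: err_class_ext (err_mul_congr ef IH gf' (growthX m gf)) => l u.
by rewrite !exprS.
Qed.

Lemma err_power i f (C : R) : (r < i)%N -> 0 <= C ->
  (forall l u, 1 <= l -> `|u| <= delta -> cabs (f l u) <= C * `|u| ^+ i) -> err_class f.
Proof.
move=> ri C0 H; exists C, 0%N; split=> // l u l1 ud; apply: (le_trans (H l u l1 ud)).
rewrite expr0 mulr1 -[leLHS]mulr1; apply: ler_pM => //; first by rewrite mulr_ge0// exprn_ge0.
  by rewrite ler_wpM2l// ler_wiXn2l// (le_trans ud).
by rewrite -expR0 ler_expR divr_ge0// mulr_ge0 ?sqr_ge0// (le_trans _ l1).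
Qed.

Lemma growth_lam_sqr : growth_class (fun l u => l%:C * iu u ^+ 2).
Proof.
exists 1, 1%N; split=> // l u l1 ud; have l0 : 0 <= l by rewrite (le_trans _ l1).
rewrite expr1 mul1r Normc.normcM cabs_real cabsX cabs_iu real_normK ?num_real//.
by rewrite (ger0_norm l0) lerDr.
Qed.

Lemma growth_iu : growth_class (fun l u => iu u).
Proof.
apply: (growth_bounded (C := 1)) => // l u _ ud; rewrite cabs_iu; exact: le_trans delta1.
Qed.

Lemma growth_horner (p : {poly R[i]}) : growth_class (fun l u => p.[iu u]).
Proof.
have := @growth_sum (size p) (fun i l u => p`_i * iu u ^+ i).
move=> h; apply: growth_class_ext (h _) => [l u|i]; first by rewrite horner_coef.
by apply: growthM; [exact: growth_cst|exact: growthX growth_iu].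
Qed.

(** Each omitted monomial has exponent greater than [r]. *)
Lemma err_trunc (p : {poly R[i]}) :
  err_class (fun l u => p.[iu u] - \sum_(j < r.+1) p`_j * iu u ^+ j).
Proof.
pose n := size p.
have E l u : \sum_(i < n) (if (i < r.+1)%N then 0 else p`_i * iu u ^+ i) =
   p.[iu u] - \sum_(j < r.+1) p`_j * iu u ^+ j.
  have -> : \sum_(j < r.+1) p`_j * iu u ^+ j = \sum_(j < n) (if (j < r.+1)%N then p`_j * iu u ^+ j else 0).
    pose f i := p`_i * iu u ^+ i.
    transitivity (\sum_(j < maxn n r.+1) (if (j < r.+1)%N then f j else 0)).
      rewrite (big_ord_widen (maxn n r.+1) f (leq_maxr _ _)).
      by rewrite big_mkcond.
    rewrite [RHS](big_ord_widen (maxn n r.+1) (fun j => if (j < r.+1)%N then f j else 0) (leq_maxl _ _)).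
    rewrite [RHS]big_mkcond/=; apply: eq_bigr => i _; case: (ltnP i n) => // ni.
    by rewrite /f nth_default// mul0r if_same.
  by rewrite horner_coef -sumrB; apply: eq_bigr => i _; case: ifP; rewrite ?subrr ?subr0.
apply: err_class_ext E _; apply: (@err_sum n (fun i l u => if (i < r.+1)%N then 0 else p`_i * iu u ^+ i)) => i.
case: ltnP => ri; first exact: err0.
apply: (err_power (i := i) (C := cabs p`_i)) => //; first exact: cabs_ge0.
by move=> l u _ _; rewrite Normc.normcM cabsX cabs_iu.
Qed.

End EdgeworthPointwise.

Section EdgeworthLocal.
Context {R : realType}.
Variables (rho : R) (a : nat -> R[i]) (F : R[i] -> R[i]).
Hypothesis rho0 : 0 < rho.
Hypothesis aF : is_power_series rho a F.
Hypothesis areal : forall j, complex.Im (a j) = 0.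
Let w k := complex.Re (a k).
Variable r : nat.

(** The expansion of [exp(l (e^{iu} - 1 - iu + u^2/2)) F(iu)] in powers of
    [iu], where [l (iu)^2] counts as order zero. *)
Definition edge_poly (w : nat -> R) (r : nat) (l u : R) : R[i] :=
  \sum_(j < r.+1) \sum_(m < j.+1) (kappa w j m * l ^+ m)%:C * iu u ^+ (j + 2 * m).

Let aw k : a k = (w k)%:C.
Proof. by apply: eq_ReIm => //=; exact: areal. Qed.

Let K : R := expR 1.

(** Small enough for the exponent [yy] below to be at most a quarter of that
    of the Gaussian. *)
Definition local_radius : R := Num.min (rho / 2) (8 * K)^-1.

Let K0 : 0 < K. Proof. exact: expR_gt0. Qed.
Let K1 : 1 <= K. Proof. by rewrite -expR0 ler_expR. Qed.

Lemma local_radius_gt0 : 0 < local_radius.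
Proof. by rewrite lt_min divr_gt0//= invr_gt0 mulr_gt0. Qed.

Lemma local_radius_lt : local_radius < rho.
Proof. by rewrite gt_min ltr_pdivrMr// mulr_natr mulr2n ltrDl rho0. Qed.

Lemma local_radius_le1 : local_radius <= 1.
Proof.
rewrite ge_min invf_le1 ?mulr_gt0//; apply/orP; right.
by have := K1; lra.
Qed.

Let dl := local_radius.

Let yy (l u : R) : R[i] := l%:C * (cexp (iu u) - 1 - iu u - iu u ^+ 2 / 2).
Let Hp : {poly R[i]} := map_poly (real_complex R) (third_order_tail r).
Let xx (l u : R) : R[i] := l%:C * iu u ^+ 2 * Hp.[iu u].
Let Wp : {poly R} := \poly_(k < r.+1) w k.

Let expu (u : R) : `|u| <= dl -> expR `|u| <= K.
Proof. by move=> ud; rewrite ler_expR (le_trans ud local_radius_le1). Qed.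

Let Hp_horner (z : R[i]) : 1 + z + z ^+ 2 / 2 + z ^+ 2 * Hp.[z] = \sum_(m < r.+3) z ^+ m / m`!%:R.
Proof.
rewrite !big_ord_recl /= expr0 expr1 fact0 !divr1 !addrA.
rewrite (horner_coef_wide z (n := r.+1)); last first.
  by rewrite (leq_trans (size_poly _ _))// size_poly.
rewrite big_ord_recl coef_map coef_poly/= mul0r add0r.
congr (_ + _); rewrite mulr_sumr; apply: eq_bigr => i _.
rewrite coef_map coef_poly /bump/= !add1n ltnS ltn_ord/=.
rewrite fmorphV rmorph_nat mulrCA -exprD mulrC add2n.
by [].
Qed.

Let yy_le l u : 1 <= l -> `|u| <= dl -> cabs (yy l u) <= l * `|u| ^+ 3 * K.
Proof.
move=> l1 ud; have l0 : 0 <= l by rewrite (le_trans _ l1).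
rewrite /yy Normc.normcM cabs_real (ger0_norm l0) -[leRHS]mulrA ler_wpM2l//.
have -> : cexp (iu u) - 1 - iu u - iu u ^+ 2 / 2 = cexp (iu u) - \sum_(m < 3) iu u ^+ m / m`!%:R.
  by rewrite !big_ord_recl big_ord0 /= expr0 expr1 fact0 !divr1 addr0 !opprD !addrA.
apply: (le_trans (cexp_taylor 3 (iu u))).
by rewrite cabs_iu ler_wpM2l ?exprn_ge0// expu.
Qed.

Let yy_le8 l u : 1 <= l -> `|u| <= dl -> cabs (yy l u) <= l * u ^+ 2 / 8.
Proof.
move=> l1 ud; apply: (le_trans (yy_le l1 ud)).
have l0 : 0 <= l by rewrite (le_trans _ l1).
rewrite [leLHS](_ : _ = l * u ^+ 2 * (`|u| * K)); last by rewrite -(real_normK (num_real u)); ring.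
apply: ler_wpM2l; first by rewrite mulr_ge0// sqr_ge0.
rewrite -ler_pdivlMr// -invfM; apply: (le_trans ud).
by rewrite ge_min lexx orbT.
Qed.

Let growth_yy : growth_class dl yy.
Proof.
exists 1, 1%N; split=> // l u l1 ud; apply: (le_trans (yy_le8 l1 ud)).
have : 0 <= l * u ^+ 2 by rewrite mulr_ge0 ?sqr_ge0// (le_trans _ l1).
lra.
Qed.

Let growth_xx : growth_class dl xx.
Proof. by apply: growthM; [exact: growth_lam_sqr|exact: growth_horner local_radius_le1 _]. Qed.

Let err_yx : err_class r dl (fun l u => yy l u - xx l u).
Proof.
exists K, 1%N; split; first exact: ltW.
move=> l u l1 ud; have l0 : 0 <= l by rewrite (le_trans _ l1).
have -> : yy l u - xx l u = l%:C * (cexp (iu u) - \sum_(m < r.+3) iu u ^+ m / m`!%:R).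
  by rewrite -Hp_horner /yy /xx; ring.
rewrite Normc.normcM cabs_real (ger0_norm l0).
apply: (@le_trans _ _ (l * (`|u| ^+ r.+3 * K))).
  rewrite ler_wpM2l// (le_trans (cexp_taylor _ _))// cabs_iu ler_wpM2l ?exprn_ge0//.
  exact: expu.
rewrite expr1 -[leLHS]mulr1; apply: ler_pM => //.
- by rewrite mulr_ge0// mulr_ge0 ?exprn_ge0// ltW.
- rewrite (_ : l * _ = K * (l * u ^+ 2) * `|u| ^+ r.+1); last first.
    by rewrite -(real_normK (num_real u)) -addn2 exprD; ring.
  by rewrite ler_wpM2r ?exprn_ge0// ler_wpM2l ?(ltW K0)// lerDr.
- by rewrite -expR0 ler_expR divr_ge0// mulr_ge0// sqr_ge0.
Qed.

Let growth_F : growth_class dl (fun l u => F (iu u)).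
Proof.
have [|C [C0 H]] := @power_series_taylor _ rho a F dl aF _ 0%N.
  by rewrite local_radius_gt0 local_radius_lt.
apply: (growth_bounded C0) => l u _ ud.
by have := H (iu u); rewrite cabs_iu => /(_ ud); rewrite /psum big_ord0 subr0 expr0 mulr1.
Qed.

Let WpC := map_poly (real_complex R) Wp.

Let err_F : err_class r dl (fun l u => F (iu u) - WpC.[iu u]).
Proof.
have [|C [C0 H]] := @power_series_taylor _ rho a F dl aF _ r.+1.
  by rewrite local_radius_gt0 local_radius_lt.
apply: (@err_power _ _ _ local_radius_le1 r.+1 _ C) => // l u _ ud.
have := H (iu u); rewrite cabs_iu => /(_ ud).
have -> // : psum a (iu u) r.+1 = WpC.[iu u].
rewrite (horner_coef_wide _ (n := r.+1)); last first.
  by rewrite (leq_trans (size_poly _ _))// size_poly.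
by apply: eq_bigr => i _; rewrite coef_map coef_poly ltn_ord aw.
Qed.

Let err_exp : err_class r dl (fun l u => cexp (yy l u) - \sum_(m < r.+1) yy l u ^+ m / m`!%:R).
Proof.
exists (K ^+ r.+1), r.+1; split; first by rewrite exprn_ge0// ltW.
move=> l u l1 ud; have l0 : 0 <= l by rewrite (le_trans _ l1).
apply: (le_trans (cexp_taylor _ _)).
apply: ler_pM; rewrite ?exprn_ge0 ?cabs_ge0 ?expR_ge0 ?ler_expR ?yy_le8//.
rewrite -!exprMn lerXn2r ?nnegrE ?cabs_ge0//.
  by rewrite !mulr_ge0// ?(ltW K0)// addr_ge0// mulr_ge0// sqr_ge0.
apply: (le_trans (yy_le l1 ud)).
rewrite [leLHS](_ : _ = K * (l * u ^+ 2) * `|u|); last first.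
  by rewrite -(real_normK (num_real u)); ring.
by rewrite ler_wpM2r// ler_wpM2l ?(ltW K0)// lerDr.
Qed.

Let qq m : {poly R} := third_order_tail r ^+ m * Wp.

Let qq_kappa j m : (j <= r)%N -> (qq m)`_j / m`!%:R = kappa w j m.
Proof.
move=> jr; rewrite /kappa mulrC; congr (_ * _); rewrite coefM; apply: eq_bigr => -[i /= ij] _.
rewrite coef_poly ifT; last lia.
congr (_ * _).
have : eq_upto j.+1 (third_order_tail r ^+ m) (third_order_tail j ^+ m : {poly R}).
  elim: m => [|m IH]; first by move=> k _; rewrite !expr0.
  rewrite !exprS; apply: eq_uptoM => // k kj; rewrite !coef_poly kj ifT//; lia.
by apply.
Qed.

Let edge_polyE l u : edge_poly w r l u =
  \sum_(m < r.+1) (l%:C * iu u ^+ 2) ^+ m / m`!%:R *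
     \sum_(j < r.+1) (map_poly (real_complex R) (qq m))`_j * iu u ^+ j.
Proof.
rewrite /edge_poly; under [RHS]eq_bigr do rewrite mulr_sumr.
rewrite exchange_big/=; apply: eq_bigr => -[j /= jr] _.
rewrite (big_ord_widen r.+1 (fun m => (kappa w j m * l ^+ m)%:C * iu u ^+ (j + 2 * m)))// big_mkcond/=.
apply: eq_bigr => -[m /= mr] _; rewrite coef_map/=; case: ifP => mj.
  rewrite -qq_kappa// !rmorphM/= fmorphV rmorph_nat rmorphXn/= exprMn exprD exprM.
  by ring.
rewrite /qq coefM big1 ?rmorph0 ?mul0r ?mulr0// => -[k /= kj] _.
rewrite coef_exp_lt ?mul0r//; first by rewrite coef_poly.
by move/negbT: mj; lia.
Qed.

(** The exponential is replaced by its Taylor polynomial of order [r], then its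
    exponent by the truncation [xx], then [F] by its Taylor polynomial; the
    products of polynomials are truncated last. *)
Lemma edge_local_err : err_class r dl (fun l u => cexp (yy l u) * F (iu u) - edge_poly w r l u).
Proof.
pose S1 l u := \sum_(m < r.+1) yy l u ^+ m / m`!%:R.
pose S2 l u := \sum_(m < r.+1) xx l u ^+ m / m`!%:R.
have gS (f : R -> R -> R[i]) : growth_class dl f -> growth_class dl (fun l u => \sum_(m < r.+1) f l u ^+ m / m`!%:R).
  move=> gf; apply: (@growth_sum _ _ r.+1 (fun m l u => f l u ^+ m / m`!%:R)) => m.
  by apply: growthM; [exact: growthX|exact: growth_cst].
have e12 : err_class r dl (fun l u => S1 l u - S2 l u).
  apply: err_class_ext (@err_sum _ r dl r.+1 (fun m l u => (yy l u ^+ m - xx l u ^+ m) * (m`!%:R)^-1) _).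
    by move=> l u; rewrite /S1 /S2 -sumrB; apply: eq_bigr => m _; rewrite mulrBl.
  by move=> m; apply: errM; [exact: err_exp_congr err_yx growth_yy growth_xx|exact: growth_cst].
have e2 : err_class r dl (fun l u => cexp (yy l u) - S2 l u).
  by apply: err_class_ext (errD err_exp e12) => l u; rewrite /S1; ring.
have e3 := err_mul_congr e2 err_F (gS _ growth_xx) growth_F.
have e4 : err_class r dl (fun l u => S2 l u * WpC.[iu u] - edge_poly w r l u).
  have := @err_sum _ r dl r.+1 (fun m l u => ((map_poly (real_complex R) (qq m)).[iu u] -
    \sum_(j < r.+1) (map_poly (real_complex R) (qq m))`_j * iu u ^+ j) * ((l%:C * iu u ^+ 2) ^+ m / m`!%:R)).
  move=> h; apply: err_class_ext (h _) => [l u|m]; last first.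
    apply: errM; first exact: err_trunc local_radius_le1 _.
    by apply: growthM; [apply: growthX; exact: growth_lam_sqr|exact: growth_cst].
  rewrite edge_polyE /S2 mulr_suml -sumrB; apply: eq_bigr => m _.
  rewrite mulrBl mulrC; congr (_ - _); last by rewrite mulrC.
  rewrite /qq rmorphM rmorphXn/= hornerM horner_exp /xx [in RHS]exprMn; ring.
by apply: err_class_ext (errD e3 e4) => l u; ring.
Qed.

(** In [edge_local_err], powers of [u] are traded for powers of [l^(-1/2)] with
    [pow_le_gauss]. *)
Lemma edge_local : exists C : R, 0 <= C /\ forall l u : R, 1 <= l -> `|u| <= dl ->
  cabs (cexp (l%:C * (cexp (iu u) - 1 - iu u)) * F (iu u) - (gaussf l u)%:C * edge_poly w r l u) <=
  C * (Num.sqrt l)^-1 ^+ r.+1 * gaussf (l / 4) u.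
Proof.
have [C [A [C0 H]]] := edge_local_err.
pose M p := @gauss_moment_cst R p.
pose D := \sum_(i < A.+1) 'C(A, i)%:R * M (2 * i + r.+1)%N.
have D0 : 0 <= D by apply: sumr_ge0 => i _; rewrite mulr_ge0// gauss_moment_cst_ge0.
exists (C * D); split; first exact: mulr_ge0.
move=> l u l1 ud; have l0 : 0 < l by rewrite (lt_le_trans _ l1).
have s0 : 0 < Num.sqrt l by rewrite sqrtr_gt0.
have s2 : Num.sqrt l ^+ 2 = l by rewrite sqr_sqrtr// ltW.
have -> : cexp (l%:C * (cexp (iu u) - 1 - iu u)) = (gaussf l u)%:C * cexp (yy l u).
  rewrite /gaussf -cexp_real -cexpD; congr cexp; rewrite /yy sqr_iu.
  rewrite (_ : (- (l * u ^+ 2 / 2))%:C = l%:C * ((- u ^+ 2)%:C / 2)).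
    by ring.
  by rewrite -(rmorph_nat (real_complex R) 2) -fmorphV -!rmorphM/= mulNr mulrN mulrA.
rewrite -mulrA -mulrBr Normc.normcM cabs_real ger0_norm ?gaussf_ge0//.
apply: (@le_trans _ _ (gaussf l u * (C * (1 + l * u ^+ 2) ^+ A * `|u| ^+ r.+1 * expR (l * u ^+ 2 / 8)))).
  by rewrite ler_wpM2l ?gaussf_ge0// H.
have hE : (1 + l * u ^+ 2) ^+ A * `|u| ^+ r.+1 <=
    D * (Num.sqrt l)^-1 ^+ r.+1 * expR (l * u ^+ 2 / 8).
  rewrite exprDn mulr_suml /D !mulr_suml; apply: ler_sum => i _.
  have E : (l * u ^+ 2) ^+ i * `|u| ^+ r.+1 =
     (Num.sqrt l)^-1 ^+ r.+1 * (Num.sqrt l * `|u|) ^+ (2 * i + r.+1).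
    rewrite exprD exprM [(_ * `|u|) ^+ 2]exprMn s2 real_normK ?num_real//.
    transitivity ((l * u ^+ 2) ^+ i * ((Num.sqrt l)^-1 * (Num.sqrt l * `|u|)) ^+ r.+1).
      by rewrite mulKf// gt_eqF.
    by rewrite [(_^-1 * _) ^+ r.+1]exprMn; ring.
  rewrite expr1n mul1r [leLHS]mulrnAl -[leLHS]mulr_natl E.
  rewrite [leRHS](_ : _ = 'C(A, i)%:R * ((Num.sqrt l)^-1 ^+ r.+1 *
    (M (2 * i + r.+1)%N * expR (l * u ^+ 2 / 8)))); last by ring.
  apply: ler_wpM2l => //; apply: ler_wpM2l; first by rewrite exprn_ge0 ?invr_ge0 ?(ltW s0).
  exact: pow_le_gauss.
rewrite [leLHS](_ : _ = C * (((1 + l * u ^+ 2) ^+ A * `|u| ^+ r.+1)) * (gaussf l u * expR (l * u ^+ 2 / 8))); last by ring.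
apply: (@le_trans _ _ (C * (D * (Num.sqrt l)^-1 ^+ r.+1 * expR (l * u ^+ 2 / 8)) * (gaussf l u * expR (l * u ^+ 2 / 8)))).
  by rewrite ler_wpM2r ?mulr_ge0 ?gaussf_ge0 ?expR_ge0// ler_wpM2l.
rewrite [leLHS](_ : _ = C * D * (Num.sqrt l)^-1 ^+ r.+1 * (expR (l * u ^+ 2 / 8) * (gaussf l u * expR (l * u ^+ 2 / 8)))); last by ring.
rewrite ler_wpM2l ?mulr_ge0 ?exprn_ge0 ?invr_ge0 ?(ltW s0)//.
rewrite /gaussf -!expRD ler_expR.
have : 0 <= l * u ^+ 2 by rewrite mulr_ge0 ?sqr_ge0// ltW.
lra.
Qed.

End EdgeworthLocal.

Section EdgeworthGlobal.
Context {R : realType}.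
Implicit Types (l u : R).

Lemma edge_poly_le (w : nat -> R) r : exists C : R, 0 <= C /\ forall l u : R, 1 <= l ->
  cabs ((gaussf l u)%:C * edge_poly w r l u) <= C * gaussf (l / 2) u.
Proof.
pose M p := @gauss_moment_cst R p.
pose C := \sum_(j < r.+1) \sum_(m < j.+1) `|kappa w j m| * M (j + 2 * m)%N.
exists C; split.
  by do 2!(apply: sumr_ge0 => ? _); rewrite mulr_ge0// gauss_moment_cst_ge0.
move=> l u l1; have l0 : 0 < l by rewrite (lt_le_trans _ l1).
have s0 : 0 < Num.sqrt l by rewrite sqrtr_gt0.
have s2 : Num.sqrt l ^+ 2 = l by rewrite sqr_sqrtr// ltW.
have s1 : 1 <= Num.sqrt l by have := ler_wsqrtr l1; rewrite sqrtr1.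
rewrite Normc.normcM cabs_real ger0_norm ?gaussf_ge0//.
apply: (@le_trans _ _ (gaussf l u * (C * expR (l * u ^+ 2 / 8)))).
  apply: ler_wpM2l; first exact: gaussf_ge0.
  rewrite /edge_poly (le_trans (cabs_sum _ _ _))// /C mulr_suml; apply: ler_sum => j _.
  rewrite (le_trans (cabs_sum _ _ _))// mulr_suml; apply: ler_sum => m _.
  rewrite Normc.normcM cabs_real cabsX cabs_iu normrM -[leLHS]mulrA -[leRHS]mulrA; apply: ler_wpM2l => //.
  apply: le_trans (pow_le_gauss l0 (j + 2 * m) u).
  rewrite normrX (ger0_norm (ltW l0)) exprMn -{1}s2 -exprM; apply: ler_wpM2r; first exact: exprn_ge0.
  by rewrite ler_weXn2l// leq_addl.
rewrite mulrCA; apply: ler_wpM2l.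
  by do 2!(apply: sumr_ge0 => ? _); rewrite mulr_ge0// gauss_moment_cst_ge0.
rewrite /gaussf -!expRD ler_expR.
have : 0 <= l * u ^+ 2 by rewrite mulr_ge0 ?sqr_ge0// ltW.
lra.
Qed.

Lemma cabs_poisson_char l u :
  cabs (cexp (l%:C * (cexp (iu u) - 1))) = expR (- (l * (1 - cos u))).
Proof.
rewrite cabs_cexp Re_realM ReB /cexp /= expR0; congr expR; ring.
Qed.

Lemma one_minus_cos_ge (d u : R) : 0 <= d <= `|u| -> `|u| <= pi -> 1 - cos d <= 1 - cos u.
Proof.
move=> /andP[d0 du] upi.
have -> : cos u = cos `|u| by case: ger0P => // _; rewrite cosN.
rewrite lerD2l lerN2 leNgt; apply/negP => h.
have : `|u| < d.
  by rewrite -ltr_cos// in_itv/= ?d0 ?normr_ge0 //= (le_trans du).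
by rewrite ltNge du.
Qed.

Lemma one_minus_cos_gt0 (d : R) : 0 < d <= pi -> 0 < 1 - cos d.
Proof.
move=> /andP[d0 dpi]; rewrite subr_gt0 -cos0 ltr_cos// in_itv/= ?lexx ?pi_ge0//.
by rewrite ltW.
Qed.

Lemma exp_decay_le (c : R) p : 0 < c -> exists C : R, 0 <= C /\ forall l : R, 1 <= l ->
  expR (- (c * l)) <= C * (Num.sqrt l)^-1 ^+ p.
Proof.
move=> c0; exists (p%:R ^+ p * c^-1 ^+ p); split.
  by rewrite mulr_ge0 ?exprn_ge0 ?invr_ge0// ltW.
move=> l l1; have l0 : 0 < l by rewrite (lt_le_trans _ l1).
have s1 : 1 <= Num.sqrt l by have := ler_wsqrtr l1; rewrite sqrtr1.
have s0 : 0 < Num.sqrt l by rewrite sqrtr_gt0.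
have s2 : Num.sqrt l ^+ 2 = l by rewrite sqr_sqrtr// ltW.
rewrite expRN -[leLHS]mul1r ler_pdivrMr ?expR_gt0//.
have := pow_le_exp p (_ : 0 <= c * l); rewrite mulr_ge0 ?(ltW c0) ?(ltW l0)// => /(_ isT) H.
rewrite [leRHS](_ : _ = (c^-1 ^+ p * (Num.sqrt l)^-1 ^+ p) * (p%:R ^+ p * expR (c * l))); last by ring.
apply: (@le_trans _ _ ((c^-1 ^+ p * (Num.sqrt l)^-1 ^+ p) * (c * l) ^+ p)); last first.
  by apply: ler_wpM2l => //; rewrite mulr_ge0 ?exprn_ge0 ?invr_ge0// ltW.
rewrite -!exprMn exprn_ege1// -{2}s2.
have -> : c^-1 * (Num.sqrt l)^-1 * (c * Num.sqrt l ^+ 2) = Num.sqrt l; last by [].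
by field; rewrite !gt_eqF.
Qed.

(** Near the origin this is [edge_local]; on the rest of the segment both terms
    are exponentially small in [l]. *)
Lemma edge_segment (rho : R) (a : nat -> R[i]) (F : R[i] -> R[i]) (r : nat) (d0 B : R) :
  0 < rho -> is_power_series rho a F -> (forall j, complex.Im (a j) = 0) ->
  0 < d0 <= pi -> (forall u, `|u| <= d0 -> cabs (F (iu u)) <= B) ->
  exists C : R, 0 <= C /\ forall l u, 1 <= l -> `|u| <= d0 ->
    cabs (cexp (l%:C * (cexp (iu u) - 1)) * F (iu u) -
      cexp (l%:C * iu u) * ((gaussf l u)%:C * edge_poly (fun k => complex.Re (a k)) r l u)) <=
    C * ((Num.sqrt l)^-1 ^+ r.+1 * gaussf (l / 4) u + (Num.sqrt l)^-1 ^+ r.+2).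
Proof.
move=> rho0 aF areal /andP[d00 d0pi] FB.
have [C1 [C10 H1]] := edge_local rho0 aF areal r.
set dl := local_radius rho in H1.
have dl0 : 0 < dl := local_radius_gt0 rho0.
have [C2 [C20 H2]] := edge_poly_le (fun k => complex.Re (a k)) r.
have dlpi : 0 < Num.min dl pi <= pi by rewrite lt_min dl0 pi_gt0/= ge_min lexx orbT.
have [C3 [C30 H3]] := exp_decay_le r.+2 (one_minus_cos_gt0 dlpi).
have [C4 [C40 H4]] := @exp_decay_le (dl ^+ 2 / 4) r.+2 (ltac:(by rewrite divr_gt0// exprn_gt0)).
have B0 : 0 <= B by apply: le_trans (FB 0 _); rewrite ?cabs_ge0// normr0 ltW.
exists (C1 + (C3 * B + C2 * C4)); split.
  by rewrite !addr_ge0// mulr_ge0.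
move=> l u l1 ud; have l0 : 0 < l by rewrite (lt_le_trans _ l1).
have s0 : 0 < Num.sqrt l by rewrite sqrtr_gt0.
have p1 : 0 <= (Num.sqrt l)^-1 ^+ r.+1 * gaussf (l / 4) u.
  by rewrite mulr_ge0 ?gaussf_ge0// exprn_ge0// invr_ge0 ltW.
have p2 : 0 <= (Num.sqrt l)^-1 ^+ r.+2 by rewrite exprn_ge0// invr_ge0 ltW.
have [udl|dlu] := leP `|u| dl.
  have -> : cexp (l%:C * (cexp (iu u) - 1)) = cexp (l%:C * iu u) * cexp (l%:C * (cexp (iu u) - 1 - iu u)).
    by rewrite -cexpD; congr cexp; ring.
  rewrite -mulrA -mulrBr Normc.normcM cabs_cexp Re_realM /= mulr0 expR0 mul1r.
  apply: (le_trans (H1 l u l1 udl)).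
  rewrite -mulrA; apply: ler_pM => //; first by rewrite lerDl addr_ge0// mulr_ge0.
  by rewrite lerDl.
apply: (le_trans (cabsB _ _)).
set X := C3 * B + C2 * C4; set Q := _^-1 ^+ r.+2 in p2 H3 H4 *.
have X0 : 0 <= X by rewrite addr_ge0// mulr_ge0.
apply: (@le_trans _ _ (X * Q)); last first.
  set P := (_ * gaussf _ _) in p1 *.
  rewrite [leRHS](_ : _ = (C1 * P + X * P + C1 * Q) + X * Q); last by ring.
  by rewrite lerDr !addr_ge0// mulr_ge0.
rewrite /X.
rewrite mulrDl; apply: lerD.
  rewrite Normc.normcM cabs_poisson_char mulrAC; apply: ler_pM; rewrite ?expR_ge0 ?cabs_ge0 ?FB//.
  apply: le_trans (H3 l l1); rewrite ler_expR lerN2 mulrC ler_wpM2l ?(ltW l0)//.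
  apply: one_minus_cos_ge; last exact: le_trans d0pi.
  by rewrite le_min ltW// pi_ge0/= ge_min (ltW dlu).
rewrite Normc.normcM cabs_cexp Re_realM /= mulr0 expR0 mul1r.
apply: (le_trans (H2 l u l1)); rewrite -mulrA ler_wpM2l//.
apply: le_trans (H4 l l1); rewrite /gaussf ler_expR lerN2.
rewrite (_ : dl ^+ 2 / 4 * l = l / 2 * dl ^+ 2 / 2); last by field.
rewrite ler_wpM2r// ler_wpM2l ?divr_ge0 ?(ltW l0)//.
by rewrite -(real_normK (num_real u)) lerXn2r ?nnegrE// ltW.
Qed.

End EdgeworthGlobal.

(** * The tree as a uniform random history *)

Section Histories.

(** The external nodes as a function of the finite list of picks. *)
Definition ext_of (h : seq node) : seq node := ext_nodes (nth [::] h) (size h).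

Lemma ext_nodes_eq p q n : (forall i, (i < n)%N -> p i = q i) -> ext_nodes p n = ext_nodes q n.
Proof.
elim: n => [//|n IH] h /=; rewrite h// IH// => i ni.
by apply: h; rewrite ltnW.
Qed.

Lemma ext_of_rcons h v :
  ext_of (rcons h v) = [:: rcons v false, rcons v true & rem v (ext_of h)].
Proof.
rewrite /ext_of size_rcons /= nth_rcons ltnn eqxx.
by rewrite (@ext_nodes_eq _ (nth [::] h))// => i ih; rewrite nth_rcons ih.
Qed.

(** The lists of picks of positive probability: each picked node is external
    when it is picked. *)
Fixpoint histories (n : nat) : seq (seq node) :=
  if n is m.+1 then
    flatten [seq [seq rcons h v | v <- ext_of h] | h <- histories m]
  else [:: [::]].

Lemma historiesP n h : h \in histories n.+1 ->
  exists h' v, [/\ h = rcons h' v, h' \in histories n & v \in ext_of h'].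
Proof.
by move=> /flattenP[_ /mapP[h' hh' ->] /mapP[v hv ->]]; exists h', v.
Qed.

Lemma mem_histories_rcons n h v : (rcons h v \in histories n.+1) =
  (h \in histories n) && (v \in ext_of h).
Proof.
apply/idP/andP => [/historiesP[h' [v' [/rcons_inj[-> ->]]]]//|[hh hv]].
apply/flattenP; exists [seq rcons h v | v <- ext_of h]; apply/mapP.
  by exists h.
by exists v.
Qed.

Lemma size_history n h : h \in histories n -> size h = n.
Proof.
elim: n h => [|n IH] h; first by rewrite inE => /eqP ->.
by move=> /historiesP[h' [v [-> /IH hs _]]]; rewrite size_rcons hs.
Qed.

Lemma size_ext_of n h : h \in histories n -> size (ext_of h) = n.+1.
Proof.
elim: n h => [|n IH] h; first by rewrite inE => /eqP ->.
move=> /historiesP[h' [v [-> /IH hs vh]]]; rewrite ext_of_rcons /= size_rem// hs.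
by [].
Qed.

End Histories.

Section Expectation.
Context {R : realType}.
Implicit Types (F G : seq node -> R).

(** The expectation of a function of the first [n] picks: there are [n!]
    histories, all equally likely. *)
Definition Ex (n : nat) F : R := (n`!%:R)^-1 * \sum_(h <- histories n) F h.

Lemma fact_inv_ge0 n : 0 <= (n`!%:R : R)^-1.
Proof. by rewrite invr_ge0. Qed.

Lemma ler_Ex n F G : (forall h, h \in histories n -> F h <= G h) -> Ex n F <= Ex n G.
Proof.
move=> h; rewrite ler_wpM2l ?fact_inv_ge0//.
rewrite !big_seq; apply: ler_sum => x; exact: h.
Qed.

Lemma eq_Ex n F G : (forall h, h \in histories n -> F h = G h) -> Ex n F = Ex n G.
Proof. by move=> h; congr (_ * _); rewrite !big_seq; apply: eq_bigr. Qed.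

Lemma ExD n F G : Ex n (fun h => F h + G h) = Ex n F + Ex n G.
Proof. by rewrite /Ex big_split/= mulrDr. Qed.

Lemma ExZ n c F : Ex n (fun h => c * F h) = c * Ex n F.
Proof. by rewrite /Ex -mulr_sumr mulrCA. Qed.

Lemma Ex_step n F : Ex n.+1 F = Ex n (fun h => (n.+1%:R)^-1 * \sum_(v <- ext_of h) F (rcons h v)).
Proof.
rewrite /Ex /= big_flatten/= big_map -mulr_sumr mulrA; congr (_ * _).
  by rewrite factS natrM invfM mulrC.
by apply: eq_bigr => h _; rewrite big_map.
Qed.

Lemma Ex_cst n (c : R) : Ex n (fun=> c) = c.
Proof.
elim: n => [|n IH].
  by rewrite /Ex big_seq1 fact0 invr1 mul1r.
rewrite Ex_step -[RHS]IH; apply: eq_Ex => h hh.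
by rewrite big_const_seq count_predT iter_addr_0 (size_ext_of hh) -[c *+ _]mulr_natl mulKf// pnatr_eq0.
Qed.

Lemma Ex_ge0 n F : (forall h, 0 <= F h) -> 0 <= Ex n F.
Proof. by move=> h; rewrite -(Ex_cst n 0); apply: ler_Ex. Qed.

Lemma Ex_Int n a b (f : seq node -> R -> R) : (forall h, continuous (f h)) ->
  Ex n (fun h => Int a b (f h)) = Int a b (fun u => Ex n (fun h => f h u)).
Proof.
move=> cf; rewrite /Ex IntZ; last exact: cont_sum.
by rewrite Int_sum.
Qed.

End Expectation.

(** * Second moments of the exponential sums *)

Section ProfileTransform.
Context {R : realType}.
Implicit Types (u : R) (h : seq node).

Definition phase (v : node) (u : R) : R[i] := cexp (iu u * (size v)%:R).
Definition Sum h u : R[i] := \sum_(v <- ext_of h) phase v u.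
(** The multiplicative growth of the exponential sum: a node of phase [z] gives
    way to two nodes of phase [e^{iu} z]. *)
Definition alpha u : R[i] := 2 * cexp (iu u) - 1.

Lemma cabs_phase v u : cabs (phase v u) = 1.
Proof.
rewrite cabs_cexp -(rmorph_nat (real_complex R)) mulrC Re_realM /= mulr0 expR0//.
Qed.

Lemma cexp_iu u : cexp (iu u) = cos u +i* sin u.
Proof. by rewrite /cexp /= expR0; apply: eq_ReIm => /=; ring. Qed.

Lemma Re_alpha u : complex.Re (alpha u) = 2 * cos u - 1.
Proof. by rewrite /alpha cexp_iu -(rmorph_nat (real_complex R)) ReB Re_realM. Qed.

Lemma cabs_alpha_le u : cabs (alpha u) <= 3.
Proof.
apply: (le_trans (cabsB _ _)); rewrite Normc.normcM Normc.normc1 cabs_nat.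
by rewrite cabs_cexp /= expR0; lra.
Qed.

Lemma Sum_rcons h v u : v \in ext_of h -> Sum (rcons h v) u = Sum h u + alpha u * phase v u.
Proof.
move=> vh; rewrite /Sum ext_of_rcons !big_cons [in RHS](big_rem v)//=.
have E b : phase (rcons v b) u = cexp (iu u) * phase v u.
  by rewrite /phase size_rcons -cexpD -natr1; congr cexp; ring.
by rewrite !E /alpha; ring.
Qed.

Lemma cabs_Sum_le n h u : h \in histories n -> cabs (Sum h u) <= n.+1%:R.
Proof.
move=> hh; apply: (le_trans (cabs_sum _ _ _)); under eq_bigr do rewrite cabs_phase.
by rewrite big_const_seq count_predT iter_addr_0 (size_ext_of hh).
Qed.

Lemma cabs_sqrD (z w : R[i]) :
  cabs (z + w) ^+ 2 = cabs z ^+ 2 + 2 * complex.Re (z^* * w) + cabs w ^+ 2.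
Proof. by rewrite !sqr_cabs; case: z => a b; case: w => c d /=; ring. Qed.

(** Averaging over the next pick, the cross term only sees the current sum. *)
Lemma Ex_step_affine n h u (A B : R[i]) : h \in histories n ->
  (n.+1%:R)^-1 * \sum_(v <- ext_of h) cabs (A + B * phase v u) ^+ 2 =
  cabs A ^+ 2 + 2 * complex.Re (A^* * (B * Sum h u)) / n.+1%:R + cabs B ^+ 2.
Proof.
move=> hh.
have -> : \sum_(v <- ext_of h) cabs (A + B * phase v u) ^+ 2 =
    \sum_(v <- ext_of h) (cabs A ^+ 2 + cabs B ^+ 2) +
    2 * complex.Re (A^* * (B * Sum h u)).
  rewrite /Sum !mulr_sumr Re_sum mulr_sumr -big_split/=; apply: eq_bigr => v _.
  by rewrite cabs_sqrD Normc.normcM cabs_phase mulr1; ring.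
rewrite big_const_seq count_predT iter_addr_0 (size_ext_of hh) -mulr_natl.
by field; rewrite nat1r pnatr_eq0.
Qed.

Lemma cont_Sum_phase (v : node) :
  continuous (fun u => complex.Re (phase v u)) /\ continuous (fun u => complex.Im (phase v u)).
Proof.
have cc (c : R) : continuous (fun u : R => c * u).
  by apply: cont_mul; [exact: cont_cst|exact: cont_id].
have E u : phase v u = cos ((size v)%:R * u) +i* sin ((size v)%:R * u).
  rewrite -cexp_iu /phase -(rmorph_nat (real_complex R)); congr cexp.
  by apply: eq_ReIm => /=; ring.
split; under eq_fun do rewrite E /=.
  by apply: cont_compose; [exact: continuous_cos|exact: cc].
by apply: cont_compose; [exact: continuous_sin|exact: cc].
Qed.

End ProfileTransform.

Section SecondMoments.
Context {R : realType}.

(** Real powers of positive numbers. *)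
Definition rpow (x p : R) : R := expR (p * ln x).

Lemma ln_succ_le n : (0 < n)%N -> ln (n.+1%:R : R) - ln n%:R <= n%:R^-1.
Proof.
move=> n0; rewrite -ln_div ?posrE ?ltr0n//.
have -> : (n.+1%:R / n%:R : R) = 1 + n%:R^-1 by rewrite -natr1 mulrDl divff ?mul1r// pnatr_eq0 -lt0n.
by apply: le_ln1Dx; rewrite (lt_le_trans (ltrN10 R))// invr_ge0.
Qed.

Lemma ln_succ_ge n : (0 < n)%N -> n.+1%:R^-1 <= ln (n.+1%:R : R) - ln n%:R.
Proof.
move=> n0; rewrite -lerN2 opprB -ln_div ?posrE ?ltr0n//.
have -> : (n%:R / n.+1%:R : R) = 1 + (- n.+1%:R^-1).
  by rewrite -[n%:R](addrK 1) natr1 mulrBl divff ?mul1r// pnatr_eq0.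
apply: le_ln1Dx; rewrite ltrNl opprK invf_lt1 ?ltr0n// ltr1n ltnS//.
Qed.

Lemma rpow_half (x : R) : 0 < x -> Num.sqrt x = rpow x 2^-1.
Proof. by move=> x0; rewrite -powR12_sqrt ?(ltW x0)// /powR gt_eqF. Qed.

Lemma rpow_three_halves (x : R) : 0 < x -> rpow x (- (3 / 2)) = (Num.sqrt x)^-1 ^+ 3.
Proof.
move=> x0; rewrite (rpow_half x0) /rpow -expRN -expRM_natl; congr expR.
by rewrite -mulr_natl; field.
Qed.

Lemma rpowD x (p q : R) : rpow x (p + q) = rpow x p * rpow x q.
Proof. by rewrite /rpow mulrDl expRD. Qed.

Lemma rpow_ge0 x p : 0 <= rpow x p. Proof. exact: expR_ge0. Qed.

Lemma rpow_le (x p q : R) : 1 <= x -> p <= q -> rpow x p <= rpow x q.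
Proof. by move=> x1 pq; rewrite ler_expR ler_wpM2r// ln_ge0. Qed.

(** Lets the sums of [n^(-3/2)] in the recursions telescope. *)
Lemma sqrt_telescope n : (0 < n)%N ->
  (Num.sqrt (n.+1%:R : R))^-1 ^+ 3 <= 2 * ((Num.sqrt n%:R)^-1 - (Num.sqrt n.+1%:R)^-1).
Proof.
move=> n0.
have s0 : 0 < Num.sqrt (n%:R : R) by rewrite sqrtr_gt0 ltr0n.
have t0 : 0 < Num.sqrt (n.+1%:R : R) by rewrite sqrtr_gt0 ltr0n.
have s2 : Num.sqrt (n%:R : R) ^+ 2 = n%:R by rewrite sqr_sqrtr.
have t2 : Num.sqrt (n.+1%:R : R) ^+ 2 = n%:R + 1 by rewrite sqr_sqrtr// natr1.
move: s0 t0 s2 t2; set s := Num.sqrt n%:R; set t := Num.sqrt n.+1%:R => s0 t0 s2 t2.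
have st : s <= t by apply: ler_wsqrtr; rewrite ler_nat.
have h : 1 <= (t - s) * (2 * t).
  have e : (t - s) * (t + s) = 1 by rewrite -subr_sqr t2 s2; ring.
  rewrite -[leLHS]e.
  by rewrite ler_wpM2l//; lra.
have -> : 2 * (s^-1 - t^-1) = (2 * (t - s) * t ^+ 2 / s) * t^-1 ^+ 3.
  by field; rewrite !gt_eqF.
rewrite -[leLHS]mul1r ler_wpM2r ?exprn_ge0 ?invr_ge0 ?(ltW t0)//.
rewrite ler_pdivlMr// mul1r (le_trans st)//.
have -> : 2 * (t - s) * t ^+ 2 = ((t - s) * (2 * t)) * t by ring.
by rewrite -[leLHS]mul1r ler_wpM2r// ltW.
Qed.

Lemma rpow_telescope n p : (0 < n)%N -> 3 / 2 <= p ->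
  rpow n.+1%:R (- p) <= (Num.sqrt n.+1%:R)^-1 ^+ 3.
Proof.
move=> n0 p32; rewrite -rpow_three_halves ?ltr0n//; apply: rpow_le; last by rewrite lerN2.
by rewrite ler1n.
Qed.

(** Relative to the growth [n^p], each step adds at most [9 n^(-p)], and
    [p >= 3/2] makes this summable with the telescoping bound above. *)
Lemma moment_recursion (a : nat -> R) (p : R) : 3 / 2 <= p ->
  (forall n, 0 <= a n) -> a 1%N <= 16 ->
  (forall n, (0 < n)%N -> a n.+1 <= a n * (1 + p / n.+1%:R) + 9) ->
  forall n, (0 < n)%N -> a n * rpow n%:R (- p) <= 16 + 18 * (1 - (Num.sqrt n%:R)^-1).
Proof.
move=> p32 a0 a1 H; elim=> [//|n IH] _.
have [->|n0] := posnP n.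
  by rewrite sqrtr1 invr1 subrr mulr0 addr0 /rpow ln1 mulr0 expR0 mulr1.
have {}IH := IH n0.
apply: (@le_trans _ _ ((a n * (1 + p / n.+1%:R) + 9) * rpow n.+1%:R (- p))).
  by rewrite ler_wpM2r ?rpow_ge0// H.
rewrite mulrDl.
have s0 : 0 < Num.sqrt (n%:R : R) by rewrite sqrtr_gt0 ltr0n.
have s1 : 0 < Num.sqrt (n.+1%:R : R) by rewrite sqrtr_gt0 ltr0n.
have h1 : a n * (1 + p / n.+1%:R) * rpow n.+1%:R (- p) <= a n * rpow n%:R (- p).
  rewrite -mulrA ler_wpM2l//.
  have -> : rpow n%:R (- p) = expR (p * (ln n.+1%:R - ln n%:R)) * rpow n.+1%:R (- p).
    by rewrite /rpow -expRD; congr expR; ring.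
  rewrite ler_wpM2r ?rpow_ge0// (le_trans (expR_ge1Dx _))// ler_expR ler_wpM2l//; first lra.
  exact: ln_succ_ge.
have h2 : rpow n.+1%:R (- p) <= 2 * ((Num.sqrt n%:R)^-1 - (Num.sqrt n.+1%:R)^-1).
  exact: le_trans (rpow_telescope n0 p32) (sqrt_telescope n0).
move: h1 IH h2; set X := a n * (1 + _) * _; set Y := a n * _; clearbody X Y.
lra.
Qed.

(** The factors [1 + (k+1)^(-2)] have a bounded product: the partial products
    are at most [expR (1 - 1 / k)]. *)
Lemma contraction_recursion (E : nat -> R) (D : R) n : (0 < n)%N -> 0 <= D -> E n <= 0 ->
  (forall k, (n <= k)%N ->
    E k.+1 <= (1 + (k.+1%:R)^-1 ^+ 2) * E k + D * (Num.sqrt k.+1%:R)^-1 ^+ 3) ->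
  forall k, (n <= k)%N -> E k <= expR 1 * (2 * D) * (Num.sqrt n%:R)^-1.
Proof.
move=> n0 D0 En H.
pose s k : R := 2 * D * ((Num.sqrt n%:R)^-1 - (Num.sqrt k%:R)^-1).
have s_ge0 k : (n <= k)%N -> 0 <= s k.
  move=> nk; rewrite mulr_ge0 ?mulr_ge0// subr_ge0 lef_pV2 ?posrE ?sqrtr_gt0 ?ltr0n ?(leq_trans n0)//.
  by apply: ler_wsqrtr; rewrite ler_nat.
have claim k : (n <= k)%N -> E k <= expR (1 - k%:R^-1) * s k.
  elim: k => [|k IH]; first by rewrite leqNgt n0.
  rewrite leq_eqVlt => /predU1P[<-|].
    by rewrite /s subrr !mulr0.
  rewrite ltnS => nk; have k0 : (0 < k)%N by exact: leq_trans nk.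
  apply: (le_trans (H k nk)).
  have ss : s k.+1 >= s k + D * (Num.sqrt k.+1%:R)^-1 ^+ 3.
    have := sqrt_telescope k0; rewrite /s => /(ler_wpM2l D0); lra.
  have e1 : expR (1 - k%:R^-1) * (1 + (k.+1%:R)^-1 ^+ 2) <= expR (1 - k.+1%:R^-1) :> R.
    apply: (@le_trans _ _ (expR (1 - k%:R^-1) * expR ((k.+1%:R)^-1 ^+ 2))).
      by rewrite ler_wpM2l ?expR_ge0// expR_ge1Dx.
    rewrite -expRD ler_expR -addrA lerD2l.
    have -> : - k%:R^-1 + k.+1%:R^-1 ^+ 2 = - k.+1%:R^-1 - (k.+1%:R^-1 * (k%:R^-1 - k.+1%:R^-1)) + 0 :> R.
      by rewrite addr0 -natr1; field; rewrite ?nat1r ?natr1 ?pnatr_eq0 /= ?(gtn_eqF k0) ?andbT.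
    rewrite addr0 lerBlDr lerDl mulr_ge0 ?invr_ge0// subr_ge0 lef_pV2 ?posrE ?ltr0n//.
    by rewrite ler_nat.
  have e2 : 1 <= expR (1 - k.+1%:R^-1) :> R.
    by rewrite -[leLHS]expR0 ler_expR subr_ge0 invf_le1 ?ltr0n// ler1n.
  apply: (@le_trans _ _ (expR (1 - k.+1%:R^-1) * (s k + D * (Num.sqrt k.+1%:R)^-1 ^+ 3))); last first.
    by rewrite ler_wpM2l ?expR_ge0.
  rewrite mulrDr; apply: lerD; last first.
    rewrite -[leLHS]mul1r ler_wpM2r// mulr_ge0// exprn_ge0// invr_ge0 sqrtr_ge0//.
  apply: (@le_trans _ _ ((1 + (k.+1%:R)^-1 ^+ 2) * (expR (1 - k%:R^-1) * s k))).
    by rewrite ler_wpM2l ?IH// addr_ge0// exprn_ge0// invr_ge0.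
  rewrite mulrA [X in X * _]mulrC ler_wpM2r// s_ge0//.
move=> k nk; apply: (le_trans (claim k nk)); rewrite /s mulrA -!mulrA.
apply: ler_pM; rewrite ?expR_ge0//.
- by rewrite mulr_ge0// mulr_ge0// subr_ge0 lef_pV2 ?posrE ?sqrtr_gt0 ?ltr0n ?(leq_trans n0)// ler_wsqrtr// ler_nat.
- by rewrite ler_expR gerBl invr_ge0.
- rewrite ler_wpM2l// ler_wpM2l// gerBl invr_ge0 sqrtr_ge0//.
Qed.

Lemma second_moment_step n (u p : R) : 4 * cos u - 2 <= p ->
  Ex n.+1 (fun h => cabs (Sum h u) ^+ 2) <=
  Ex n (fun h => cabs (Sum h u) ^+ 2) * (1 + p / n.+1%:R) + 9.
Proof.
move=> up; rewrite Ex_step -(Ex_cst n 9) mulrC -ExZ -ExD; apply: ler_Ex => h hh.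
rewrite (eq_big_seq (fun v => cabs (Sum h u + alpha u * phase v u) ^+ 2)); last first.
  by move=> v vh; rewrite Sum_rcons.
rewrite (Ex_step_affine u (Sum h u) (alpha u) hh).
have -> : complex.Re ((Sum h u)^* * (alpha u * Sum h u)) = (2 * cos u - 1) * cabs (Sum h u) ^+ 2.
  by rewrite -Re_alpha sqr_cabs; case: (Sum h u) => a b; case: (alpha u) => c d /=; ring.
apply: lerD; last first.
  rewrite (_ : 9 = 3 ^+ 2 :> R); last by ring.
  by rewrite lerXn2r ?nnegrE ?cabs_ge0 ?cabs_alpha_le.
rewrite [leRHS]mulrDl mul1r lerD2l.
rewrite [leLHS](_ : _ = ((4 * cos u - 2) * cabs (Sum h u) ^+ 2) / n.+1%:R); last by ring.
rewrite [leRHS]mulrAC.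
rewrite ler_wpM2r ?invr_ge0// ler_wpM2r ?exprn_ge0 ?cabs_ge0//.
Qed.

(** The mean square of the sum grows like [n^(4 cos u - 2)], as the factor for
    one step is [1 + (4 cos u - 2) / (n + 1)]; replacing the exponent by a larger
    [p >= 3/2] avoids the case where the additive constant dominates. *)
Lemma second_moment n (u p : R) : 3 / 2 <= p -> 4 * cos u - 2 <= p -> (0 < n)%N ->
  Ex n (fun h => cabs (Sum h u) ^+ 2) * rpow n%:R (- p) <= 34.
Proof.
move=> p32 up n0.
apply: (@le_trans _ _ (16 + 18 * (1 - (Num.sqrt n%:R)^-1))).
  apply: (moment_recursion (a := fun n => Ex n (fun h => cabs (Sum h u) ^+ 2)) p32) => //.
  - by move=> k; apply: Ex_ge0 => h; rewrite sqr_ge0.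
  - rewrite -(Ex_cst 1 16); apply: ler_Ex => h hh.
    rewrite (_ : 16 = 4 ^+ 2 :> R); last by ring.
    rewrite lerXn2r ?nnegrE ?cabs_ge0// (le_trans (cabs_Sum_le u hh))//; lra.
  - by move=> k _; exact: second_moment_step.
have : 0 <= (Num.sqrt n%:R : R)^-1 by rewrite invr_ge0 sqrtr_ge0.
lra.
Qed.

(** The normalized sum [W_ n] at [iu], as a function of the history. *)
Definition Wh n h (u : R) : R[i] := cexp (- alpha u * (ln n%:R)%:C) * Sum h u.

Lemma sqr_cabs_Wh n h u :
  cabs (Wh n h u) ^+ 2 = cabs (Sum h u) ^+ 2 * rpow n%:R (- (4 * cos u - 2)).
Proof.
rewrite Normc.normcM exprMn cabs_cexp [LHS]mulrC; congr (_ * _).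
rewrite /rpow -expRM_natl; congr expR.
rewrite [_ * _%:C]mulrC Re_realM.
have -> : complex.Re (- alpha u) = - complex.Re (alpha u) by case: (alpha u).
by rewrite Re_alpha -mulr_natl; ring.
Qed.

Lemma Wh_moment n (u : R) : 3 / 2 <= 4 * cos u - 2 -> (0 < n)%N ->
  Ex n (fun h => cabs (Wh n h u) ^+ 2) <= 34.
Proof.
move=> u32 n0; apply: le_trans (second_moment u32 (lexx _) n0).
by rewrite mulrC -ExZ; apply: ler_Ex => h _; rewrite sqr_cabs_Wh mulrC.
Qed.

Definition step_cst : R := 24 + 144 * expR 3.

(** The normalization [exp(- alpha log n)] compensates the growth factor
    [1 + alpha / (k + 1)] up to second order. *)
Lemma step_factor_le k (u : R) : (0 < k)%N ->
  cabs (cexp (- alpha u * (ln k.+1%:R - ln k%:R)%:C) * (1 + alpha u / k.+1%:R) - 1) <=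
  step_cst * (k.+1%:R)^-1 ^+ 2.
Proof.
move=> k0; set d := ln k.+1%:R - ln k%:R; set t : R := k.+1%:R^-1; set al := alpha u.
have al3 : cabs al <= 3 := cabs_alpha_le u.
have d1 : d <= k%:R^-1 := ln_succ_le k0.
have d2 : t <= d := ln_succ_ge k0.
have t0 : 0 <= t by rewrite invr_ge0.
have kt : k%:R^-1 - t <= 2 * t ^+ 2.
  have -> : k%:R^-1 - t = k%:R^-1 * t by rewrite /t -natr1; field; rewrite ?nat1r ?natr1 ?pnatr_eq0 /= ?(gtn_eqF k0) ?andbT.
  have : k%:R^-1 <= 2 * t.
    rewrite /t -[2]invrK -invfM lef_pV2 ?posrE ?mulr_gt0 ?invr_gt0 ?ltr0n//.
    by rewrite ler_pdivrMl// -natrM ler_nat; lia.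
  by move=> h; rewrite expr2 mulrA ler_wpM2r.
have k1 : k%:R^-1 <= 1 :> R by rewrite invf_le1 ?ltr0n// ler1n.
have t1 : t <= 1 by rewrite invf_le1 ?ltr0n// ler1n.
have d2t : d <= 2 * t by move: kt d1; nra.
have -> : (alpha u / k.+1%:R) = al * t%:C.
  by rewrite /t fmorphV rmorph_nat.
set E1 := cexp (- al * d%:C) - (1 + - al * d%:C).
have -> : cexp (- al * d%:C) * (1 + al * t%:C) - 1 =
    al * (t - d)%:C - al ^+ 2 * (d * t)%:C + E1 * (1 + al * t%:C).
  by rewrite /E1; clear E1; clearbody d t al; rewrite rmorphB rmorphM/=; ring.
have d0 : 0 <= d by exact: le_trans d2.
have e1 : cabs E1 <= 36 * expR 3 * t ^+ 2.
  have := cexp_taylor 2 (- al * d%:C); rewrite exp_trunc2 -/E1 => h; apply: (le_trans h).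
  have ald : cabs (- al * d%:C) <= 3 * d.
    by rewrite Normc.normcM normcN cabs_real (ger0_norm d0) ler_wpM2r.
  rewrite [leRHS]mulrAC; apply: ler_pM; rewrite ?exprn_ge0 ?cabs_ge0 ?expR_ge0//.
    rewrite (_ : 36 * t ^+ 2 = (3 * (2 * t)) ^+ 2); last by ring.
    rewrite lerXn2r ?nnegrE ?cabs_ge0 ?mulr_ge0// (le_trans ald)// ler_wpM2l//.
  by rewrite ler_expR (le_trans ald)//; lra.
apply: (le_trans (le_normcD _ _)); apply: (@le_trans _ _ ((6 + 18) * t ^+ 2 + 36 * expR 3 * t ^+ 2 * 4)).
  apply: lerD.
    apply: (le_trans (cabsB _ _)); rewrite [leRHS]mulrDl; apply: lerD.
      rewrite Normc.normcM cabs_real ler0_norm ?subr_le0// opprB.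
      apply: (@le_trans _ _ (3 * (2 * t ^+ 2))); last by rewrite mulrA; lra.
      by apply: ler_pM; rewrite ?cabs_ge0 ?subr_ge0//; move: kt d1; lra.
    rewrite Normc.normcM cabs_real cabsX ger0_norm ?mulr_ge0//.
    rewrite (_ : 18 * t ^+ 2 = 3 ^+ 2 * (2 * t * t)); last by ring.
    apply: ler_pM; rewrite ?exprn_ge0 ?cabs_ge0 ?mulr_ge0//.
      by rewrite lerXn2r ?nnegrE ?cabs_ge0.
    by rewrite ler_wpM2r.
  rewrite Normc.normcM; apply: ler_pM; rewrite ?cabs_ge0//.
  apply: (le_trans (le_normcD _ _)); rewrite Normc.normc1 Normc.normcM cabs_real ger0_norm//.
  have : cabs al * t <= 3 * 1 by apply: ler_pM; rewrite ?cabs_ge0.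
  lra.
by rewrite /step_cst; lra.
Qed.

Definition increment_cst : R := 68 * step_cst ^+ 2 + 9.

(** Given the history, one step multiplies [Wh] by a factor [1 + O(k^(-2))] on
    average and adds a variance [O(k^(-p))], where [p = 4 cos u - 2 >= 3/2]. *)
Lemma Wh_increment n (u : R) : 3 / 2 <= 4 * cos u - 2 -> (0 < n)%N ->
  forall k, (n <= k)%N ->
  Ex k (fun h => cabs (Wh k h u - Wh n (take n h) u) ^+ 2) <=
  expR 1 * (2 * increment_cst) * (Num.sqrt n%:R)^-1.
Proof.
move=> u32 n0; apply: (contraction_recursion (E := fun k => Ex k (fun h => cabs (Wh k h u - Wh n (take n h) u) ^+ 2))) => //.
- by rewrite addr_ge0// mulr_ge0// sqr_ge0.
- rewrite -(Ex_cst n 0); apply: ler_Ex => h hh.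
  by rewrite take_oversize ?(size_history hh)// subrr Normc.normc0 expr0n.
move=> k nk; have k0 : (0 < k)%N by exact: leq_trans nk.
set t : R := k.+1%:R^-1.
have t0 : 0 < t by rewrite invr_gt0 ltr0n.
have s1 : 1 <= Num.sqrt (k.+1%:R : R) by have := @ler_wsqrtr R 1 k.+1%:R; rewrite sqrtr1 ler1n; apply.
have ts : t ^+ 2 <= (Num.sqrt k.+1%:R)^-1 ^+ 3.
  have -> : t = (Num.sqrt k.+1%:R)^-1 ^+ 2 by rewrite exprVn sqr_sqrtr.
  rewrite -exprM; apply: ler_wiXn2l; rewrite ?invr_ge0 ?invf_le1 ?(lt_le_trans ltr01)//.
pose p := 4 * cos u - 2.
apply: (@le_trans _ _ (Ex k (fun h =>
   (1 + t ^+ 2) * cabs (Wh k h u - Wh n (take n h) u) ^+ 2 +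
   (2 * step_cst ^+ 2 * t ^+ 2) * cabs (Wh k h u) ^+ 2 + 9 * rpow k.+1%:R (- p)))); last first.
  rewrite !ExD !ExZ Ex_cst -addrA lerD2l /increment_cst [leRHS]mulrDl.
  have h1 := Wh_moment u32 k0.
  have h2 : rpow k.+1%:R (- p) <= (Num.sqrt k.+1%:R)^-1 ^+ 3 by exact: rpow_telescope.
  apply: lerD; last by rewrite ler_wpM2l.
  rewrite (_ : 68 * _ * _ = 2 * step_cst ^+ 2 * (Num.sqrt k.+1%:R)^-1 ^+ 3 * 34); last by ring.
  apply: ler_pM => //.
  - by rewrite mulr_ge0 ?sqr_ge0// mulr_ge0 ?sqr_ge0.
  - by apply: Ex_ge0 => h; rewrite sqr_ge0.
  - by rewrite ler_wpM2l// mulr_ge0 ?sqr_ge0.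
rewrite Ex_step; apply: ler_Ex => h hh.
set X := Wh n (take n h) u; set gm := cexp (- alpha u * (ln k.+1%:R - ln k%:R)%:C).
set bt := gm * (alpha u * cexp (- alpha u * (ln k%:R)%:C)).
rewrite (eq_big_seq (fun v => cabs ((gm * Wh k h u - X) + bt * phase v u) ^+ 2)); last first.
  move=> v vh; congr (cabs _ ^+ 2).
  have -> : take n (rcons h v) = take n h.
    by rewrite -cats1 takel_cat// (size_history hh).
  rewrite -/X /Wh Sum_rcons// /bt.
  have -> : cexp (- alpha u * (ln k.+1%:R)%:C) = gm * cexp (- alpha u * (ln k%:R)%:C).
    by rewrite /gm -cexpD; congr cexp; rewrite rmorphB/=; ring.
  by ring.
rewrite (Ex_step_affine u (gm * Wh k h u - X) bt hh) -/t.
set A := gm * Wh k h u - X.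
have -> : bt * Sum h u = gm * (alpha u * Wh k h u) by rewrite /bt /Wh; ring.
set Y := gm * (alpha u * Wh k h u).
(* Completing the square shows the conditional mean [A + t Y] of the next value. *)
have -> : cabs A ^+ 2 + 2 * complex.Re (A^* * Y) / k.+1%:R + cabs bt ^+ 2 =
   cabs (A + t%:C * Y) ^+ 2 - t ^+ 2 * cabs Y ^+ 2 + cabs bt ^+ 2.
  clearbody A Y bt; rewrite cabs_sqrD [A^* * (t%:C * _)]mulrCA Re_realM Normc.normcM cabs_real ger0_norm ?(ltW t0)//.
  by rewrite /t; ring.
have ->: A + t%:C * Y = (Wh k h u - X) + (gm * (1 + alpha u / k.+1%:R) - 1) * Wh k h u.
  by rewrite /A /Y /t fmorphV rmorph_nat; ring.
have sf := step_factor_le u k0; rewrite -/gm -/t in sf.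
set rr := gm * _ - 1 in sf *.
have bb : cabs bt ^+ 2 <= 9 * rpow k.+1%:R (- p).
  have -> : bt = alpha u * cexp (- alpha u * (ln k.+1%:R)%:C).
    rewrite /bt /gm mulrCA -cexpD; congr (_ * cexp _); rewrite rmorphB/=; ring.
  rewrite Normc.normcM exprMn; apply: ler_pM; rewrite ?exprn_ge0 ?cabs_ge0//.
    rewrite (_ : 9 = 3 ^+ 2 :> R); last by ring.
    by rewrite lerXn2r ?nnegrE ?cabs_ge0 ?cabs_alpha_le.
  have := sqr_cabs_Wh k.+1 [::] u; rewrite Normc.normcM exprMn mulrC => /mulfI -> //.
  rewrite /Sum /ext_of /= big_seq1 cabs_phase expr1n oner_eq0//.
rewrite -addrA; apply: lerD; last first.
  have : 0 <= t ^+ 2 * cabs Y ^+ 2 by rewrite mulr_ge0 ?sqr_ge0.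
  move: bb; lra.
set D := Wh k h u - X; set w := Wh k h u.
have h1 : cabs (D + rr * w) <= cabs D + step_cst * t ^+ 2 * cabs w.
  by rewrite (le_trans (le_normcD _ _))// lerD2l Normc.normcM ler_wpM2r ?cabs_ge0.
have rc0 : 0 <= step_cst by rewrite addr_ge0// mulr_ge0// expR_ge0.
apply: (@le_trans _ _ ((cabs D + step_cst * t ^+ 2 * cabs w) ^+ 2)).
  have p0 : 0 <= step_cst * t ^+ 2 by rewrite mulr_ge0 ?sqr_ge0.
  by rewrite lerXn2r ?nnegrE ?cabs_ge0// addr_ge0 ?cabs_ge0// mulr_ge0 ?cabs_ge0.
have t1 : t <= 1 by rewrite invf_le1 ?ltr0n// ler1n.
have t2 : t ^+ 2 <= 1 by rewrite expr_le1// ltW.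
move: (cabs D) (cabs w) step_cst => x y c.
rewrite -subr_ge0.
have -> : (1 + t ^+ 2) * x ^+ 2 + 2 * c ^+ 2 * t ^+ 2 * y ^+ 2 - (x + c * t ^+ 2 * y) ^+ 2 =
  (t * x - c * t * y) ^+ 2 + (c * t * y) ^+ 2 * (1 - t ^+ 2) by ring.
by rewrite addr_ge0 ?sqr_ge0// mulr_ge0 ?sqr_ge0// subr_ge0.
Qed.

End SecondMoments.

(** * Probabilities of events depending on the history *)

Lemma sum_inv_sqr_le (R : realType) m n : (0 < m)%N -> (m <= n)%N ->
  \sum_(m <= j < n) (j.+1%:R)^-1 ^+ 2 <= m%:R^-1 - n%:R^-1 :> R.
Proof.
move=> m0; elim: n => [|n IH]; first by rewrite leqNgt m0.
rewrite leq_eqVlt => /predU1P[->|]; first by rewrite big_geq// subrr.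
rewrite ltnS => mn; rewrite big_nat_recr//=; apply: (le_trans (lerD (IH mn) (lexx _))).
rewrite -addrA lerD2l.
have n0 : (0 < n)%N by exact: leq_trans mn.
have nn : n%:R != 0 :> R by rewrite pnatr_eq0 -lt0n.
have nn1 : 1 + n%:R != 0 :> R by rewrite nat1r pnatr_eq0.
rewrite -subr_ge0.
have -> : - n.+1%:R^-1 - (- n%:R^-1 + n.+1%:R^-1 ^+ 2) = n%:R^-1 * n.+1%:R^-1 ^+ 2 :> R.
  by rewrite -natr1; field; rewrite ?nat1r ?natr1 ?pnatr_eq0 /= ?(gtn_eqF n0) ?andbT.
by rewrite mulr_ge0 ?invr_ge0// exprn_ge0// invr_ge0.
Qed.

Section HistoryLaw.
Context {R : realType} {d : measure_display} {T : measurableType d}.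
Context {P : probability T R} {V : nat -> T -> node}.

Definition hist n w : seq node := mkseq (fun i => V i w) n.

Lemma bst_ext_hist n w : bst_ext V n w = ext_of (hist n w).
Proof.
rewrite /bst_ext /ext_of size_mkseq; apply: ext_nodes_eq => i ni.
by rewrite nth_mkseq.
Qed.

Lemma take_hist n m w : (n <= m)%N -> take n (hist m w) = hist n w.
Proof. by move=> nm; rewrite /hist /mkseq -map_take take_iota (minn_idPl nm). Qed.

Lemma hist_setE n (v : nat -> node) :
  [set w | forall i, (i < n)%N -> V i w = v i] = [set w | hist n w = mkseq v n].
Proof.
apply/seteqP; split => w /= h.
  by apply/eq_in_map => i; rewrite mem_iota add0n => /h.
by move=> i ni; have := congr1 (fun s => nth [::] s i) h; rewrite /hist !nth_mkseq.
Qed.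

Hypothesis bstV : bst_process P V.

Lemma measurable_hist n h : measurable [set w | hist n w = h].
Proof.
elim: n h => [|n IH] h.
  have [->|h0] := eqVneq h [::].
    by rewrite (_ : mkset _ = setT)//; apply/seteqP; split.
  rewrite (_ : mkset _ = set0)//; apply/seteqP; split=> w //=.
  by move=> e; rewrite -e eqxx in h0.
case/lastP: h => [|h x].
  rewrite (_ : mkset _ = set0)//; apply/seteqP; split=> w //=.
rewrite (_ : mkset _ = [set w | hist n w = h] `&` [set w | V n w = x]).
  by apply: measurableI; [exact: IH|exact: bstV.1].
apply/seteqP; split => w /=; rewrite /hist mkseqS.
  by move=> /rcons_inj[-> ->].
by move=> [-> ->].
Qed.

(** The chain of conditional probabilities in the definition of the process
    telescopes to [1 / n!]. *)
Lemma prob_hist n h : P [set w | hist n w = h] =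
  (if h \in histories n then (n`!%:R^-1)%:E else 0)%E.
Proof.
elim: n h => [|n IH] h.
  rewrite inE; have [->|h0] := eqVneq h [::].
    by rewrite (_ : mkset _ = setT) ?probability_setT ?fact0 ?invr1//; apply/seteqP; split.
  rewrite (_ : mkset _ = set0) ?measure0//; apply/seteqP; split=> w //=.
  by move=> e; rewrite -e eqxx in h0.
have [hn|/eqP hn] := eqVneq (size h) n.+1; last first.
  rewrite (_ : mkset _ = set0) ?measure0.
    by case: ifP => // /size_history.
  apply/seteqP; split=> w //= e; apply: hn.
  by rewrite -e size_mkseq.
case/lastP: h hn => [//|h x]; rewrite size_rcons => -[hn].
pose v := nth [::] (rcons h x).
have hv : mkseq v n = h.
  rewrite -[RHS](mkseq_nth [::]) hn; apply/eq_in_map => i; rewrite mem_iota add0n => /= ni.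
  by rewrite /v nth_rcons hn ni.
have hxv : mkseq v n.+1 = rcons h x by rewrite mkseqS hv /v nth_rcons hn ltnn eqxx.
have -> : [set w | hist n.+1 w = rcons h x] = [set w | forall i, (i <= n)%N -> V i w = v i].
  by rewrite -hxv; symmetry; exact: (hist_setE n.+1 v).
rewrite (bstV.2 n v) hist_setE hv IH mem_histories_rcons.
have -> : v n = x by rewrite /v nth_rcons hn ltnn eqxx.
have -> : ext_nodes v n = ext_of h.
  rewrite /ext_of hn; apply: ext_nodes_eq => i ni.
  by rewrite /v nth_rcons hn ni.
case: (h \in histories n); rewrite ?mule0//=.
case: (x \in ext_of h); rewrite ?mul0e// -EFinM factS natrM invfM//.
Qed.

Lemma measurable_hist_pred n (Q : pred (seq node)) : measurable [set w | Q (hist n w)].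
Proof.
have [pk [up upK]] : exists (pk : seq node -> nat) up, pcancel pk up.
  by exists pickle, unpickle; exact: pickleK.
rewrite (_ : mkset _ = \bigcup_k (if up k is Some h then
   if Q h then [set w | hist n w = h] else set0 else set0)).
  apply: bigcup_measurable => k _; case: (up k) => [h|]//; case: ifP => // _.
  exact: measurable_hist.
apply/seteqP; split => w /=.
  by move=> Qw; exists (pk (hist n w)) => //; rewrite upK Qw.
by move=> [k _]; case: (up k) => // h; case: ifP => // Qh /= ->.
Qed.

Lemma bad_history_null n : P [set w | hist n w \notin histories n] = 0%E.
Proof.
have [pk [up upK]] : exists (pk : seq node -> nat) up, pcancel pk up.
  by exists pickle, unpickle; exact: pickleK.
apply: (measure_negligible (measurable_hist_pred n (fun h => h \notin histories n))).
rewrite (_ : mkset _ = \bigcup_k (if up k is Some h then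
   if h \notin histories n then [set w | hist n w = h] else set0 else set0)).
  apply: negligible_bigcup => k; case: (up k) => [h|]; last exact: negligible_set0.
  case: ifP => hn; last exact: negligible_set0.
  exists [set w | hist n w = h]; split => //; first exact: measurable_hist.
  by have := prob_hist n h; rewrite (negbTE hn) => <-.
apply/seteqP; split => w /=.
  by move=> Qw; exists (pk (hist n w)) => //; rewrite upK Qw.
by move=> [k _]; case: (up k) => // h; case: ifP => // Qh /= ->.
Qed.

(** A union bound over the finitely many histories; lists that are not
    histories carry no mass. *)
Lemma prob_hist_pred n (Q : pred (seq node)) :
  (P [set w | Q (hist n w)] <= (Ex n (fun h => (Q h)%:R : R))%:E)%E.
Proof.
have mQ := measurable_hist_pred n Q.
have listP (s : seq (seq node)) : {subset s <= histories n} ->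
    (P [set w | Q (hist n w) && (hist n w \in s)] <=
     (n`!%:R^-1 * \sum_(h <- s) (Q h)%:R : R)%:E)%E.
  elim: s => [|h s IH] sub.
    rewrite (_ : mkset _ = set0) ?measure0 ?big_nil ?mulr0//.
    by apply/seteqP; split=> w //=; rewrite andbF.
  have hh : h \in histories n by apply: sub; rewrite mem_head.
  have {}IH := IH (fun x xs => sub x (mem_behead (s := h :: s) xs)).
  have mh : measurable [set w | Q (hist n w) && (hist n w == h)].
    exact: (measurable_hist_pred n (fun x => Q x && (x == h))).
  have ms : measurable [set w | Q (hist n w) && (hist n w \in s)].
    exact: (measurable_hist_pred n (fun x => Q x && (x \in s))).
  rewrite (_ : mkset _ = [set w | Q (hist n w) && (hist n w == h)] `|`
    [set w | Q (hist n w) && (hist n w \in s)]); last first.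
    apply/seteqP; split => w /=; rewrite inE.
      by case/andP => -> /orP[->|->]; [left|right].
    by case => /andP[-> ->] //; rewrite orbT.
  apply: (le_trans (measureU2 _ mh ms)).
  rewrite big_cons mulrDr EFinD; apply: leeD; last exact: IH.
  case Qh : (Q h).
    rewrite mulr1 (_ : mkset _ = [set w | hist n w = h]).
      by have := prob_hist n h; rewrite hh => <-.
    apply/seteqP; split => w /=; first by case/andP => _ /eqP.
    by move=> ->; rewrite Qh eqxx.
  rewrite mulr0 (_ : mkset _ = set0) ?measure0//.
  by apply/seteqP; split=> w //= /andP[+ /eqP e]; rewrite e Qh.
have mb := measurable_hist_pred n (fun h => h \notin histories n).
have mg := measurable_hist_pred n (fun h => Q h && (h \in histories n)).
apply: (@le_trans _ _ (P ([set w | Q (hist n w) && (hist n w \in histories n)] `|`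
   [set w | hist n w \notin histories n]))).
  apply: le_measure; rewrite ?inE//; first exact: measurableU.
  by move=> w /= ->; case: (_ \in _); [left|right].
apply: (le_trans (measureU2 _ mg mb)); rewrite [X in (_ + X)%E]bad_history_null adde0.
exact: listP.
Qed.

(** Markov's inequality and the Borel-Cantelli lemma. *)
Lemma history_ae_small (F : nat -> seq node -> R) (N : nat -> nat) (C : R) : 0 <= C ->
  (forall m h, 0 <= F m h) ->
  (forall m, Ex (N m) (F m) <= C * (m.+1%:R)^-1 ^+ 4) ->
  {ae P, forall w, exists M, forall m, (M <= m)%N -> F m (hist (N m) w) <= (m.+1%:R)^-1 ^+ 2}.
Proof.
move=> C0 F0 EF.
pose Q m h := (m.+1%:R)^-1 ^+ 2 < F m h.
pose A m := [set w | Q m (hist (N m) w)].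
have mA m : measurable (A m) by exact: measurable_hist_pred.
have PA m : (P (A m) <= (C * (m.+1%:R)^-1 ^+ 2)%:E)%E.
  apply: (le_trans (prob_hist_pred _ _)); rewrite lee_fin.
  apply: (@le_trans _ _ (Ex (N m) (fun h => m.+1%:R ^+ 2 * F m h))).
    apply: ler_Ex => h _; rewrite /Q.
    case: ltP => /= [lt|_]; last by rewrite mulr_ge0// sqr_ge0.
    rewrite -ler_pdivrMl ?exprn_gt0 ?ltr0n// mulr1 -exprVn ltW//.
  rewrite ExZ -ler_pdivlMl ?exprn_gt0 ?ltr0n//; apply: (le_trans (EF m)).
  have -> : m.+1%:R ^- 2 = m.+1%:R^-1 ^+ 2 :> R by rewrite exprVn.
  by rewrite [leRHS]mulrCA -exprD.
have L : P (lim_sup_set A) = 0%E.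
  apply: lim_sup_set_cvg0 => //.
  apply: (@le_lt_trans _ _ (C * 2)%:E); last exact: ltry.
  apply: lime_le; first exact: is_cvg_nneseries.
  apply: nearW => n.
  apply: (@le_trans _ _ (\sum_(0 <= m < n) (C * (m.+1%:R)^-1 ^+ 2)%:E)%E).
    by apply: lee_sum => m _; exact: PA.
  rewrite sumEFin lee_fin -mulr_sumr ler_wpM2l//.
  case: n => [|n]; first by rewrite big_nil.
  rewrite big_ltn// invr1 expr1n.
  apply: (@le_trans _ _ (1 + (1%:R^-1 - n.+1%:R^-1))).
    by rewrite lerD2l sum_inv_sqr_le.
  by rewrite invr1 addrA gerBl invr_ge0.
have : P.-negligible (lim_sup_set A).
  by exists (lim_sup_set A); split => //; apply: bigcap_measurable => // n _; apply: bigcup_measurable.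
apply: negligibleS => w /= H n _.
apply: contrapT => H'; apply: H; exists n => m nm.
rewrite leNgt; apply/negP => lt; apply: H'; exists m => //.
Qed.

End HistoryLaw.

(** * Continuity of complex functions of a real variable *)

Section ContinuousComplex.
Context {R : realType}.
Implicit Types f g : R -> R[i].

Definition ccont f := continuous (fun u => complex.Re (f u)) /\ continuous (fun u => complex.Im (f u)).

Lemma ccont_add f g : ccont f -> ccont g -> ccont (fun u => f u + g u).
Proof.
move=> [f1 f2] [g1 g2]; split.
  by under eq_fun do rewrite ReD; exact: cont_add.
by under eq_fun do rewrite ImD; exact: cont_add.
Qed.

Lemma ccont_opp f : ccont f -> ccont (fun u => - f u).
Proof.
move=> [f1 f2]; split.
  have -> : (fun u => complex.Re (- f u)) = (fun u => - complex.Re (f u)).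
    by apply/funext => u; case: (f u).
  exact: cont_opp.
have -> : (fun u => complex.Im (- f u)) = (fun u => - complex.Im (f u)).
  by apply/funext => u; case: (f u).
exact: cont_opp.
Qed.

Lemma ccont_sub f g : ccont f -> ccont g -> ccont (fun u => f u - g u).
Proof. by move=> cf cg; apply: ccont_add => //; exact: ccont_opp. Qed.

Lemma ccont_mul f g : ccont f -> ccont g -> ccont (fun u => f u * g u).
Proof.
move=> [f1 f2] [g1 g2]; split.
  have -> : (fun u => complex.Re (f u * g u)) = (fun u =>
     complex.Re (f u) * complex.Re (g u) - complex.Im (f u) * complex.Im (g u)).
    by apply/funext => u; case: (f u) => a b; case: (g u).
  by apply: cont_sub; apply: cont_mul.
have -> : (fun u => complex.Im (f u * g u)) = (fun u =>
   complex.Re (f u) * complex.Im (g u) + complex.Im (f u) * complex.Re (g u)).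
  by apply/funext => u; case: (f u) => a b; case: (g u).
by apply: cont_add; apply: cont_mul.
Qed.

Lemma ccont_cst (c : R[i]) : ccont (fun=> c).
Proof. by split; exact: cont_cst. Qed.

Lemma ccont_real (f : R -> R) : continuous f -> ccont (fun u => (f u)%:C).
Proof. by move=> cf; split => //=; exact: cont_cst. Qed.

Lemma ccont_sum (I : Type) (r : seq I) (F : I -> R -> R[i]) :
  (forall i, ccont (F i)) -> ccont (fun u => \sum_(i <- r) F i u).
Proof.
move=> h; elim: r => [|i r IH].
  by under eq_fun do rewrite big_nil; exact: ccont_cst.
by under eq_fun do rewrite big_cons; exact: ccont_add.
Qed.

Lemma ccont_pow f n : ccont f -> ccont (fun u => f u ^+ n).
Proof.
move=> cf; elim: n => [|n IH].
  by under eq_fun do rewrite expr0; exact: ccont_cst.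
by under eq_fun do rewrite exprS; exact: ccont_mul.
Qed.

Lemma ccont_cexp f : ccont f -> ccont (fun u => cexp (f u)).
Proof.
move=> [f1 f2]; rewrite /cexp; apply: ccont_mul.
  by apply: ccont_real; apply: cont_compose => //; exact: continuous_expR.
split => /=; apply: cont_compose => //; [exact: continuous_cos|exact: continuous_sin].
Qed.

Lemma ccont_iu : ccont (@iu R).
Proof. by split; [exact: cont_cst|exact: cont_id]. Qed.

Lemma cont_cabs f : ccont f -> continuous (fun u => cabs (f u)).
Proof.
move=> [f1 f2]; under eq_fun do rewrite cabsE.
apply: cont_compose; first exact: sqrt_continuous.
by apply: cont_add; apply: cont_pow.
Qed.

Lemma ccont_Sum h : ccont (Sum h : R -> _).
Proof. by apply: ccont_sum => v; exact: cont_Sum_phase. Qed.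

Lemma ccont_alpha : ccont (@alpha R).
Proof.
apply: ccont_sub; last exact: ccont_cst.
by apply: ccont_mul; [exact: ccont_cst|apply: ccont_cexp; exact: ccont_iu].
Qed.

Lemma ccont_Wh n h : ccont (Wh n h : R -> _).
Proof.
apply: ccont_mul; last exact: ccont_Sum.
apply: ccont_cexp; apply: ccont_mul; last exact: ccont_cst.
by apply: ccont_opp; exact: ccont_alpha.
Qed.

End ContinuousComplex.

(** * Almost sure bounds along blocks *)

Section AveragedBounds.
Context {R : realType}.
Implicit Types (a b : R).

Lemma le_amgm (x t : R) : 0 < t -> x <= (t * x ^+ 2 + t^-1) / 2.
Proof.
move=> t0; have : 0 <= (t * x - 1) ^+ 2 / t by rewrite mulr_ge0 ?sqr_ge0// invr_ge0 ltW.
have -> : (t * x - 1) ^+ 2 / t = t * x ^+ 2 - 2 * x + t^-1 by field; rewrite gt_eqF.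
lra.
Qed.

(** Fubini's theorem and [2 x <= t x^2 + 1 / t], which avoids square roots of
    moments; [t] is chosen later to balance the two terms. *)
Lemma Ex_Int_le a b n (f : seq node -> R -> R) (M t : R) : a <= b -> 0 < t ->
  (forall h, continuous (f h)) ->
  (forall u, a <= u <= b -> Ex n (fun h => f h u ^+ 2) <= M) ->
  Ex n (fun h => Int a b (f h)) <= (b - a) * ((t * M + t^-1) / 2).
Proof.
move=> ab t0 cf H; rewrite Ex_Int//.
have cE : continuous (fun u => Ex n (fun h => f h u)).
  by rewrite /Ex; apply: cont_mul; [exact: cont_cst|apply: cont_sum => h; exact: cf].
rewrite mulrC; apply: Int_le_cst => // u uab.
apply: (@le_trans _ _ (Ex n (fun h => (t / 2) * f h u ^+ 2 + t^-1 / 2))).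
  by apply: ler_Ex => h _; apply: (le_trans (le_amgm _ t0)); rewrite mulrDl mulrAC.
rewrite ExD ExZ Ex_cst mulrDl lerD2r mulrAC ler_wpM2r// ler_wpM2l ?H// ltW//.
Qed.

(** End times of blocks.  The growth is polynomial, so that consecutive ends
    have ratio [1 + O(1 / m)], while a given negative power of [n] is summable
    along them once [q] is large. *)
Definition block (q m : nat) : nat := (m.+1 ^ q)%N.

Lemma block_gt0 q m : (0 < block q m)%N.
Proof. by rewrite expn_gt0. Qed.

Lemma block_le q m m' : (m <= m')%N -> (block q m <= block q m')%N.
Proof. by rewrite /block; case: q => // q h; rewrite leq_exp2r. Qed.

Lemma lt_block q m : (0 < q)%N -> (m < block q m)%N.
Proof.
move=> q0; rewrite /block -{1}[m.+1]expn1.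
by rewrite leq_pexp2l.
Qed.

End AveragedBounds.

Section AlmostSureBlocks.
Context {R : realType} {d : measure_display} {T : measurableType d}.
Context {P : probability T R} {V : nat -> T -> node}.
Hypothesis bstV : bst_process P V.
Local Notation H n w := (hist (V := V) n w).

Lemma ae_histories : {ae P, forall w, forall n, H n w \in histories n}.
Proof.
apply: (@ae_foralln _ _ _ P (fun n w => H n w \in histories n)) => n.
exists [set w | H n w \notin histories n]; split.
- exact: (measurable_hist_pred bstV n (fun h => h \notin histories n)).
- exact: bad_history_null.
- by move=> w /= h; apply/negP.
Qed.

(** The choice [t = (m + 1)^4] turns the second moments, which are
    [O((m + 1)^(-8))] because [q >= 16], into first moments [O((m + 1)^(-4))]. *)
Lemma ae_inner (d0 : R) (q : nat) : 0 < d0 -> (16 <= q)%N ->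
  (forall u, `|u| <= d0 -> 3 / 2 <= 4 * cos u - 2) ->
  {ae P, forall w, exists M, forall m, (M <= m)%N ->
    Int (- d0) d0 (fun u => cabs (Wh (block q m.+1) (H (block q m.+1) w) u -
                                  Wh (block q m) (H (block q m) w) u)) <= (m.+1%:R)^-1 ^+ 2}.
Proof.
move=> d00 q16 hd.
(* The earlier value is read off the same history, cut at the earlier time. *)
pose F m h := Int (- d0) d0 (fun u => cabs (Wh (block q m.+1) h u - Wh (block q m) (take (block q m) h) u)).
set K : R := expR 1 * (2 * increment_cst).
have K0 : 0 <= K.
  by rewrite mulr_ge0 ?expR_ge0// mulr_ge0// addr_ge0// mulr_ge0// sqr_ge0.
have cF m h : continuous (fun u => cabs (Wh (block q m.+1) h u - Wh (block q m) (take (block q m) h) u) : R).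
  by apply: cont_cabs; apply: ccont_sub; exact: ccont_Wh.
have C0 : 0 <= 2 * d0 * (K + 1) / 2.
  by rewrite mulr_ge0// mulr_ge0 ?addr_ge0// mulr_ge0// ltW.
have F0 m h : 0 <= F m h by apply: Int_ge0 => u; exact: cabs_ge0.
apply: filterS (history_ae_small bstV (N := fun m => block q m.+1) C0 F0 _).
  move=> w [M hM]; exists M => m Mm; have := hM m Mm.
  by rewrite /F take_hist// block_le.
move=> m.
have x0 : 0 < m.+1%:R :> R by rewrite ltr0n.
have t0 : 0 < (m.+1%:R : R) ^+ 4 by rewrite exprn_gt0.
have dd : - d0 <= d0 by lra.
apply: (le_trans (Ex_Int_le (M := K * (m.+1%:R^-1 ^+ 8)) dd t0 (cF m) _)); last first.
  rewrite le_eqVlt; apply/orP; left; apply/eqP.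
  by field; rewrite ?nat1r ?natr1 ?pnatr_eq0.
move=> u /andP[u1 u2].
have ud : `|u| <= d0 by rewrite ler_norml u1.
apply: (le_trans (Wh_increment (hd _ ud) (block_gt0 q m) (block_le q (leqnSn m)))).
rewrite -/K ler_wpM2l// exprVn lef_pV2 ?posrE ?sqrtr_gt0 ?ltr0n ?block_gt0 ?exprn_gt0//.
have -> : (m.+1%:R : R) ^+ 8 = Num.sqrt ((m.+1%:R ^+ 8) ^+ 2).
  by rewrite sqrtr_sqr ger0_norm// exprn_ge0// ltW.
apply: ler_wsqrtr; rewrite -exprM /block natrX.
by apply: ler_weXn2l => //; rewrite ler1n.
Qed.

(** As for [ae_inner]: the second moments are [O(n^(p - 2))] and
    [n = (m + 2)^q]. *)
Lemma ae_outer (a b p : R) (q : nat) : a <= b -> 3 / 2 <= p -> 8 <= q%:R * (2 - p) ->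
  (forall u, a <= u <= b -> 4 * cos u - 2 <= p) ->
  {ae P, forall w, exists M, forall m, (M <= m)%N ->
    Int a b (fun u => cabs (Sum (H (block q m.+1) w) u) / (block q m.+1)%:R) <= (m.+1%:R)^-1 ^+ 2}.
Proof.
move=> ab p32 qp hab.
pose F m h := Int a b (fun u => cabs (Sum h u) / (block q m.+1)%:R).
have cF m h : continuous (fun u => cabs (Sum h u) / (block q m.+1)%:R : R).
  by apply: cont_mul; [apply: cont_cabs; exact: ccont_Sum|exact: cont_cst].
have C0 : 0 <= (b - a) * ((34 + 1) / 2).
  by rewrite mulr_ge0// subr_ge0.
have F0 m h : 0 <= F m h by apply: Int_ge0 => u; rewrite mulr_ge0 ?cabs_ge0.
apply: filterS (history_ae_small bstV (N := fun m => block q m.+1) C0 F0 _) => // m.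
have x0 : 0 < m.+1%:R :> R by rewrite ltr0n.
have t0 : 0 < (m.+1%:R : R) ^+ 4 by rewrite exprn_gt0.
apply: (le_trans (Ex_Int_le (M := 34 * (m.+1%:R^-1 ^+ 8)) ab t0 (cF m) _)); last first.
  rewrite le_eqVlt; apply/orP; left; apply/eqP.
  by field; rewrite ?nat1r ?natr1 ?pnatr_eq0.
move=> u uab; set n := block q m.+1.
have n0 : (0 < n)%N := block_gt0 q m.+1.
have := second_moment p32 (hab _ uab) n0.
set E2 := Ex n _ => hE.
rewrite (@eq_Ex _ _ _ (fun h => (n%:R^-1) ^+ 2 * cabs (Sum h u) ^+ 2)); last first.
  by move=> h _; rewrite exprMn mulrC.
rewrite ExZ -/E2.
have E20 : 0 <= E2 by apply: Ex_ge0 => h; rewrite sqr_ge0.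
have n2 : rpow n%:R (- 2) = (n%:R^-1) ^+ 2 :> R.
  by rewrite /rpow mulNr expRN (expRM_natl 2) lnK ?posrE ?ltr0n// exprVn.
have -> : (n%:R^-1) ^+ 2 * E2 = (E2 * rpow n%:R (- p)) * rpow n%:R (p - 2).
  rewrite -n2 -mulrA -rpowD mulrC; congr (_ * rpow _ _); ring.
apply: ler_pM => //; [by rewrite mulr_ge0 ?rpow_ge0|exact: rpow_ge0|].
have -> : (m.+1%:R : R)^-1 ^+ 8 = expR (- (8 * ln m.+1%:R)).
  by rewrite expRN (expRM_natl 8) lnK ?posrE ?ltr0n// exprVn.
rewrite ler_expR /n /block natrX lnXn ?ltr0n// -mulr_natl.
have l0 : 0 <= ln (m.+2%:R : R) by rewrite ln_ge0// ler1n.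
have l1 : ln (m.+1%:R : R) <= ln m.+2%:R by rewrite ler_ln ?posrE ?ltr0n// ler_nat.
have l2 := ler_wpM2r l0 qp.
by lra.
Qed.

End AlmostSureBlocks.

(** * From blocks to all times *)

Section PathBounds.
Context {R : realType} {d : measure_display} {T : measurableType d}.
Context {V : nat -> T -> node} {w : T}.
Local Notation H n := (hist (V := V) n w).
Hypothesis Hh : forall n, H n \in histories n.

(** The parameter of the approximating Poisson law. *)
Definition lam n : R := 2 * ln n%:R.

Definition Sbar n (u : R) : R[i] := (n%:R^-1)%:C * Sum (H n) u.

Lemma ccont_Sbar n : ccont (Sbar n).
Proof. by apply: ccont_mul; [exact: ccont_cst|exact: ccont_Sum]. Qed.

Lemma cabs_Sum_diff n k (u : R) : (n <= k)%N ->
  cabs (Sum (H k) u - Sum (H n) u) <= 3 * (k - n)%:R.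
Proof.
move=> nk; rewrite -{1}(subnKC nk); elim: (k - n)%N => [|j IH].
  by rewrite addn0 subrr Normc.normc0 mulr0.
have tr := cabs_dist_triangle (Sum (H (n + j)) u) (Sum (H (n + j.+1)) u) (Sum (H n) u).
apply: (le_trans tr).
rewrite -[j.+1%:R]natr1 [leRHS]mulrDr mulr1 [leRHS]addrC addnS; apply: lerD; last exact: IH.
have hm := Hh (n + j).+1; move: hm; rewrite /hist mkseqS mem_histories_rcons => /andP[_ vh].
by rewrite Sum_rcons// [X in cabs X]addrC addKr Normc.normcM cabs_phase mulr1 cabs_alpha_le.
Qed.

Lemma cabs_Sbar_le n (u : R) : (0 < n)%N -> cabs (Sbar n u) <= 2.
Proof.
move=> n0; rewrite Normc.normcM cabs_real ger0_norm ?invr_ge0//.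
rewrite ler_pdivrMl ?ltr0n//; apply: (le_trans (cabs_Sum_le u (Hh n))).
by rewrite -natrM ler_nat; lia.
Qed.

(** One pick changes the sum by at most 3 and the sum is at most [n + 1]. *)
Lemma Sbar_diff n k (u : R) : (0 < n)%N -> (n <= k)%N ->
  cabs (Sbar k u - Sbar n u) <= 5 * ((k - n)%:R / n%:R).
Proof.
move=> n0 nk; have k0 : (0 < k)%N by exact: leq_trans nk.
have kn : (k%:R : R)^-1 <= n%:R^-1 by rewrite lef_pV2 ?posrE ?ltr0n// ler_nat.
have -> : Sbar k u - Sbar n u = (k%:R^-1)%:C * (Sum (H k) u - Sum (H n) u)
   - (n%:R^-1 - k%:R^-1)%:C * Sum (H n) u.
  by rewrite /Sbar rmorphB/=; ring.
apply: (le_trans (cabsB _ _)); rewrite !Normc.normcM !cabs_real !ger0_norm ?subr_ge0 ?invr_ge0//.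
rewrite (_ : 5 = 3 + 2 :> R); last by ring.
rewrite [leRHS]mulrDl; apply: lerD.
  rewrite mulrA [leRHS]mulrC; apply: ler_pM; rewrite ?invr_ge0 ?cabs_ge0//.
  exact: cabs_Sum_diff.
have -> : (n%:R^-1 - k%:R^-1) = (k - n)%:R / n%:R * k%:R^-1 :> R.
  by rewrite natrB//; field; rewrite !pnatr_eq0 -!lt0n k0.
rewrite -[leLHS]mulrA [leRHS]mulrC ler_wpM2l ?mulr_ge0 ?invr_ge0//.
rewrite ler_pdivrMl ?ltr0n//; apply: (le_trans (cabs_Sum_le u (Hh n))).
by rewrite -natrM ler_nat; lia.
Qed.

Lemma Sbar_Wh n (u : R) : (0 < n)%N ->
  Sbar n u = cexp ((lam n)%:C * (cexp (iu u) - 1)) * Wh n (H n) u.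
Proof.
move=> n0; rewrite /Sbar /Wh mulrA -cexpD; congr (_ * _).
rewrite -[n%:R in LHS]lnK ?posrE ?ltr0n// -expRN -cexp_real; congr cexp.
by rewrite /alpha /lam rmorphM rmorphN/= (rmorph_nat (real_complex R) 2); ring.
Qed.

(** Inside a block, [Wh] is kept at the beginning [n] of the block while the
    Poisson transform is taken at the actual time [k]. *)
Lemma Sbar_Wh_shift n k (u X : R) : (0 < n)%N -> (n <= k)%N -> (k - n)%:R / n%:R <= X ->
  cabs (Sbar k u - cexp ((lam k)%:C * (cexp (iu u) - 1)) * Wh n (H n) u) <=
  (5 + 8 * expR (4 * X)) * X.
Proof.
move=> n0 nk xX; have k0 : (0 < k)%N by exact: leq_trans nk.
set x := _ / _ in xX.
have x0 : 0 <= x by rewrite mulr_ge0// invr_ge0.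
set z := cexp (iu u) - 1.
have z2 : cabs z <= 2.
  apply: (le_trans (cabsB _ _)); rewrite cabs_cexp Normc.normc1 /= expR0; lra.
set y := (lam k - lam n)%:C * z.
have y4 : cabs y <= 4 * X.
  rewrite Normc.normcM cabs_real (_ : 4 * X = (2 * X) * 2); last by ring.
  apply: ler_pM; rewrite ?cabs_ge0// ger0_norm ?subr_ge0; last first.
    by rewrite ler_wpM2l// ler_ln ?posrE ?ltr0n// ler_nat.
  rewrite -mulrBr ler_wpM2l// (le_trans _ xX)// -ln_div ?posrE ?ltr0n//.
  have -> : k%:R / n%:R = 1 + x.
    by rewrite /x natrB//; field; rewrite pnatr_eq0 -lt0n.
  by apply: le_ln1Dx; rewrite (lt_le_trans _ x0)// ltrN10.
have -> : Sbar k u - cexp ((lam k)%:C * z) * Wh n (H n) u =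
   (Sbar k u - Sbar n u) - (cexp y - 1) * Sbar n u.
  rewrite [in RHS](Sbar_Wh u n0) -/z.
  have -> : (lam k)%:C * z = y + (lam n)%:C * z by rewrite /y rmorphB/=; ring.
  by rewrite cexpD; ring.
rewrite [leRHS]mulrDl; apply: (le_trans (cabsB _ _)); apply: lerD.
  by apply: (le_trans (Sbar_diff u n0 nk)); rewrite ler_wpM2l.
rewrite Normc.normcM (_ : 8 * expR (4 * X) * X = (4 * X * expR (4 * X)) * 2); last by ring.
apply: ler_pM; rewrite ?cabs_ge0 ?cabs_Sbar_le//.
have := cexp_taylor 1 y; rewrite big_ord1 expr0 fact0 divr1 expr1 => h.
apply: (le_trans h); apply: ler_pM; rewrite ?cabs_ge0 ?expR_ge0//.
by rewrite ler_expR.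
Qed.

Lemma pow_1D_le q (t : R) : 0 <= t <= 1 -> (1 + t) ^+ q <= 1 + (2 ^+ q - 1) * t.
Proof.
move=> /andP[t0 t1]; elim: q => [|q IH]; first by rewrite !expr0 subrr mul0r addr0.
rewrite !exprS.
have h : (1 + t) * (1 + t) ^+ q <= (1 + t) * (1 + (2 ^+ q - 1) * t).
  by rewrite ler_wpM2l// addr_ge0.
apply: (le_trans h); have p1 : 1 <= 2 ^+ q :> R by rewrite exprn_ege1// ler1n.
have : (2 ^+ q - 1) * t * t <= (2 ^+ q - 1) * t * 1.
  by rewrite ler_wpM2l// mulr_ge0// subr_ge0.
move: (2 ^+ q : R) p1 => Q p1; lra.
Qed.

Lemma block_ratio q m n : (block q m <= n)%N -> (n < block q m.+1)%N ->
  (n - block q m)%:R / (block q m)%:R <= 2 ^+ q / m.+1%:R :> R.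
Proof.
move=> mn nm.
have b0 : (0 : R) < (block q m)%:R by rewrite ltr0n block_gt0.
rewrite natrB// mulrBl divff ?gt_eqF//.
apply: (@le_trans _ _ ((1 + m.+1%:R^-1) ^+ q - 1)).
  rewrite lerD2r ler_pdivrMr// /block natrX -exprMn mulrDl mul1r mulVf ?pnatr_eq0// natr1.
  by rewrite -natrX ler_nat ltnW.
have := @pow_1D_le q (m.+1%:R^-1); rewrite invr_ge0 ler0n invf_le1 ?ltr0n// ler1n => /(_ isT) h.
move: h; set x := m.+1%:R^-1; set Q := 2 ^+ q; set Y := (1 + x) ^+ q.
have x0 : 0 <= x by rewrite invr_ge0.
clearbody x Q Y; lra.
Qed.

Lemma block_exists q n : (0 < q)%N -> (0 < n)%N ->
  exists m, (block q m <= n)%N /\ (n < block q m.+1)%N.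
Proof.
move=> q0 n0.
have ex1 : exists m, (n < block q m.+1)%N.
  by exists n; rewrite (ltn_trans (lt_block n q0))// /block ltn_exp2r.
case: (ex_minnP ex1) => m hm mmin; exists m; split => //.
case: m hm mmin => [|m] hm mmin; first by rewrite /block exp1n.
rewrite leqNgt; apply/negP => /mmin; by rewrite ltnn.
Qed.

Lemma block_rate q m n : (0 < q)%N -> (0 < m)%N -> (0 < n)%N -> (n < block q m.+1)%N ->
  (m%:R : R)^-1 <= 3 * expR (- ((2 * q%:R)^-1 * lam n)).
Proof.
move=> q0 m0 n0 nm.
apply: (@le_trans _ _ (3 * (m.+2%:R)^-1)).
  rewrite -[3]invrK -invfM lef_pV2 ?posrE ?mulr_gt0 ?invr_gt0 ?ltr0n//.
  by rewrite ler_pdivrMl// -natrM ler_nat; lia.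
rewrite ler_wpM2l// expRN lef_pV2 ?posrE ?expR_gt0 ?ltr0n//.
rewrite -[leRHS]lnK ?posrE ?ltr0n// ler_expR.
rewrite /lam invfM mulrACA mulVf ?pnatr_eq0// mul1r ler_pdivrMl ?ltr0n//.
rewrite mulr_natl -lnXn ?ltr0n// ler_ln ?posrE ?exprn_gt0 ?ltr0n//.
by rewrite -natrX ler_nat ltnW.
Qed.

Local Notation W m := (Wh m (H m)).

Lemma cabs_char_le1 n (u : R) : cabs (cexp ((lam n)%:C * (cexp (iu u) - 1))) <= 1.
Proof.
rewrite cabs_poisson_char -[leRHS]expR0 ler_expR oppr_le0 mulr_ge0//.
  case: n => [|n]; first by rewrite /lam ln0// mulr0.
  by rewrite mulr_ge0// ln_ge0// ler1n.
Qed.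

Lemma inner_telescope q M m m' (d0 : R) : (M <= m)%N -> (m <= m')%N ->
  (forall j, (M <= j)%N ->
    Int (- d0) d0 (fun u => cabs (W (block q j.+1) u - W (block q j) u)) <= (j.+1%:R)^-1 ^+ 2) ->
  Int (- d0) d0 (fun u => cabs (W (block q m') u - W (block q m) u)) <=
  \sum_(m <= j < m') (j.+1%:R)^-1 ^+ 2.
Proof.
move=> Mm mm' H1; rewrite -(subnKC mm'); elim: (m' - m)%N => [|j IH].
  rewrite addn0 big_geq//; under eq_Int do rewrite subrr Normc.normc0 -[0](mul0r 0).
  by rewrite (IntZ _ _ 0 (@cont_cst _ 0)) mul0r.
rewrite addnS big_nat_recr ?leq_addr//=.
have cW a b : continuous (fun u : R => cabs (W a u - W b u)).
  by apply: cont_cabs; apply: ccont_sub; exact: ccont_Wh.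
apply: (@le_trans _ _ (Int (- d0) d0 (fun u =>
   cabs (W (block q (m + j)) u - W (block q m) u) +
   cabs (W (block q (m + j).+1) u - W (block q (m + j)) u)))).
  apply: Int_le => [||u _]; [exact: cW|by apply: cont_add; exact: cW|].
  by rewrite [leRHS]addrC; exact: cabs_dist_triangle.
rewrite IntD; [|exact: cW|exact: cW].
by apply: lerD => //; apply: H1; rewrite (leq_trans Mm)// leq_addr.
Qed.

(** The increments of [Wh] over later blocks sum to [O(1 / m)], and so does the
    change inside the block of [n]; [m] is about [n^(1/q)].  The time [m'] is
    left free so that it can tend to infinity. *)
Lemma path_inner q (d0 : R) : (0 < q)%N -> 0 < d0 ->
  (exists M, forall j, (M <= j)%N ->
    Int (- d0) d0 (fun u => cabs (W (block q j.+1) u - W (block q j) u)) <= (j.+1%:R)^-1 ^+ 2) ->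
  exists (C c : R) (N0 : nat), [/\ 0 <= C, 0 < c & forall n, (N0 <= n)%N -> exists m0, forall m', (m0 <= m')%N ->
    Int (- d0) d0 (fun u => cabs (Sbar n u -
      cexp ((lam n)%:C * (cexp (iu u) - 1)) * W (block q m') u)) <= C * expR (- (c * lam n))].
Proof.
move=> q0 d00 [M HM].
pose Q : R := 2 ^+ q; pose K := (5 + 8 * expR (4 * Q)) * Q.
have Q0 : 0 < Q by rewrite exprn_gt0.
have K0 : 0 <= K by rewrite mulr_ge0 ?(ltW Q0)// addr_ge0// mulr_ge0// expR_ge0.
exists ((K * (d0 - - d0) + 1) * 3), ((2 * q%:R)^-1), (block q M.+1); split.
- by rewrite mulr_ge0// addr_ge0// mulr_ge0//; lra.
- by rewrite invr_gt0 mulr_gt0 ?ltr0n.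
move=> n nM; have n0 : (0 < n)%N by rewrite (leq_trans _ nM)// block_gt0.
have [m [mn nm]] := block_exists q0 n0.
have Mm : (M < m)%N.
  by rewrite ltnNge; apply/negP => mM; move: nm; rewrite ltnNge (leq_trans _ nM)// block_le.
have m0 : (0 < m)%N by exact: leq_ltn_trans Mm.
exists m => m' mm'.
have cW a b : continuous (fun u : R => cabs (W a u - W b u)).
  by apply: cont_cabs; apply: ccont_sub; exact: ccont_Wh.
have cz : ccont (fun u : R => cexp ((lam n)%:C * (cexp (iu u) - 1))).
  apply: ccont_cexp; apply: ccont_mul; first exact: ccont_cst.
  by apply: ccont_sub; [apply: ccont_cexp; exact: ccont_iu|exact: ccont_cst].
apply: (@le_trans _ _ (Int (- d0) d0 (fun u =>
   K / m%:R + cabs (W (block q m') u - W (block q m) u)))).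
  apply: Int_le => [||u _].
  - by apply: cont_cabs; apply: ccont_sub; [exact: ccont_Sbar|apply: ccont_mul => //; exact: ccont_Wh].
  - by apply: cont_add; [exact: cont_cst|exact: cW].
  set e := cexp _.
  have -> : Sbar n u - e * W (block q m') u = (Sbar n u - e * W (block q m) u) -
     e * (W (block q m') u - W (block q m) u) by ring.
  apply: (le_trans (cabsB _ _)); apply: lerD; last first.
    by rewrite Normc.normcM -[leRHS]mul1r ler_wpM2r ?cabs_ge0// cabs_char_le1.
  apply: (le_trans (Sbar_Wh_shift u (block_gt0 q m) mn (block_ratio mn nm))).
  have m1 : m.+1%:R^-1 <= m%:R^-1 :> R by rewrite lef_pV2 ?posrE ?ltr0n// ler_nat.
  have m2 : m.+1%:R^-1 <= 1 :> R by rewrite invf_le1 ?ltr0n// ler1n.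
  rewrite /K -/Q -[leRHS]mulrA; apply: ler_pM.
  - by rewrite addr_ge0// mulr_ge0// expR_ge0.
  - by rewrite mulr_ge0 ?invr_ge0// ltW.
  - rewrite lerD2l ler_wpM2l// ler_expR ler_wpM2l//.
    by rewrite -[leRHS]mulr1 ler_wpM2l// ltW.
  - by rewrite ler_wpM2l// ltW.
rewrite IntD; [|exact: cont_cst|exact: cW].
rewrite Int_cst; last lra.
apply: (@le_trans _ _ ((K * (d0 - - d0) + 1) * m%:R^-1)).
  rewrite mulrDl mul1r mulrAC lerD2l.
  apply: (le_trans (inner_telescope (ltnW Mm) mm' HM)).
  apply: (le_trans (sum_inv_sqr_le _ m0 mm')).
  by rewrite gerBl invr_ge0.
rewrite -mulrA ler_wpM2l//; last exact: block_rate.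
by rewrite addr_ge0// mulr_ge0//; lra.
Qed.

Lemma path_outer q (a b : R) : (0 < q)%N -> a <= b ->
  (exists M, forall m, (M <= m)%N ->
    Int a b (fun u => cabs (Sum (H (block q m.+1)) u) / (block q m.+1)%:R) <= (m.+1%:R)^-1 ^+ 2) ->
  exists (C c : R) (N0 : nat), [/\ 0 <= C, 0 < c & forall n, (N0 <= n)%N ->
    Int a b (fun u => cabs (Sbar n u)) <= C * expR (- (c * lam n))].
Proof.
move=> q0 ab [M HM].
pose Q : R := 2 ^+ q.
have Q0 : 0 < Q by rewrite exprn_gt0.
have C0 : 0 <= 5 * Q * (b - a) + 1.
  by rewrite addr_ge0// mulr_ge0 ?subr_ge0// mulr_ge0// ltW.
exists ((5 * Q * (b - a) + 1) * 3), ((2 * q%:R)^-1), (block q M.+1); split.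
- by rewrite mulr_ge0.
- by rewrite invr_gt0 mulr_gt0 ?ltr0n.
move=> n nM; have n0 : (0 < n)%N by rewrite (leq_trans _ nM)// block_gt0.
have [m [mn nm]] := block_exists q0 n0.
have Mm : (M < m)%N.
  by rewrite ltnNge; apply/negP => mM; move: nm; rewrite ltnNge (leq_trans _ nM)// block_le.
have m0 : (0 < m)%N by exact: leq_ltn_trans Mm.
have cS k : continuous (fun u : R => cabs (Sbar k u)) by apply: cont_cabs; exact: ccont_Sbar.
apply: (@le_trans _ _ (Int a b (fun u => 5 * Q / m%:R + cabs (Sbar (block q m) u)))).
  apply: Int_le => [||u _]; [exact: cS|by apply: cont_add; [exact: cont_cst|exact: cS]|].
  rewrite -lerBlDr; apply: (le_trans (cabs_le_dist _ _)).
  apply: (le_trans (Sbar_diff u (block_gt0 q m) mn)).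
  rewrite -mulrA ler_wpM2l//; apply: (le_trans (block_ratio mn nm)).
  rewrite ler_wpM2l ?(ltW Q0)// lef_pV2 ?posrE ?ltr0n// ler_nat//.
rewrite IntD; [|exact: cont_cst|exact: cS].
rewrite Int_cst//.
apply: (@le_trans _ _ ((5 * Q * (b - a) + 1) * m%:R^-1)); last first.
  by rewrite -[leRHS]mulrA ler_wpM2l//; exact: block_rate.
rewrite [leRHS]mulrDl mul1r mulrAC lerD2l.
case: m m0 Mm {mn nm} => // m _; rewrite ltnS => Mm.
under eq_Int do rewrite /Sbar Normc.normcM cabs_real ger0_norm ?invr_ge0// mulrC.
apply: (le_trans (HM m Mm)).
by rewrite expr2 -[leRHS]mulr1 ler_wpM2l ?invr_ge0// invf_le1 ?ltr0n// ler1n.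
Qed.

End PathBounds.

(** * Fourier inversion *)

Section FourierInversion.
Context {R : realType}.
Implicit Types (u y a b : R).

Lemma sin_nat_pi n : sin (n%:R * pi : R) = 0.
Proof.
elim: n => [|n IH]; first by rewrite mul0r sin0.
by rewrite -natr1 mulrDl mul1r sinDpi IH oppr0.
Qed.

Lemma sin_int_pi (z : int) : sin (z%:~R * pi : R) = 0.
Proof.
case: z => n; first exact: sin_nat_pi.
by rewrite NegzE mulrNz mulNr sinN sin_nat_pi oppr0.
Qed.

Lemma cont_linear a : continuous (fun u : R => u * a).
Proof. by apply: cont_mul; [exact: cont_id|exact: cont_cst]. Qed.

Lemma Int_cos_int (z : int) :
  Int (- pi) pi (fun u => cos (u * z%:~R)) = 2 * pi * (z == 0)%:R :> R.
Proof.
have pipi : - pi <= pi :> R by have := pi_ge0 R; lra.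
have [->|z0] := eqVneq z 0.
  under eq_Int do rewrite mulr0 cos0.
  by rewrite Int_cst// mulr1; ring.
have zR0 : z%:~R != 0 :> R by rewrite intr_eq0.
have cc : continuous (fun u : R => cos (u * z%:~R)).
  by apply: cont_compose; [exact: continuous_cos|exact: cont_linear].
have D (u : R) : is_derive u 1 (fun u => z%:~R^-1 * sin (z%:~R * u)) (cos (u * z%:~R)).
  apply: is_derive_eqfun (is_derive_funZ z%:~R^-1 (is_derive_fun_sin (is_derive_linear u z%:~R))) => //.
  by rewrite mulKf// mulrC.
by rewrite (Int_FTC pipi cc D) mulrN sinN sin_int_pi oppr0 !mulr0 subrr.
Qed.

Definition rot u (x : R) : R[i] := cexp (iu (- (u * x))).

Lemma ccont_rot (x : R) : ccont (fun u => rot u x).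
Proof.
apply: ccont_cexp; split; first exact: cont_cst.
by apply: cont_opp; exact: cont_linear.
Qed.

Lemma cabs_rot u x : cabs (rot u x) = 1.
Proof. by rewrite cabs_cexp /= expR0. Qed.

Lemma cont_Re f : ccont f -> continuous (fun u : R => complex.Re (f u) : R).
Proof. by case. Qed.

(** Orthogonality of the characters [e^{iku}] on [-pi, pi]. *)
Lemma profile_inversion (s : seq node) (k : int) :
  Int (- pi) pi (fun u => complex.Re ((\sum_(v <- s) phase v u) * rot u k%:~R)) =
  2 * pi * (count (fun v : node => (size v)%:Z == k) s)%:R :> R.
Proof.
have E u : complex.Re ((\sum_(v <- s) phase v u) * rot u k%:~R) =
    \sum_(v <- s) cos (u * ((size v)%:Z - k)%:~R) :> R.
  rewrite mulr_suml Re_sum; apply: eq_bigr => v _.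
  have -> : phase v u * rot u k%:~R = cexp (iu (u * ((size v)%:Z - k)%:~R)).
    rewrite /phase /rot -cexpD; congr cexp; rewrite -(rmorph_nat (real_complex R)).
    by apply: eq_ReIm => /=; rewrite ?rmorphB/=; ring.
  by rewrite cexp_iu.
under eq_Int do rewrite E.
rewrite Int_sum; last first.
  by move=> v; apply: cont_compose; [exact: continuous_cos|exact: cont_linear].
under eq_bigr do rewrite Int_cos_int subr_eq0.
rewrite -mulr_sumr; congr (_ * _).
by rewrite -sum1_count natr_sum [in RHS]big_mkcond/=; apply: eq_bigr => v _; case: eqP.
Qed.

Lemma iu_polar u : iu u = u%:C * cexp (iu (pi / 2)).
Proof. by rewrite cexp_iu cos_pihalf sin_pihalf; apply: eq_ReIm => /=; ring. Qed.

Lemma cexp_iuM n u : cexp (iu u) ^+ n = cexp (iu (n%:R * u)).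
Proof.
elim: n => [|n IH]; first by rewrite expr0 mul0r (_ : iu 0 = 0) ?cexp0.
by rewrite exprS IH -cexpD; congr cexp; apply: eq_ReIm => /=; rewrite -?natr1; ring.
Qed.

Lemma Re_wave m y u : complex.Re (iu u ^+ m * rot u y) = wave m y u.
Proof.
have -> : iu u ^+ m = (u ^+ m)%:C * cexp (iu (m%:R * (pi / 2))).
  by rewrite iu_polar exprMn cexp_iuM rmorphXn.
rewrite -mulrA -cexpD Re_realM.
rewrite (_ : iu _ + iu _ = iu (m%:R * (pi / 2) - u * y)); last by apply: eq_ReIm => /=; ring.
by rewrite cexp_iu.
Qed.

End FourierInversion.

Section EdgeworthSum.
Context {R : realType}.
Implicit Types (u y a b l : R).
Variables (w : nat -> R) (r : nat).

(** The Gaussian approximation of the transform, with its corrections. *)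
Definition edge_char l u : R[i] :=
  cexp (l%:C * iu u) * ((gaussf l u)%:C * edge_poly w r l u).

(** The real part of the integral of [edge_char l u e^{-iux}] over the line. *)
Definition edge_density l x : R :=
  \sum_(j < r.+1) \sum_(m < j.+1) kappa w j m * l ^+ m * gauss_fourier l (j + 2 * m) (x - l).

Lemma ccont_edge_char l : ccont (edge_char l).
Proof.
apply: ccont_mul.
  apply: ccont_cexp; apply: ccont_mul; [exact: ccont_cst|exact: ccont_iu].
apply: ccont_mul; first by apply: ccont_real; exact: cont_gaussf.
apply: ccont_sum => j; apply: ccont_sum => m.
by apply: ccont_mul; [exact: ccont_cst|apply: ccont_pow; exact: ccont_iu].
Qed.

Lemma Re_edge_char l u x : complex.Re (edge_char l u * rot u x) =
  \sum_(j < r.+1) \sum_(m < j.+1) kappa w j m * l ^+ m * (wave (j + 2 * m) (x - l) u * gaussf l u).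
Proof.
have -> : edge_char l u * rot u x = \sum_(j < r.+1) \sum_(m < j.+1)
   (kappa w j m * l ^+ m * gaussf l u)%:C * (iu u ^+ (j + 2 * m) * rot u (x - l)).
  have -> : edge_char l u * rot u x = ((gaussf l u)%:C * rot u (x - l)) * edge_poly w r l u.
    have -> : rot u (x - l) = cexp (l%:C * iu u) * rot u x.
      by rewrite /rot -cexpD; congr cexp; apply: eq_ReIm => /=; ring.
    by rewrite /edge_char; ring.
  rewrite mulr_sumr; apply: eq_bigr => j _; rewrite mulr_sumr; apply: eq_bigr => m _.
  by rewrite [in RHS]rmorphM/=; ring.
rewrite Re_sum; apply: eq_bigr => j _; rewrite Re_sum; apply: eq_bigr => m _.
by rewrite Re_realM Re_wave; ring.
Qed.

Lemma Int_edge_char l a x : Int (- a) a (fun u => complex.Re (edge_char l u * rot u x)) =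
  \sum_(j < r.+1) \sum_(m < j.+1) kappa w j m * l ^+ m * J l (j + 2 * m) a (x - l).
Proof.
have cw m : continuous (fun u : R => wave m (x - l) u * gaussf l u).
  by apply: cont_mul; [exact: cont_wave|exact: cont_gaussf].
have cc j m : continuous (fun u : R => kappa w j m * l ^+ m * (wave (j + 2 * m) (x - l) u * gaussf l u)).
  by apply: cont_mul; [exact: cont_cst|exact: cw].
under eq_Int do rewrite Re_edge_char.
rewrite Int_sum; last by move=> j; apply: cont_sum => m; exact: cc.
apply: eq_bigr => j _; rewrite Int_sum; last by move=> m; exact: cc.
by apply: eq_bigr => m _; rewrite IntZ.
Qed.

Lemma edge_density_lim l x : 0 < l ->
  Int (- n%:R) n%:R (fun u => complex.Re (edge_char l u * rot u x)) @[n --> \oo] --> edge_density l x.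
Proof.
move=> l0; apply: (cvg_seq_ext (f := fun n => \sum_(j < r.+1) \sum_(m < j.+1)
   kappa w j m * l ^+ m * J l (j + 2 * m) n%:R (x - l))).
  by move=> n; rewrite Int_edge_char.
have cs N (F : 'I_N -> nat -> R) (L : 'I_N -> R) :
    (forall i, F i n @[n --> \oo] --> L i) -> (\sum_(i < N) F i n) @[n --> \oo] --> \sum_(i < N) L i.
  move=> h; elim: N F L h => [|N IH] F L h.
    by under eq_fun do rewrite big_ord0; rewrite big_ord0; exact: cvg_cst.
  by under eq_fun do rewrite big_ord_recr; rewrite big_ord_recr; apply: cvgD; [exact: IH|exact: h].
apply: (cs _ _ _) => j; apply: (cs _ _ _) => m; apply: cvg_seq_scale; exact: J_cvg.
Qed.

(** The integral over the line is a limit of integrals over segments; outside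
    [-d0, d0] part of the Gaussian exponent provides the exponential factor. *)
Lemma edge_char_tail (d0 : R) : 0 < d0 -> exists C : R, 0 <= C /\ forall l x, 1 <= l ->
  `|edge_density l x - Int (- d0) d0 (fun u => complex.Re (edge_char l u * rot u x))| <=
  C * expR (- (d0 ^+ 2 / 8 * l)).
Proof.
move=> d00; have [C [C0 H]] := edge_poly_le w r.
exists (C * Num.sqrt (8 * pi)); split; first by rewrite mulr_ge0 ?sqrtr_ge0.
move=> l x l1; have l0 : 0 < l by rewrite (lt_le_trans _ l1).
set f := fun u => complex.Re (edge_char l u * rot u x).
have cf : continuous f.
  by apply: cont_Re; apply: ccont_mul; [exact: ccont_edge_char|exact: ccont_rot].
have cg : continuous (fun u : R => C * expR (- (d0 ^+ 2 / 8 * l)) * gaussf (l / 4) u).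
  by apply: cont_mul; [exact: cont_cst|exact: cont_gaussf].
have fg u : d0 <= `|u| -> `|f u| <= C * expR (- (d0 ^+ 2 / 8 * l)) * gaussf (l / 4) u.
  move=> du; apply: (le_trans (Re_le_cabs _)).
  rewrite Normc.normcM cabs_rot mulr1 Normc.normcM cabs_cexp Re_realM /= mulr0 expR0 mul1r.
  apply: (le_trans (H l u l1)); rewrite -mulrA ler_wpM2l// /gaussf -expRD ler_expR.
  have : d0 ^+ 2 <= u ^+ 2.
    by rewrite -(real_normK (num_real u)) lerXn2r ?nnegrE// ltW.
  move=> /(ler_wpM2l (ltW l0)); lra.
have key n : d0 <= n%:R ->
    `|Int (- n%:R) n%:R f - Int (- d0) d0 f| <= C * Num.sqrt (8 * pi) * expR (- (d0 ^+ 2 / 8 * l)).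
  move=> dn.
  rewrite (@Int_split _ (- n%:R) n%:R (- d0))//; [|lra|lra].
  rewrite (@Int_split _ (- d0) n%:R d0)//; [|lra].
  have -> (A B D : R) : A + (B + D) - B = A + D by ring.
  apply: (le_trans (ler_normD _ _)).
  have cn : continuous (fun u => `|f u|) by exact: cont_normr.
  have g0 u : 0 <= C * expR (- (d0 ^+ 2 / 8 * l)) * gaussf (l / 4) u.
    by rewrite mulr_ge0 ?gaussf_ge0// mulr_ge0// expR_ge0.
  apply: (@le_trans _ _ (Int (- n%:R) n%:R (fun u => C * expR (- (d0 ^+ 2 / 8 * l)) * gaussf (l / 4) u))).
    rewrite [leRHS](@Int_split _ (- n%:R) n%:R (- d0))//; [|lra|lra].
    rewrite [X in _ <= _ + X](@Int_split _ (- d0) n%:R d0)//; [|lra].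
    rewrite addrCA -[leLHS]add0r; apply: lerD; first exact: Int_ge0.
    apply: lerD.
      apply: (le_trans (Int_norm_le _ _ cf)); apply: Int_le => // u /andP[_ u2]; apply: fg.
      by rewrite ler0_norm; lra.
    apply: (le_trans (Int_norm_le _ _ cf)); apply: Int_le => // u /andP[u1 _]; apply: fg.
    by rewrite ger0_norm; lra.
  rewrite IntZ; last exact: cont_gaussf.
  rewrite [leRHS]mulrAC ler_wpM2l ?mulr_ge0 ?expR_ge0//.
  have l4 : 0 < l / 4 by rewrite divr_gt0.
  apply: (le_trans (Int_gaussf_le l4 (ler0n _ _))); apply: ler_wsqrtr.
  rewrite ler_pdivrMr//; have := pi_ge0 R => p0.
  have := ler_wpM2l p0 l1; lra.
have lim := edge_density_lim l0 (x := x); rewrite -/f in lim.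
have lim2 : `|Int (- n%:R) n%:R f - Int (- d0) d0 f| @[n --> \oo] --> `|edge_density l x - Int (- d0) d0 f|.
  by apply: cvg_norm; apply: cvgB => //; exact: cvg_cst.
(* The bound on segments of half-length [n] is uniform in [n]. *)
rewrite -(cvg_lim _ lim2)//; apply: limr_le; first by apply: cvgP lim2.
near=> n; apply: key.
by near: n; exact: nbhs_infty_ger.
Unshelve. all: by end_near.
Qed.

End EdgeworthSum.

(** * The profile along one realization *)

Lemma lam_ge1 (R : realType) : exists N, forall n, (N <= n)%N -> 1 <= lam n :> R.
Proof.
exists (Num.bound (expR 1 : R)) => n nN.
have e : expR 1 <= n%:R :> R.
  by apply: (le_trans (ltW (archi_boundP (expR_ge0 1)))); rewrite ler_nat.
have n0 : 0 < n%:R :> R by rewrite (lt_le_trans _ e)// expR_gt0.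
have : 1 <= ln (n%:R : R) by rewrite -[leLHS](expRK 1) ler_ln ?posrE ?expR_gt0.
rewrite /lam; lra.
Qed.

Section PathEdgeworth.
Context {R : realType} {d : measure_display} {T : measurableType d}.
Context {V : nat -> T -> node} {w : T}.
Local Notation H n := (hist (V := V) n w).
Local Notation W m := (Wh m (H m)).
Variables (rho : R) (a : nat -> R[i]) (F : R[i] -> R[i]) (d0 : R) (q r : nat).
Hypothesis Hh : forall n, H n \in histories n.
Hypotheses (rho0 : 0 < rho) (aF : is_power_series rho a F) (areal : forall j, complex.Im (a j) = 0).
Hypotheses (q0 : (0 < q)%N) (d0pi : 0 < d0 <= pi).
Hypothesis unifW : forall e : R, 0 < e -> exists N, forall n, (N <= n)%N ->
  forall u, `|u| <= d0 -> cabs (W n u - F (iu u)) <= e.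
Hypothesis inner : exists M, forall j, (M <= j)%N ->
  Int (- d0) d0 (fun u => cabs (W (block q j.+1) u - W (block q j) u)) <= (j.+1%:R)^-1 ^+ 2.
Hypothesis outer_left : exists M, forall j, (M <= j)%N ->
  Int (- pi) (- d0) (fun u => cabs (Sum (H (block q j.+1)) u) / (block q j.+1)%:R) <= (j.+1%:R)^-1 ^+ 2.
Hypothesis outer_right : exists M, forall j, (M <= j)%N ->
  Int d0 pi (fun u => cabs (Sum (H (block q j.+1)) u) / (block q j.+1)%:R) <= (j.+1%:R)^-1 ^+ 2.
Local Notation wt := (fun k => complex.Re (a k)).

Let S n := @Sbar R d T V w n.

(** A single [W n] within distance 1 of [F] is bounded by the number of
    nodes. *)
Lemma limit_bounded : exists B, forall u, `|u| <= d0 -> cabs (F (iu u)) <= B.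
Proof.
have [N /(_ N (leqnn N)) hN] := unifW ltr01.
exists (expR (3 * `|ln (N%:R : R)|) * N.+1%:R + 1) => u ud.
have h := hN u ud; rewrite cabs_distC in h.
have t := cabs_le_dist (F (iu u)) (W N u).
have hW : cabs (W N u) <= expR (3 * `|ln (N%:R : R)|) * N.+1%:R.
  rewrite Normc.normcM; apply: ler_pM; rewrite ?cabs_ge0//; last exact: cabs_Sum_le.
  rewrite cabs_cexp ler_expR.
  apply: (le_trans (ler_norm _)); apply: (le_trans (Re_le_cabs _)).
  by rewrite Normc.normcM normcN cabs_real ler_wpM2r// cabs_alpha_le.
move: h t hW; set X := expR _ * _; clearbody X; lra.
Qed.

(** The transform is compared with [W (block q m')] in the integral, the latter
    with the limit [F] uniformly, and finally the Poisson transform with its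
    Edgeworth expansion. *)
Lemma inner_compare : exists (C : R) (N0 : nat), 0 <= C /\ forall n, (N0 <= n)%N -> 1 <= lam n :> R ->
  Int (- d0) d0 (fun u => cabs (S n u - edge_char wt r (lam n) u)) <= C * (Num.sqrt (lam n))^-1 ^+ r.+2.
Proof.
have /andP[d00 dpi] := d0pi.
have [B HB] := limit_bounded.
have [C1 [C10 H1]] := edge_segment r rho0 aF areal d0pi HB.
have [C2 [c [N0 [C20 c0 H2]]]] := path_inner Hh q0 d00 inner.
have [C3 [C30 H3]] := exp_decay_le r.+2 c0.
have dd : - d0 <= d0 by lra.
exists (C2 * C3 + (1 * (d0 - - d0) + C1 * (Num.sqrt (8 * pi) + (d0 - - d0)))), N0; split.
  have : 0 <= d0 - - d0 by lra.
  by move=> p; rewrite addr_ge0 ?mulr_ge0// addr_ge0 ?mulr_ge0// addr_ge0 ?sqrtr_ge0.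
move=> n nN; set l := lam n => l1; have l0 : 0 < l by rewrite (lt_le_trans _ l1).
have s0 : 0 < Num.sqrt l by rewrite sqrtr_gt0.
set s := (Num.sqrt l)^-1; have sp0 : 0 < s by rewrite invr_gt0.
(* The accuracy asked of the uniform convergence depends on [n], and so does [m']. *)
have [N1 HN1] := unifW (exprn_gt0 r.+2 sp0).
have [m0 Hm0] := H2 n nN.
pose m' := maxn m0 N1; have := Hm0 m' (leq_maxl _ _); rewrite -/l.
set e := fun u => cexp (l%:C * (cexp (iu u) - 1)).
have ce : ccont e.
  apply: ccont_cexp; apply: ccont_mul; first exact: ccont_cst.
  by apply: ccont_sub; [apply: ccont_cexp; exact: ccont_iu|exact: ccont_cst].
set f1 := (fun u => cabs (Sbar n u - _)) => hf1.
have cf1 : continuous f1.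
  by apply: cont_cabs; apply: ccont_sub; [exact: ccont_Sbar|apply: ccont_mul => //; exact: ccont_Wh].
have cg : continuous (fun u : R => C1 * (s ^+ r.+1 * gaussf (l / 4) u + s ^+ r.+2)).
  apply: cont_mul; first exact: cont_cst.
  apply: cont_add; last exact: cont_cst.
  by apply: cont_mul; [exact: cont_cst|exact: cont_gaussf].
have cS : continuous (fun u : R => s ^+ r.+2 + C1 * (s ^+ r.+1 * gaussf (l / 4) u + s ^+ r.+2)).
  by apply: cont_add => //; exact: cont_cst.
apply: (@le_trans _ _ (Int (- d0) d0 (fun u => f1 u + (s ^+ r.+2 + C1 * (s ^+ r.+1 * gaussf (l / 4) u + s ^+ r.+2))))).
  apply: Int_le => [||u].
  - by apply: cont_cabs; apply: ccont_sub; [exact: ccont_Sbar|exact: ccont_edge_char].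
  - exact: cont_add.
  rewrite -ler_norml => ud.
  have -> : S n u - edge_char wt r l u = (S n u - e u * W (block q m') u) +
     (e u * (W (block q m') u - F (iu u)) + (e u * F (iu u) - edge_char wt r l u)) by ring.
  apply: (le_trans (le_normcD _ _)); rewrite lerD2l.
  apply: (le_trans (le_normcD _ _)); apply: lerD; last exact: H1.
  rewrite Normc.normcM -[leRHS]mul1r; apply: ler_pM; rewrite ?cabs_ge0//.
    exact: cabs_char_le1.
  apply: HN1 => //; apply: (leq_trans (leq_maxr m0 N1)); apply: ltnW.
  exact: lt_block.
rewrite IntD//.
rewrite mulrDl; apply: lerD.
  by apply: (le_trans hf1); rewrite -[leRHS]mulrA ler_wpM2l// H3.
rewrite IntD//; last exact: cont_cst.
rewrite Int_cst// [leRHS]mulrDl mul1r [_ * (d0 - - d0)]mulrC lerD2l.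
rewrite IntZ; last first.
  by apply: cont_add; [apply: cont_mul; [exact: cont_cst|exact: cont_gaussf]|exact: cont_cst].
rewrite -[leRHS]mulrA ler_wpM2l//.
rewrite IntD; [|by apply: cont_mul; [exact: cont_cst|exact: cont_gaussf]|exact: cont_cst].
rewrite Int_cst// [leRHS]mulrDl [_ * (d0 - - d0)]mulrC lerD2r IntZ; last exact: cont_gaussf.
have l4 : 0 < l / 4 by rewrite divr_gt0.
rewrite [s ^+ r.+2]exprSr [leRHS]mulrCA ler_wpM2l ?exprn_ge0 ?(ltW sp0)//.
apply: (le_trans (Int_gaussf_le l4 (ltW d00))).
rewrite (_ : 2 * pi / (l / 4) = (8 * pi) / l); last by field; rewrite gt_eqF.
by rewrite sqrtrM ?mulr_ge0 ?pi_ge0// sqrtrV// ltW.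
Qed.

(** The modulus of a Fourier coefficient is at most the integral of the modulus
    of the function, which makes the bound uniform in [k]. *)
Lemma path_edgeworth : exists (C : R) (N0 : nat), 0 <= C /\ forall n, (N0 <= n)%N -> forall k : int,
  `|(count (fun v : node => (size v)%:Z == k) (ext_of (H n)))%:R / n%:R -
    edge_density wt r (lam n) k%:~R / (2 * pi)| <= C * (Num.sqrt (lam n))^-1 ^+ r.+2.
Proof.
have /andP[d00 dpi] := d0pi.
have [N1 HN1] := lam_ge1 R.
have [C2 [N2 [C20 H2]]] := inner_compare.
have l1 : - pi <= - d0 by lra.
have [C3 [c3 [N3 [C30 c30 H3]]]] := path_outer Hh q0 l1 outer_left.
have [C4 [c4 [N4 [C40 c40 H4]]]] := path_outer Hh q0 dpi outer_right.
have [C5 [C50 H5]] := edge_char_tail wt r d00.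
have d8 : 0 < d0 ^+ 2 / 8 by rewrite divr_gt0// exprn_gt0.
have [D3 [D30 K3]] := exp_decay_le r.+2 c30.
have [D4 [D40 K4]] := exp_decay_le r.+2 c40.
have [D5 [D50 K5]] := exp_decay_le r.+2 d8.
have pi0 := pi_gt0 R.
exists ((C2 + C3 * D3 + C4 * D4 + C5 * D5) / (2 * pi)), (maxn (maxn N1 N2) (maxn N3 (maxn N4 1))); split.
  by rewrite divr_ge0 ?mulr_ge0 ?(ltW pi0)// !addr_ge0 ?mulr_ge0.
move=> n; rewrite !geq_max => /andP[/andP[n1 n2] /andP[n3 /andP[n4 n0]]] k.
have ll := HN1 n n1; set l := lam n in ll *; set s := (Num.sqrt l)^-1.
have cr : ccont (fun u : R => rot u k%:~R) by exact: ccont_rot.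
have cS : ccont (S n) by exact: ccont_Sbar.
have cE := ccont_edge_char wt r l.
have cSr : continuous (fun u => complex.Re (S n u * rot u k%:~R)).
  by apply: cont_Re; exact: ccont_mul.
have cEr : continuous (fun u => complex.Re (edge_char wt r l u * rot u k%:~R)).
  by apply: cont_Re; exact: ccont_mul.
have inv : 2 * pi * ((count (fun v : node => (size v)%:Z == k) (ext_of (H n)))%:R / n%:R) =
    Int (- pi) pi (fun u => complex.Re (S n u * rot u k%:~R)).
  rewrite mulrA -profile_inversion mulrC -IntZ; last first.
    by apply: cont_Re; apply: ccont_mul => //; exact: ccont_Sum.
  by apply: eq_Int => u; rewrite /S /Sbar -mulrA Re_realM.
rewrite -(ler_pM2l (_ : 0 < 2 * pi)) ?mulr_gt0//.
rewrite -[X in X * `|_|](@gtr0_norm _ (2 * pi)) ?mulr_gt0// -normrM mulrBr inv.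
rewrite [2 * pi * (_ / _)]mulrC divfK ?gt_eqF ?mulr_gt0//.
rewrite (@Int_split _ (- pi) pi (- d0))//; last lra.
rewrite (@Int_split _ (- d0) pi d0)//; last lra.
set IL := Int (- pi) _ _; set IM := Int (- d0) _ _; set IR := Int d0 _ _.
set E := edge_density _ _ _ _; set EM := Int (- d0) d0 (fun u => complex.Re (edge_char wt r l u * rot u k%:~R)).
have bound aa bb (f : R -> R[i]) : ccont f ->
    `|Int aa bb (fun u => complex.Re (f u * rot u k%:~R))| <= Int aa bb (fun u => cabs (f u)).
  move=> cf; have cfr : continuous (fun u => complex.Re (f u * rot u k%:~R)).
    by apply: cont_Re; exact: ccont_mul.
  apply: (le_trans (Int_norm_le _ _ cfr)); apply: Int_le => [||u _].
  - exact: cont_normr.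
  - exact: cont_cabs.
  by apply: (le_trans (Re_le_cabs _)); rewrite Normc.normcM cabs_rot mulr1.
have bL : `|IL| <= C3 * D3 * s ^+ r.+2.
  apply: (le_trans (bound _ _ _ cS)); apply: (le_trans (H3 n n3)).
  by rewrite -mulrA ler_wpM2l// K3.
have bR : `|IR| <= C4 * D4 * s ^+ r.+2.
  apply: (le_trans (bound _ _ _ cS)); apply: (le_trans (H4 n n4)).
  by rewrite -mulrA ler_wpM2l// K4.
have bM : `|IM - EM| <= C2 * s ^+ r.+2.
  rewrite /IM /EM -IntB//.
  have -> : Int (- d0) d0 (fun u => complex.Re (S n u * rot u k%:~R) -
      complex.Re (edge_char wt r l u * rot u k%:~R)) =
    Int (- d0) d0 (fun u => complex.Re ((S n u - edge_char wt r l u) * rot u k%:~R)).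
    by apply: eq_Int => u; rewrite mulrBl ReB.
  by apply: (le_trans (bound _ _ _ (ccont_sub cS cE))); exact: H2.
have bE : `|E - EM| <= C5 * D5 * s ^+ r.+2.
  by apply: (le_trans (H5 l k%:~R ll)); rewrite -[leRHS]mulrA ler_wpM2l// K5.
rewrite (_ : IL + (IM + IR) - E = IL + IR + (IM - EM) - (E - EM)); last by ring.
apply: (le_trans (ler_normB _ _)); apply: (le_trans (lerD (ler_normD _ _) (lexx _))).
rewrite -addrA; apply: (le_trans (lerD (ler_normD _ _) (lexx _))).
rewrite [leRHS](_ : _ = (C2 + C3 * D3 + C4 * D4 + C5 * D5) * s ^+ r.+2); last first.
  by rewrite mulrA [2 * pi * (_ / _)]mulrC divfK// gt_eqF// mulr_gt0.
by move: bL bR bM bE; lra.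
Qed.

End PathEdgeworth.

(** * The limit function of one realization *)

Section LimitDomain.
Context {R : realType}.

(** The function [e^b (1 - b)] is strictly increasing for [b <= 0] and strictly
    decreasing for [b >= 0]: two roots lie on different sides of 0. *)
Lemma root_signs (bm bp : R) : bm < bp -> 2 * expR bm * (1 - bm) = 1 ->
  2 * expR bp * (1 - bp) = 1 -> bm < 0 < bp.
Proof.
move=> lt em ep.
have em0 := expR_gt0 bm; have ep0 := expR_gt0 bp.
have d0 : bp - bm != 0 by rewrite gt_eqF// subr_gt0.
have e1 : expR bp = expR bm * expR (bp - bm) by rewrite -expRD addrC subrK.
have e2 : expR bm = expR bp * expR (bm - bp) by rewrite -expRD addrC subrK.
have h1 := expR_gt1Dx d0.
have h2 : 1 + (bm - bp) < expR (bm - bp) by apply: expR_gt1Dx; rewrite -opprB oppr_eq0.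
have pm : 0 < 1 - bm.
  by rewrite -(pmulr_rgt0 _ (_ : 0 < 2 * expR bm)) ?em// mulr_gt0.
have pp : 0 < 1 - bp.
  by rewrite -(pmulr_rgt0 _ (_ : 0 < 2 * expR bp)) ?ep// mulr_gt0.
have eq : expR bm * (1 - bm) = expR bp * (1 - bp) by lra.
apply/andP; split; rewrite ltNge; apply/negP => h.
- have : expR bp * ((1 - bm) * (1 + (bm - bp))) < expR bp * ((1 - bm) * expR (bm - bp)).
    by rewrite ltr_pM2l// ltr_pM2l.
  have -> : expR bp * ((1 - bm) * expR (bm - bp)) = expR bm * (1 - bm) by rewrite [in RHS]e2; ring.
  rewrite eq ltr_pM2l// ltNge => /negP; apply.
  have : 0 <= bm * (bp - bm) by rewrite mulr_ge0// subr_ge0 ltW.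
  nra.
- have : expR bm * ((1 - bp) * (1 + (bp - bm))) < expR bm * ((1 - bp) * expR (bp - bm)).
    by rewrite ltr_pM2l// ltr_pM2l.
  have -> : expR bm * ((1 - bp) * expR (bp - bm)) = expR bp * (1 - bp) by rewrite [in RHS]e1; ring.
  rewrite -eq ltr_pM2l// ltNge => /negP; apply.
  have : 0 <= - bp * (bp - bm) by apply: mulr_ge0; [rewrite oppr_ge0|rewrite subr_ge0 ltW].
  nra.
Qed.

Lemma cos_near_one (u : R) : `|u| <= 8^-1 -> 3 / 2 <= 4 * cos u - 2.
Proof.
move=> u8; have := cos_second_order 0 u; rewrite add0r cos0 sin0 mulr0 addr0 => h.
have e8 : expR `|u| <= 2.
  have := expR_ge1Dx (- `|u|); rewrite expRN => g.
  have p : 2^-1 <= (expR `|u|)^-1 by lra.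
  by rewrite -lef_pV2 ?posrE ?expR_gt0.
have u2 : u ^+ 2 <= 8^-1 ^+ 2.
  by rewrite -(real_normK (num_real u)) lerXn2r ?nnegrE.
have : u ^+ 2 * expR `|u| <= 8^-1 ^+ 2 * 2 by rewrite ler_pM ?sqr_ge0 ?expR_ge0.
move: h; rewrite ler_norml => /andP[h _] g; lra.
Qed.

Lemma cos_le_outside (d0 u : R) : 0 < d0 -> d0 <= `|u| -> `|u| <= pi -> cos u <= cos d0.
Proof.
move=> d00 du upi; have := @one_minus_cos_ge R d0 u; rewrite (ltW d00) du => /(_ isT upi); lra.
Qed.

Lemma open_disc (D : set R[i]^o) : open D -> D 0 -> exists d1 : R, 0 < d1 /\
  forall z : R[i]^o, cabs z < d1 -> D z.
Proof.
move=> oD D0; have /nbhs_ballP[e /= e0 he] : nbhs (0 : R[i]^o) D by exact: open_nbhs_nbhs.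
have [eIm eRe] := gt0_complex e0.
exists (complex.Re e); split=> // z zd; apply: he; rewrite -ball_normE /= sub0r normrN.
by rewrite normr_cabs ltcE/= eIm eqxx.
Qed.

Lemma uniform_eventually (K : set R[i]^o) (f_ : nat -> R[i]^o -> R[i]^o) (f : R[i]^o -> R[i]^o) :
  {uniform K, f_ @ \oo --> f} -> forall e : R, 0 < e ->
  exists N, forall n, (N <= n)%N -> forall z, K z -> cabs (f_ n z - f z) <= e.
Proof.
move=> h e e0.
have eC : 0 < e%:C :> R[i] by rewrite ltcR.
have /h[N _ hN] : nbhs (f : {uniform` K -> R[i]^o})
    [set g : {uniform` K -> R[i]^o} | forall z, K z -> ball (f z) e%:C (g z)].
  apply/uniform_nbhs; exists [set xy | ball xy.1 e%:C xy.2]; split => //.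
  exact: (entourage_ball _ (PosNum eC)).
exists N => n Nn z Kz; have := hN n Nn z Kz.
by rewrite -ball_normE /= distrC normr_cabs ltcR => /ltW.
Qed.

Lemma cont_iu_plane : continuous (fun u : R => iu u : R[i]^o).
Proof.
move=> x; apply/cvgrPdist_lt => e e0.
have [eIm eRe] := gt0_complex e0.
near=> y.
have -> : iu x - iu y = iu (x - y) by apply: eq_ReIm => /=; ring.
rewrite normr_cabs cabs_iu ltcE/= eIm eqxx/=.
by near: y; apply: cvgr_dist_lt => //; exact: cvg_id.
Unshelve. all: by end_near.
Qed.

Lemma compact_imaginary_segment (d0 : R) :
  compact [set (iu u : R[i]^o) | u in `[- d0, d0]].
Proof.
apply: continuous_compact; last exact: segment_compact.
by apply: continuous_subspaceT; exact: cont_iu_plane.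
Qed.

Lemma analytic_power_series (D : set R[i]^o) (f : R[i]^o -> R[i]^o) : analytic_on D f -> D 0 ->
  exists (a : nat -> R[i]) (rho : R), 0 < rho /\ is_power_series rho a f.
Proof.
move=> af D0; have [a [rho [rho0 h]]] := af 0 D0.
have hp (z : R[i]) : cabs z < rho -> clim (psum a z) (f z).
  move=> zr; have := h z; rewrite normr_cabs ltcR => /(_ zr); rewrite add0r => hz.
  apply/climP; have <- : series (fun k => a k * z ^+ k) = psum a z; last exact: hz.
  by apply/funext => n; rewrite /series /psum /= big_mkord.
exists a, rho; split => //; split => //.
by apply: cvg_coef_bounded => z zr; exists (f z); exact: hp.
Qed.

Lemma power_series_shrink (rho rho' : R) (a : nat -> R[i]) f : rho' <= rho -> is_power_series rho a f -> is_power_series rho' a f.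
Proof.
move=> rr [b h]; split.
  by move=> r /andP[r0 r1]; apply: b; rewrite r0 (lt_le_trans r1).
by move=> z zr; apply: h; exact: lt_le_trans rr.
Qed.

End LimitDomain.

Section Limit.
Context {R : realType} {d : measure_display} {T : measurableType d}.
Context {V : nat -> T -> node} {w : T}.
Local Notation H n := (hist (V := V) n w).
Hypothesis Hh : forall n, H n \in histories n.

Lemma W_Wh n (u : R) : W_ V n w (iu u) = Wh n (H n) u.
Proof. by rewrite /W_ /Wh bst_ext_hist /alpha; congr (cexp _ * _). Qed.

Lemma W_real n (b : R) : complex.Im (W_ V n w b%:C) = 0.
Proof.
rewrite /W_ cexp_real.
have -> : - (2 * (expR b)%:C - 1) * (ln n%:R)%:C = (- (2 * expR b - 1) * ln n%:R)%:C :> R[i].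
  by rewrite rmorphM rmorphN rmorphB rmorphM/= (rmorph_nat (real_complex R)).
rewrite cexp_real Im_realM Im_sum big1 ?mulr0// => v _.
by rewrite -(rmorph_nat (real_complex R)) -rmorphM cexp_real.
Qed.

Lemma W_at0 n : (0 < n)%N -> W_ V n w 0 = (n.+1%:R / n%:R)%:C :> R[i].
Proof.
move=> n0; rewrite /W_ cexp0 bst_ext_hist.
under eq_bigr do rewrite mul0r cexp0.
rewrite big_const_seq count_predT iter_addr_0 (size_ext_of (Hh n)).
have -> : - (2 * 1 - 1) * (ln n%:R)%:C = (- ln n%:R)%:C :> R[i] by rewrite rmorphN/=; ring.
rewrite cexp_real expRN lnK ?posrE ?ltr0n// mulrC rmorphM/= -mulr_natl.
by rewrite (rmorph_nat (real_complex R)); ring.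
Qed.

Variables (D : set R[i]^o) (f : R[i]^o -> R[i]^o) (d1 : R).
Hypotheses (d10 : 0 < d1) (discD : forall z : R[i]^o, cabs z < d1 -> D z).
Hypothesis af : analytic_on D f.
Hypothesis Wf : forall K : set R[i]^o, compact K -> K `<=` D ->
    {uniform K, (fun n => W_ V n w) @ \oo --> f}.

Lemma W_pointwise (z : R[i]^o) : cabs z < d1 -> forall e : R, 0 < e ->
  exists N, forall n, (N <= n)%N -> cabs (W_ V n w z - f z) <= e.
Proof.
move=> zd e e0.
have [|N hN] := uniform_eventually (Wf (@compact_set1 _ z) _) e0.
  by move=> _ ->; exact: discD.
by exists N => n Nn; exact: hN.
Qed.

(** Each [W_ n] is real on the real axis and is [(n + 1) / n] at 0; both facts
    pass to the limit, with compact sets reduced to points. *)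
Lemma limit_power_series : exists (a : nat -> R[i]) (rho : R),
  [/\ 0 < rho, is_power_series rho a f, forall j, complex.Im (a j) = 0 & a 0%N = 1].
Proof.
have D0 : D 0 by apply: discD; rewrite Normc.normc0.
have [a [rho [rho0 aF]]] := analytic_power_series af D0.
exists a, (Num.min rho d1).
have m0 : 0 < Num.min rho d1 by rewrite lt_min rho0.
have aF' : is_power_series (Num.min rho d1) a f.
  by apply: power_series_shrink aF; rewrite ge_min lexx.
split => //.
- apply: (power_series_real_coef m0 aF') => b; rewrite lt_min => /andP[_ bd].
  apply/eqP; rewrite -normr_le0 leNgt; apply/negP => lt.
  have [N /(_ N (leqnn N)) hN] := @W_pointwise b%:C ltac:(by rewrite cabs_real) _ (divr_gt0 lt (ltr0n _ 2)).
  have := le_trans (Im_le_cabs _) hN; rewrite ImB W_real sub0r normrN.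
  move: lt; set x := `|_|; clearbody x; lra.
rewrite -(power_series_at0 rho0 aF).
apply/eqP; rewrite -subr_eq0; apply/eqP/Normc.eq0_normc/eqP.
rewrite eq_le cabs_ge0 andbT leNgt; apply/negP => lt.
have [N hN] := @W_pointwise 0 ltac:(by rewrite Normc.normc0) _ (divr_gt0 lt (ltr0n _ 4)).
(* A time at which [1 / n] is at most a quarter of the distance to 1. *)
pose n := maxn N (Num.bound (4 / cabs (f 0 - 1))).+1.
have n0 : (0 < n)%N by rewrite leq_max orbT.
have := hN n (leq_maxl _ _); rewrite W_at0// => h1.
have h2 : cabs ((n.+1%:R / n%:R)%:C - 1 : R[i]) <= cabs (f 0 - 1) / 4.
  rewrite -(rmorph1 (real_complex R)) -rmorphB cabs_real -natr1 mulrDl divff ?pnatr_eq0 -?lt0n//.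
  rewrite addrC addKr mul1r ger0_norm ?invr_ge0//.
  rewrite -[cabs _ / 4]invrK invf_div lef_pV2 ?posrE ?divr_gt0 ?ltr0n//.
  apply: (le_trans (ltW (archi_boundP _))); first by rewrite divr_ge0 ?cabs_ge0.
  by rewrite ler_nat leq_max leqnSn orbT.
have tri : cabs (f 0 - 1) <= cabs ((n.+1%:R / n%:R)%:C - f 0) + cabs ((n.+1%:R / n%:R)%:C - 1).
  by rewrite [X in _ <= X + _]cabs_distC; exact: cabs_dist_triangle.
lra.
Qed.

Lemma limit_segment (d0 : R) : d0 < d1 -> forall e : R, 0 < e -> exists N, forall n, (N <= n)%N ->
  forall u, `|u| <= d0 -> cabs (Wh n (H n) u - f (iu u)) <= e.
Proof.
move=> dd e e0.
have [|N hN] := uniform_eventually (Wf (@compact_imaginary_segment R d0) _) e0.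
  move=> _ /= [u + <-]; rewrite in_itv/= -ler_norml => ud; apply: discD.
  by rewrite cabs_iu (le_lt_trans ud).
exists N => n Nn u ud; rewrite -W_Wh; apply: hN => //.
by exists u => //=; rewrite in_itv/= -ler_norml.
Qed.

End Limit.

(** * The terms of the expansion *)

Section EdgeworthTerms.
Context {R : realType}.
Implicit Types (l x : R).

Lemma powR_half l j : 0 < l -> l `^ (j%:R / 2) = Num.sqrt l ^+ j.
Proof.
move=> l0; rewrite mulrC powRrM powR12_sqrt ?(ltW l0)// powR_mulrn// sqrtr_ge0.
Qed.

(** With [l = log n], the Poisson parameter is [2 l]: the scale [sqrt (2 l)]
    splits into the factor [sqrt 2] in [G_hermite] and the powers of [sqrt l]. *)
Lemma edge_density_G (c w : nat -> R) r l x : 0 < l -> (forall j, exp_coefs c w j) ->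
  edge_density w r (2 * l) x / (2 * pi) =
  expR (- ((x - 2 * l) ^+ 2 / (4 * l))) / Num.sqrt (4 * pi * l) *
  \sum_(j < r.+1) G c j ((x - 2 * l) / Num.sqrt (2 * l)) / l `^ (j%:R / 2).
Proof.
move=> l0 cw; have pi0 := pi_gt0 R.
have sl : Num.sqrt (2 * l) = Num.sqrt 2 * Num.sqrt l by rewrite sqrtrM.
have s20 : 0 < Num.sqrt (2 : R) by rewrite sqrtr_gt0.
have sl0 : 0 < Num.sqrt l by rewrite sqrtr_gt0.
have s2l0 : 0 < Num.sqrt (2 * l) by rewrite sqrtr_gt0 mulr_gt0.
have s2l : Num.sqrt (2 * l) ^+ 2 = 2 * l by rewrite sqr_sqrtr// mulr_ge0// ltW.
set y := x - 2 * l; set z := y / _.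
have -> : edge_density w r (2 * l) x = Num.sqrt (2 * pi / (2 * l)) * expR (- (y ^+ 2 / (4 * l))) *
   \sum_(j < r.+1) G c j z / l `^ (j%:R / 2).
  rewrite /edge_density mulr_sumr; apply: eq_bigr => j _.
  rewrite (G_hermite _ (cw j)) powR_half// mulr_sumr mulr_suml mulr_sumr; apply: eq_bigr => m _.
  rewrite /gauss_fourier -/y -/z.
  have -> : 2 * (2 * l) = 4 * l by ring.
  have e1 : (2 * l) ^+ m * (Num.sqrt (2 * l))^-1 ^+ (j + 2 * m) =
     (Num.sqrt 2)^-1 ^+ j / Num.sqrt l ^+ j.
    have -> : (2 * l) ^+ m = Num.sqrt (2 * l) ^+ (2 * m) by rewrite exprM s2l.
    rewrite exprD mulrCA -exprMn divff ?gt_eqF// expr1n mulr1.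
    by rewrite sl invfM exprMn; congr (_ * _); rewrite exprVn.
  rewrite -[X in _ * X = _]mulrA.
  transitivity (Num.sqrt (2 * pi / (2 * l)) * expR (- (y ^+ 2 / (4 * l))) *
    (kappa w j m * (hermite (j + 2 * m)).[z] * ((2 * l) ^+ m * (Num.sqrt (2 * l))^-1 ^+ (j + 2 * m)))).
    by ring.
  by rewrite e1; ring.
have -> : Num.sqrt (2 * pi / (2 * l)) = 2 * pi / Num.sqrt (4 * pi * l).
  have p4 : 0 < 4 * pi * l by rewrite !mulr_gt0.
  rewrite (_ : 2 * pi / (2 * l) = (2 * pi) ^+ 2 / (4 * pi * l)); last first.
    by apply/eqP; rewrite eqr_div ?lt0r_neq0 ?mulr_gt0//; apply/eqP; ring.
  rewrite sqrtrM ?sqr_ge0// sqrtr_sqr ger0_norm ?mulr_ge0 ?(ltW pi0)//.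
  by rewrite sqrtrV// ltW.
set A := (Num.sqrt (4 * pi * l))^-1; set B := expR _; set S := \sum_(_ < _) _.
rewrite [LHS](_ : _ = (2 * pi)^-1 * (2 * pi * (B * A * S))); last by ring.
by rewrite mulKf// lt0r_neq0// mulr_gt0.
Qed.

(** The coefficient of [x^t] and of the [i]-th derivative of the limit
    in the polynomial [G]. *)
Definition G_coef (j t i : nat) : R :=
  (Num.sqrt 2)^-1 ^+ j * \sum_(m < j.+1)
    m`!%:R^-1 * (third_order_tail j ^+ m)`_(j - i) * i`!%:R^-1 * (hermite (j + 2 * m))`_t.

(** The function [v] stands for the derivatives of the limit at 0, whence
    [v 0 = 1]. *)
Lemma G_expansion (c w v : nat -> R) j x : exp_coefs c w j -> v 0%N = 1 ->
  (forall i, w i = v i / i`!%:R) ->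
  G c j x = \sum_(t < (3 * j).+1)
    (G_coef j t 0 + \sum_(1 <= i < j.+1) G_coef j t i * v i) * x ^+ t.
Proof.
move=> cw v0 wv; rewrite (G_hermite x cw).
have hs m : (m < j.+1)%N -> (hermite (j + 2 * m)).[x] = \sum_(t < (3 * j).+1) (hermite (j + 2 * m))`_t * x ^+ t :> R.
  move=> mj; apply: horner_coef_wide; apply: (leq_trans (size_hermite _)); lia.
transitivity (\sum_(t < (3 * j).+1) (\sum_(i < j.+1) G_coef j t i * v i) * x ^+ t); last first.
  apply: eq_bigr => t _; rewrite big_ord_recl/= v0 mulr1; congr ((_ + _) * _).
  by rewrite big_add1/= big_mkord.
under eq_bigr => m _ do rewrite hs// /kappa.
rewrite mulr_sumr.
transitivity (\sum_(m < j.+1) \sum_(t < (3 * j).+1) \sum_(i < j.+1)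
  ((Num.sqrt 2)^-1 ^+ j * (m`!%:R^-1 * (third_order_tail j ^+ m)`_(j - i) * i`!%:R^-1 * (hermite (j + 2 * m))`_t)
   * v i * x ^+ t)).
  apply: eq_bigr => m _; rewrite !mulr_sumr; apply: eq_bigr => t _.
  rewrite (reindex_inj rev_ord_inj)/= mulr_suml mulr_sumr; apply: eq_bigr => i _.
  rewrite !subSS subKn ?wv; last by rewrite -ltnS.
  by ring.
rewrite exchange_big/=; apply: eq_bigr => t _.
rewrite exchange_big/= mulr_suml; apply: eq_bigr => i _.
by rewrite /G_coef mulr_sumr !mulr_suml; apply: eq_bigr => m _; ring.
Qed.

Lemma G_at0 (c w : nat -> R) x : exp_coefs c w 0 -> G c 0 x = 1.
Proof.
move=> cw; rewrite (G_hermite x cw) big_ord1 /kappa big_ord1 /= !expr0 coef1 eqxx cw.1 fact0.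
by rewrite (hornerC (1 : R)) invr1 /= !mulr1.
Qed.

Lemma G_at1 (c w : nat -> R) x : exp_coefs c w 1 ->
  G c 1 x = (Num.sqrt 2)^-1 * (w 1%N * x + (x ^+ 3 - 3 * x) / 6).
Proof.
move=> cw.
have h1 : (hermite 1 : {poly R}) = 'X by rewrite /= mulr1 derivC subr0.
have h3 : (hermite 3).[x] = x ^+ 3 - 3 * x :> R.
  by rewrite !hermite_rec h1 !hornerE /=; ring.
have k0 : kappa w 1 0 = w 1%N.
  by rewrite /kappa !big_ord_recl big_ord0 expr0 !coef1 fact0 invr1 /= mul1r mul1r mul0r addr0 addr0 subn0.
have k1 : kappa w 1 1 = 6^-1.
  rewrite /kappa !big_ord_recl big_ord0 expr1 !coef_poly /= mul0r add0r addr0 cw.1.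
  by rewrite /bump /= !factS fact0; field.
rewrite (G_hermite x cw) big_ord_recl big_ord1 expr1.
rewrite (_ : kappa w 1 (lift ord0 ord0) = 6^-1)// (_ : kappa w 1 ord0 = w 1%N)//.
rewrite (_ : hermite (1 + 2 * (ord0 : 'I_2)) = 'X)// hornerX.
rewrite (_ : (hermite (1 + 2 * lift ord0 (ord0 : 'I_1))).[x] = x ^+ 3 - 3 * x)//.
by congr (_ * (_ + _)); rewrite mulrC.
Qed.

End EdgeworthTerms.

(** * Convergence of the rescaled suprema *)

Section Conclusion.
Context {R : realType}.

Lemma ln_eventually (M : R) : exists N, forall n, (N <= n)%N -> M <= ln (n%:R : R).
Proof.
exists (Num.bound (expR M)) => n nN.
have e : expR M <= n%:R :> R.
  by apply: (le_trans (ltW (archi_boundP (expR_ge0 M)))); rewrite ler_nat.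
have n0 : 0 < n%:R :> R by rewrite (lt_le_trans _ e)// expR_gt0.
by rewrite -[leLHS]expRK ler_ln ?posrE ?expR_gt0.
Qed.

Lemma inv_sqrt_ln_cvg0 (C : R) : C * (Num.sqrt (2 * ln n%:R))^-1 @[n --> \oo] --> (0 : R).
Proof.
apply/cvgrPdist_le => e e0.
pose M := `|C| / e.
have M0 : 0 <= M by rewrite divr_ge0// ltW.
have [N hN] := ln_eventually (M ^+ 2 + 1).
exists N => // n /= Nn; have l := hN n Nn.
rewrite sub0r normrN normrM.
have l0 : 0 < ln (n%:R : R) by apply: lt_le_trans l; rewrite ltr_wpDl// sqr_ge0.
have s0 : 0 < Num.sqrt (2 * ln (n%:R : R)) by rewrite sqrtr_gt0 mulr_gt0.
have sM : M <= Num.sqrt (2 * ln (n%:R : R)).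
  rewrite -[leLHS]ger0_norm// -sqrtr_sqr; apply: ler_wsqrtr; lra.
rewrite normfV (gtr0_norm s0) ler_pdivrMr//.
by move: sM; rewrite /M ler_pdivrMr// mulrC.
Qed.

(** The bound is smaller than the rescaling by a power of [l^(-1/2)]. *)
Lemma rescaled_sup_cvg0 (A : nat -> int -> R) (C : R) N0 r : 0 <= C ->
  (forall n, (N0 <= n)%N -> forall k, `|A n k| <= C * (Num.sqrt (2 * ln n%:R))^-1 ^+ r.+2) ->
  (fun n : nat => ((ln n%:R : R) `^ (r.+1%:R / 2))%:E *
     ereal_sup [set (`|A n k|)%:E | k in [set: int]])%E @ \oo --> (0 : \bar R).
Proof.
move=> C0 H; apply: (@squeeze_cvge _ \oo _ R (cst 0%E) _ (fun n => (C * (Num.sqrt (2 * ln n%:R))^-1)%:E)).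
- have [N1 HN1] := @ln_eventually 1.
  exists (maxn N0 N1) => // n /=; rewrite geq_max => /andP[n0 n1].
  have l0 : 0 < ln (n%:R : R) by apply: lt_le_trans (HN1 n n1).
  set l := ln _ in l0 *.
  have s0 : 0 < Num.sqrt l by rewrite sqrtr_gt0.
  have t0 : 0 < Num.sqrt (2 * l) by rewrite sqrtr_gt0 mulr_gt0.
  have sup0 : (0 <= ereal_sup [set (`|A n k|)%:E | k in [set: int]])%E.
    apply: (@le_trans _ _ (`|A n 0|)%:E); first by rewrite lee_fin.
    by apply: ereal_sup_ubound; exists 0.
  apply/andP; split; first by rewrite mule_ge0// lee_fin powR_ge0.
  apply: (@le_trans _ _ ((l `^ (r.+1%:R / 2))%:E * (C * (Num.sqrt (2 * l))^-1 ^+ r.+2)%:E)%E).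
    apply: lee_wpmul2l; first by rewrite lee_fin powR_ge0.
    by apply: ge_ereal_sup => _ [k _ <-]; rewrite lee_fin; exact: H.
  rewrite -EFinM lee_fin powR_half// mulrCA ler_wpM2l// [(Num.sqrt (2 * l))^-1 ^+ r.+2]exprSr mulrA.
  rewrite -[leRHS]mul1r ler_wpM2r ?invr_ge0 ?(ltW t0)//.
  rewrite -exprMn; apply: exprn_ile1; first by apply: mulr_ge0; rewrite ?invr_ge0 ltW.
  rewrite ler_pdivrMr// mul1r; apply: ler_wsqrtr; lra.
- exact: cvg_cst.
- by apply: cvg_EFin; [exact: nearW|exact: inv_sqrt_ln_cvg0].
Qed.

(** On [|u| <= d0] the growth exponent [4 cos u - 2] is at least 3/2, which
    [Wh_increment] requires; outside it is at most some [p < 2], so that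
    [S_n / n] decays there.  The exponent [q] of the blocks makes all error
    bounds summable. *)
Lemma segment_parameters (d1 : R) : 0 < d1 -> exists (d0 p : R) (q : nat),
  [/\ 0 < d0 <= pi, d0 < d1, forall u, `|u| <= d0 -> 3 / 2 <= 4 * cos u - 2 &
   [/\ 3 / 2 <= p, 8 <= q%:R * (2 - p), (16 <= q)%N &
     forall u, d0 <= `|u| -> `|u| <= pi -> 4 * cos u - 2 <= p]].
Proof.
move=> d10; pose d0 := Num.min 8^-1 (Num.min (d1 / 2) pi).
have d00 : 0 < d0 by rewrite !lt_min invr_gt0 divr_gt0// pi_gt0 ltr0n.
have d08 : d0 <= 8^-1 by rewrite ge_min lexx.
have d01 : d0 <= d1 / 2 by rewrite !ge_min lexx orbT.
have d0pi : d0 <= pi by rewrite !ge_min lexx !orbT.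
pose p := Num.max (3 / 2) (4 * cos d0 - 2).
have p2 : p < 2.
  rewrite gt_max; apply/andP; split; first lra.
  have := @one_minus_cos_gt0 R d0; rewrite d00 d0pi => /(_ isT); lra.
have tp : 0 < 2 - p by lra.
pose q := maxn 16 (Num.bound (8 / (2 - p))).
exists d0, p, q; split.
- by rewrite d00.
- lra.
- by move=> u ud; apply: cos_near_one; exact: le_trans d08.
- split.
  + by rewrite le_max lexx.
  + rewrite -ler_pdivrMr//; apply: (le_trans (ltW (archi_boundP _))); first by rewrite divr_ge0// ltW.
    by rewrite ler_nat leq_maxr.
  + by rewrite leq_maxl.
  + move=> u du upi; rewrite le_max; apply/orP; right.
    have := cos_le_outside d00 du upi; lra.
Qed.

End Conclusion.

Theorem theorem1p1 (R : realType) (d : measure_display) (T : measurableType d)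
  (P : probability T R) (V : nat -> T -> node) (bstV : bst_process P V)
  (betam betap : R) (lt_beta : betam < betap)
  (betamE : 2 * expR betam * (1 - betam) = 1)
  (betapE : 2 * expR betap * (1 - betap) = 1)
  (D : set R[i]^o) (openD : open D)
  (D_beta : forall b : R, betam < b < betap -> D b%:C)
  (W : T -> R[i]^o -> R[i]^o) (W_lim : is_W_infty P V D W) :
  [/\ forall r : nat, {ae P, forall w,
        (fun n : nat =>
           let l : R := ln n%:R in
           ((l `^ (r.+1%:R / 2))%:E *
            ereal_sup [set
              (`| (profile V n k w)%:R / n%:R
                  - expR (- ((k%:~R - 2 * l) ^+ 2 / (4 * l)))
                    / Num.sqrt (4 * pi * l)
                    * \sum_(j < r.+1)
                        G (chi (W w)) j ((k%:~R - 2 * l) / Num.sqrt (2 * l))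
                        / l `^ (j%:R / 2) |)%:E
              | k in [set: int]])%E) @ \oo --> (0 : \bar R)},
      forall j : nat, exists a : nat -> nat -> R, {ae P, forall w,
        forall x : R, G (chi (W w)) j x =
          \sum_(m < (3 * j).+1)
            (a m 0%N + \sum_(1 <= i < j.+1) a m i * Wderiv (W w) i) * x ^+ m},
      {ae P, forall w, forall x : R, G (chi (W w)) 0 x = 1}
    & {ae P, forall w, forall x : R, G (chi (W w)) 1 x =
        (Num.sqrt 2)^-1 * (Wderiv (W w) 1 * x + (x ^+ 3 - 3 * x) / 6)}].
Proof.
have D0 : D 0 by exact: (D_beta 0 (root_signs lt_beta betamE betapE)).
have [d1 [d10 disc]] := open_disc openD D0.
have [[analW _] unifW] := W_lim.
have hists := ae_histories bstV.
have series_facts : {ae P, forall w, exists (a : nat -> R[i]) (rho : R),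
    [/\ 0 < rho, is_power_series rho a (W w), forall j, complex.Im (a j) = 0 & a 0%N = 1]}.
  apply: filterS2 hists unifW => w Hh Wc.
  exact: (limit_power_series Hh d10 disc (analW w) Wc).
have wderiv (w : T) a rho : 0 < rho -> is_power_series rho a (W w) ->
    forall i, complex.Re (a i) = Wderiv (W w) i / i`!%:R.
  move=> rho0 aF i; rewrite /Wderiv (power_series_derive1n_at0 i rho0 aF).
  rewrite -(rmorph_nat (real_complex R)) Re_realM mulrC mulKf// pnatr_eq0 -lt0n.
split.
- move=> r.
  have [d0 [p [q [/andP[d00 d0pi] dd hin [p32 qp q16 hout]]]]] := segment_parameters d10.
  have q0 : (0 < q)%N by exact: leq_trans q16.
  have npd : - pi <= - d0 by lra.
  have hl (u : R) : - pi <= u <= - d0 -> 4 * cos u - 2 <= p.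
    by move=> /andP[u1 u2]; apply: hout; rewrite ler0_norm; lra.
  have hr (u : R) : d0 <= u <= pi -> 4 * cos u - 2 <= p.
    by move=> /andP[u1 u2]; apply: hout; rewrite ger0_norm; lra.
  have hI := ae_inner bstV d00 q16 hin.
  have hL := ae_outer bstV npd p32 qp hl.
  have hR := ae_outer bstV d0pi p32 qp hr.
  apply: filter_app hists; apply: filter_app unifW.
  apply: filterS3 hI hL hR => w I L L' Wc Hh.
  have [a [rho [rho0 aF areal a0]]] := limit_power_series Hh d10 disc (analW w) Wc.
  have d0pi' : 0 < d0 <= pi by rewrite d00.
  have seg := limit_segment disc Wc dd.
  have [C [N0 [C0 HC]]] := path_edgeworth r Hh rho0 aF areal q0 d0pi' seg I L L'.
  have [N1 HN1] := @ln_eventually R 1.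
  apply: (rescaled_sup_cvg0 (N0 := maxn N0 N1) C0) => n; rewrite geq_max => /andP[n0 n1] k.
  have l0 : 0 < ln (n%:R : R) by apply: lt_le_trans (HN1 n n1).
  rewrite -(edge_density_G r k%:~R l0 (fun j => exp_coefs_chi j rho0 aF a0)).
  by rewrite /profile bst_ext_hist; exact: HC.
- move=> j; exists (G_coef j); apply: filterS series_facts => w [a [rho [rho0 aF areal a0]]] x.
  apply: (G_expansion x (exp_coefs_chi j rho0 aF a0)); last exact: wderiv rho0 aF.
  have := wderiv w a rho rho0 aF 0%N; rewrite a0 fact0 invr1 mulr1 /= => <-.
  by [].
- apply: filterS series_facts => w [a [rho [rho0 aF areal a0]]] x.
  exact: G_at0 (exp_coefs_chi 0 rho0 aF a0).
- apply: filterS series_facts => w [a [rho [rho0 aF areal a0]]] x.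
  rewrite (G_at1 x (exp_coefs_chi 1 rho0 aF a0)) (wderiv w a rho rho0 aF 1%N).
  by rewrite invr1 mulr1.
Qed.
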